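(* Let $M$ be a finite von Neumann algebra with faithful normal trace $\tau$, let $\mathcal{A}\subseteq M$ be a $\sigma$-weakly dense unital $\ast$-subalgebra with C$^\ast$-closure $A$, and let $\partial:\mathcal{A}\to H$ be a closable derivation into an $\mathcal{A}$-$\mathcal{A}$ bimodule $H$. Assume that $\mathcal{A}$ has a linear basis $(e_i)_{i\in I}$ with $I$ countable that is orthonormal in $L_2(M)$, and let $S:\mathcal{A}\to H$ be the linear map with $S(e_i)=\partial(e_i)/\|\partial(e_i)\|$, where $S(e_i)$ is any unit vector in $H$ if $\partial(e_i)=0$. Assume that: (i) $H$ is weakly contained in the coarse bimodule of $M$ as $\mathcal{A}$-$\mathcal{A}$ bimodules, i.e. the assignment $x\otimes y^{\mathrm{op}}\in B(L_2(M)\otimes L_2(M))\mapsto xy^{\mathrm{op}}\in B(H)$, $x,y\in\mathcal{A}$, extends to a bounded $\ast$-homomorphism; (ii) $S$ is bounded as a map $L_2(M)\to H$ and $S^\ast S$ is a Fredholm operator on $L_2(M)$; (iii) for all $x,y\in\mathcal{A}$ the bounded operator $T_{x,y}:L_2(M)\to H$, $\xi\mapsto xS(\xi)y-S(x\xi y)$, is compact. Then there is a unital completely positive map $\theta:A\otimes_{\min}A^{\mathrm{op}}\to B(L_2(M))$ such that $\theta(a\otimes b^{\mathrm{op}})-ab^{\mathrm{op}}$ is compact for all $a,b\in A$.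
   Context: An $\mathcal{A}$-$\mathcal{A}$ bimodule is a Hilbert space $H$ with $\ast$-homomorphisms $\mathcal{A}\to B(H)$ and $\mathcal{A}^{\mathrm{op}}\to B(H)$ (left and right action) with commuting images; $xy^{\mathrm{op}}\in B(H)$ denotes the operator $\xi\mapsto x\xi y$. A derivation is a linear map $\partial$ with $\partial(ab)=a\partial(b)+\partial(a)b$; closable means closable as a densely defined operator from $L_2(M)$ to $H$. On $L_2(M)=L_2(M,\tau)$, $a$ and $b^{\mathrm{op}}$ act by left and right multiplication. The coarse bimodule is $L_2(M)\otimes L_2(M)$, with $x\otimes y^{\mathrm{op}}$ acting as left multiplication by $x$ on the first and right multiplication by $y$ on the second tensor factor. *)

(* Defs.v *)
From HB Require Import structures.
From mathcomp Require Import all_boot all_order all_algebra.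
From mathcomp Require Import complex.
From mathcomp Require Import all_classical all_reals all_analysis.

Set Implicit Arguments.
Unset Strict Implicit.
Unset Printing Implicit Defensive.

Import Order.TTheory GRing.Theory Num.Theory.
Import numFieldNormedType.Exports.
Local Open Scope classical_set_scope.
Local Open Scope ring_scope.

(* The inner product is linear in its first argument. Norms of vectors are
   elements of R[i]; in the partial order of R[i], [0 <= z] means that z is
   real and nonnegative. *)
HB.mixin Record isHilbert (R : realType) H & CompleteNormedModule R[i] H := {
  dotp : H -> H -> R[i] ;
  dotpDl : forall x y z : H, dotp (x + y) z = dotp x z + dotp y z ;
  dotpZl : forall (c : R[i]) (x y : H), dotp (c *: x) y = c * dotp x y ;
  dotpC : forall x y : H, dotp y x = (dotp x y)^* ;
  dotpE : forall x : H, dotp x x = `|x| ^+ 2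
}.

#[short(type="hilbertType")]
HB.structure Definition Hilbert (R : realType) :=
  {H of isHilbert R H & CompleteNormedModule R[i] H}.

Section Operators.
Context {R : realType}.

(* Operators are plain functions, so that the pointwise linear structure of
   the library, [\o] and [id] provide the algebra structure. *)
Definition bounded_op {H K : hilbertType R} : set (H -> K) :=
  [set T | linear T /\ continuous T].

(* The Hilbert space adjoint; it exists and is unique for T bounded. *)
Definition adj {H K : hilbertType R} (T : H -> K) : K -> H :=
  xget (cst 0) [set T' | forall x y, dotp (T x) y = dotp x (T' y)].

Definition positive_op {H : hilbertType R} (T : H -> H) : Prop :=
  bounded_op T /\ forall x, 0 <= dotp (T x) x.

Definition norm_le {H K : hilbertType R} (b : R[i]) (T : H -> K) : Prop :=
  forall x, `|T x| <= b * `|x|.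

Definition compact_op {H K : hilbertType R} (T : H -> K) : Prop :=
  bounded_op T /\ compact (closure (T @` [set x | `|x| <= 1])).

Definition lin_span {V : lmodType R[i]} (G : set V) : set V :=
  [set v | exists (n : nat) (c : 'I_n -> R[i]) (g : 'I_n -> V),
     (forall i, G (g i)) /\ v = \sum_(i < n) c i *: g i].

Definition finite_dim {V : lmodType R[i]} (W : set V) : Prop :=
  exists (n : nat) (u : 'I_n -> V), W `<=` lin_span (range u).

(* Finite-dimensional kernel, closed range, finite-dimensional cokernel. *)
Definition fredholm {H K : hilbertType R} (T : H -> K) : Prop :=
  [/\ bounded_op T,
      finite_dim [set x | T x = 0],
      closed (range T) &
      exists W : set K, finite_dim W /\
        forall y, exists (x : H) (w : K), W w /\ y = T x + w].

Definition norm_closure {H K : hilbertType R} (D : set (H -> K)) :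
    set (H -> K) :=
  [set T | bounded_op T /\
     forall e : R[i], 0 < e -> exists2 S, D S & norm_le e (T - S)].

Definition square_summable {H : hilbertType R} (x : nat -> H) : Prop :=
  cvgn (series (fun k => `|x k| ^+ 2 : R[i]^o)).

Definition vector_functional {H : hilbertType R} (x y : nat -> H)
    (T : H -> H) : R[i] :=
  limn (series (fun k => dotp (T (x k)) (y k) : R[i]^o)).

(* The sigma-weak topology is generated by the functionals
   T |-> \sum_k <T x_k, y_k> with x and y square summable. *)
Definition sigma_weak_closure {H : hilbertType R} (D : set (H -> H)) :
    set (H -> H) :=
  [set T | bounded_op T /\
     forall (n : nat) (x y : 'I_n -> nat -> H),
       (forall i, square_summable (x i)) ->
       (forall i, square_summable (y i)) ->
       forall e : R[i], 0 < e ->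
       exists2 S, D S & forall i, `|vector_functional (x i) (y i) (T - S)| < e].

Definition unital_star_subalgebra {H : hilbertType R} (D : set (H -> H)) :
    Prop :=
  D `<=` bounded_op /\
  [/\ D id,
      (forall S T, D S -> D T -> D (S + T)),
      (forall (c : R[i]) T, D T -> D (c *: T)),
      (forall S T, D S -> D T -> D (S \o T)) &
      (forall T, D T -> D (adj T))].

Definition von_neumann_algebra {H : hilbertType R} (M : set (H -> H)) : Prop :=
  unital_star_subalgebra M /\ sigma_weak_closure M `<=` M.

Definition linear_on {V W : lmodType R[i]} (D : set V) (f : V -> W) : Prop :=
  (forall x y, D x -> D y -> f (x + y) = f x + f y) /\
  (forall (c : R[i]) x, D x -> f (c *: x) = c *: f x).

(* Neither unitality nor boundedness is part of the definition. *)
Definition star_hom_on {H K : hilbertType R} (D : set (H -> H))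
    (f : (H -> H) -> (K -> K)) : Prop :=
  [/\ (forall T, D T -> bounded_op (f T)),
      linear_on D f,
      (forall S T, D S -> D T -> f (S \o T) = f S \o f T) &
      (forall T, D T -> f (adj T) = adj (f T))].

(* A *-homomorphism on the opposite algebra of D. *)
Definition star_antihom_on {H K : hilbertType R} (D : set (H -> H))
    (f : (H -> H) -> (K -> K)) : Prop :=
  [/\ (forall T, D T -> bounded_op (f T)),
      linear_on D f,
      (forall S T, D S -> D T -> f (S \o T) = f T \o f S) &
      (forall T, D T -> f (adj T) = adj (f T))].

Definition bimodule {K H : hilbertType R} (D : set (K -> K))
    (lft rgt : (K -> K) -> (H -> H)) : Prop :=
  [/\ star_hom_on D lft, star_antihom_on D rgt &
      forall a b, D a -> D b -> lft a \o rgt b = rgt b \o lft a].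

Definition derivation_on {K H : hilbertType R} (D : set (K -> K))
    (lft rgt : (K -> K) -> (H -> H)) (d : (K -> K) -> H) : Prop :=
  linear_on D d /\
  forall a b, D a -> D b -> d (a \o b) = lft a (d b) + rgt b (d a).

(* Least upper bound of D in the self-adjoint part of M. *)
Definition op_sup_in {H : hilbertType R} (M D : set (H -> H)) (s : H -> H) :
    Prop :=
  [/\ M s, (forall x, D x -> positive_op (s - x)) &
      forall u, M u -> adj u = u ->
        (forall x, D x -> positive_op (u - x)) -> positive_op (u - s)].

Definition directed_op {H : hilbertType R} (D : set (H -> H)) : Prop :=
  D !=set0 /\
  forall x y, D x -> D y ->
    exists z, [/\ D z, positive_op (z - x) & positive_op (z - y)].

(* A finite-valued faithful normal trace; only the values of tau on M matter. *)
Definition faithful_normal_trace {H : hilbertType R} (M : set (H -> H))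
    (tau : (H -> H) -> R[i]) : Prop :=
  [/\ (forall x y, M x -> M y -> tau (x + y) = tau x + tau y) /\
      (forall (c : R[i]) x, M x -> tau (c *: x) = c * tau x),
      (forall x, M x -> positive_op x -> 0 <= tau x),
      (forall x y, M x -> M y -> tau (x \o y) = tau (y \o x)),
      (forall x, M x -> tau (adj x \o x) = 0 -> x = 0) &
      (forall D s, D `<=` M -> (forall x, D x -> positive_op x) ->
         directed_op D -> op_sup_in M D s ->
         (forall x, D x -> tau x <= tau s) /\
         forall c : R[i], (forall x, D x -> tau x <= c) -> tau s <= c)].

(* L2 with the map eta is the Hilbert space completion of M for the inner
   product (x, y) |-> tau (y^* x); this determines (L2, eta) up to a unique
   unitary. *)
Definition is_L2_space {H L2 : hilbertType R} (M : set (H -> H))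
    (tau : (H -> H) -> R[i]) (eta : (H -> H) -> L2) : Prop :=
  [/\ linear_on M eta,
      (forall x y, M x -> M y -> dotp (eta x) (eta y) = tau (adj y \o x)) &
      closure (eta @` M) = setT].

(* The bounded operators on L2 extending left and right multiplication by an
   element of M; existence and uniqueness hold by density of eta @` M. *)
Definition L2_left {H L2 : hilbertType R} (M : set (H -> H))
    (eta : (H -> H) -> L2) (a : H -> H) : L2 -> L2 :=
  xget (cst 0) [set T | bounded_op T /\
    forall x, M x -> T (eta x) = eta (a \o x)].

Definition L2_right {H L2 : hilbertType R} (M : set (H -> H))
    (eta : (H -> H) -> L2) (b : H -> H) : L2 -> L2 :=
  xget (cst 0) [set T | bounded_op T /\
    forall x, M x -> T (eta x) = eta (x \o b)].

(* H with the map t is the Hilbert space tensor product of H1 and H2; this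
   determines (H, t) up to a unique unitary. *)
Definition is_hilbert_tensor {H1 H2 H : hilbertType R} (t : H1 -> H2 -> H) :
    Prop :=
  [/\ (forall y, linear (t ^~ y)),
      (forall x, linear (t x)),
      (forall x x' y y', dotp (t x y) (t x' y') = dotp x x' * dotp y y') &
      closure (lin_span [set z | exists x y, z = t x y]) = setT].

(* The bounded operator T1 (x) T2 on the Hilbert space tensor product. *)
Definition tensor_op {H1 H2 H : hilbertType R} (t : H1 -> H2 -> H)
    (T1 : H1 -> H1) (T2 : H2 -> H2) : H -> H :=
  xget (cst 0) [set T | bounded_op T /\
    forall x y, T (t x y) = t (T1 x) (T2 y)].

(* The linear span of the operators x (x) y^op, for x and y in D, on
   L2 (x) L2. *)
Definition coarse_span {K L2 LL : hilbertType R} (M : set (K -> K))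
    (eta : (K -> K) -> L2) (t : L2 -> L2 -> LL) (D : set (K -> K)) :
    set (LL -> LL) :=
  lin_span [set T | exists x y,
    [/\ D x, D y & T = tensor_op t (L2_left M eta x) (L2_right M eta y)]].

(* The minimal (spatial) tensor product of A and A^op, in the faithful
   representations of A and A^op on L2. *)
Definition min_tensor_op {K L2 LL : hilbertType R} (M : set (K -> K))
    (eta : (K -> K) -> L2) (t : L2 -> L2 -> LL) (A : set (K -> K)) :
    set (LL -> LL) :=
  norm_closure (coarse_span M eta t A).

Definition weakly_contained_in_coarse {K H L2 LL : hilbertType R}
    (M : set (K -> K)) (eta : (K -> K) -> L2) (t : L2 -> L2 -> LL)
    (D : set (K -> K)) (lft rgt : (K -> K) -> (H -> H)) : Prop :=
  exists Phi : (LL -> LL) -> (H -> H),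
    [/\ star_hom_on (coarse_span M eta t D) Phi,
        (exists2 c : R[i], 0 <= c & forall T (b : R[i]),
           coarse_span M eta t D T -> 0 <= b -> norm_le b T ->
           norm_le (c * b) (Phi T)) &
        forall x y, D x -> D y ->
          Phi (tensor_op t (L2_left M eta x) (L2_right M eta y))
          = lft x \o rgt y].

Definition closable_on {K L2 H : hilbertType R} (eta : (K -> K) -> L2)
    (D : set (K -> K)) (d : (K -> K) -> H) : Prop :=
  forall (a : nat -> (K -> K)) (h : H), (forall n, D (a n)) ->
    (fun n => eta (a n)) @ \oo --> (0 : L2) ->
    (fun n => d (a n)) @ \oo --> h -> h = 0.

Definition linear_basis {V : lmodType R[i]} {I : choiceType} (D : set V)
    (e : I -> V) : Prop :=
  [/\ (forall i, D (e i)),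
      (forall (s : seq I) (c : I -> R[i]), uniq s ->
         \sum_(i <- s) c i *: e i = 0 -> forall i, i \in s -> c i = 0) &
      D `<=` lin_span (range e)].

Definition orthonormal_family {I : eqType} {H : hilbertType R} (v : I -> H) : Prop :=
  forall i j, dotp (v i) (v j) = (i == j)%:R.

(* Positivity of a matrix of operators, i.e. of the operator it defines on the
   n-fold direct sum of H. *)
Definition positive_mx {H : hilbertType R} (n : nat) (X : 'M[H -> H]_n) :
    Prop :=
  forall v : 'I_n -> H,
    0 <= \sum_(i < n) \sum_(j < n) dotp (X i j (v j)) (v i).

Definition completely_positive_on {H K : hilbertType R} (D : set (H -> H))
    (f : (H -> H) -> (K -> K)) : Prop :=
  [/\ (forall T, D T -> bounded_op (f T)), linear_on D f &
      forall (n : nat) (X : 'M[H -> H]_n), (forall i j, D (X i j)) ->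
        positive_mx X -> positive_mx (map_mx f X)].

Definition ucp_on {H K : hilbertType R} (D : set (H -> H))
    (f : (H -> H) -> (K -> K)) : Prop :=
  completely_positive_on D f /\ f id = id.

End Operators.

(* Main.v *)
(* The idea.  Write [lam x y] for the operator [x y^op] on [L2], [S] for the
   bounded extension [Sb], and [Phi] for the homomorphism [x (x) y^op |-> x y^op]
   into [B(H)].  Condition (iii) gives [Phi (x (x) y^op) S - S lam x y] compact;
   taking adjoints, [S^* S] commutes with every [lam x y] modulo the compacts.
   Since [S^* S] is Fredholm, [S^* S + G] is coercive for some positive [G] of
   finite rank.  Its inverse square root [N] again commutes with the [lam x y]
   modulo the compacts, so [V = S N] is a contraction with [1 - V^* V] compact
   that intertwines [lam] and [Phi] modulo the compacts.  Then
     [theta T = V^* (Phi T) V + <T zeta, zeta> (1 - V^* (Phi 1) V)],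
   for a unit vector [zeta], is unital, and its second term is compact because
   [Phi 1 V - V] is.  Boundedness of [Phi] extends it to the norm closure; as
   [Phi] is a homomorphism only on the *-algebra spanned by the [x (x) y^op],
   complete positivity of the extension is obtained by approximating a positive
   matrix by squares of hermitian matrices over that algebra, through an
   iteration for the square root that uses polynomials only. *)

Require Import Defs.
From HB Require Import structures.
From mathcomp Require Import all_boot all_order all_algebra.
From mathcomp Require Import finmap complex.
From mathcomp Require Import all_classical all_reals all_analysis.
From mathcomp Require Import ring lra.

Set Implicit Arguments.
Unset Strict Implicit.
Unset Printing Implicit Defensive.

Import Order.TTheory GRing.Theory Num.Theory.
Import numFieldNormedType.Exports.
Local Open Scope classical_set_scope.
Local Open Scope ring_scope.

(** * Norms with values in the reals *)

(** Square roots are needed twice: of a coercive operator, where the root must keep commuting with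
    the [lam x y] modulo the compacts, and of a positive matrix over an algebra that is not norm
    closed, where the root must stay in that algebra. One recursion answers both: its iterates are
    polynomials in the given operator, and they converge geometrically once the operator is rescaled
    to lie at distance less than one from the identity. This is why coercivity, not mere positivity,
    is arranged each time: by adding [G] in one case, a small multiple of the identity in the other.
    The recursion is stated for an abstract semi-inner product, so that it also applies to tuples of
    vectors. As [Phi 1] is only known to be a projection, [theta] needs a correction term to be
    unital. Complete positivity of that term is a Schur product of the numbers [<X i j zeta, zeta>]
    with the form of [1 - V^* (Phi 1) V]; positivity of this form is the reason for wanting a
    contraction [V]. The same Schur product bounds [T1 (x) T2] on the tensor product. *)

Section RealNorm.
Context {R : realType}.
Local Open Scope complex_scope.

Lemma rcD (x y : R) : (x + y)%:C = x%:C + y%:C.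
Proof. exact: rmorphD. Qed.

Lemma rcN (x : R) : (- x)%:C = - x%:C.
Proof. exact: rmorphN. Qed.

Lemma rcM (x y : R) : (x * y)%:C = x%:C * y%:C.
Proof. exact: rmorphM. Qed.

(** Norms are elements of [R[i]], whose order is partial; passing to the real part loses nothing and
    lets estimates run in the ordered field [R]. *)
Definition nrm {V : normedZmodType R[i]} (x : V) : R := complex.Re `|x|.

Lemma nrmE {V : normedZmodType R[i]} (x : V) : `|x| = (nrm x)%:C.
Proof. by rewrite /nrm RRe_real // normr_real. Qed.

Lemma nrm_ge0 {V : normedZmodType R[i]} (x : V) : 0 <= nrm x.
Proof. by rewrite -ler0c -nrmE. Qed.

Lemma nrmD {V : normedZmodType R[i]} (x y : V) : nrm (x + y) <= nrm x + nrm y.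
Proof. by rewrite -lecR rcD -!nrmE ler_normD. Qed.

Lemma nrmN {V : normedZmodType R[i]} (x : V) : nrm (- x) = nrm x.
Proof. by rewrite /nrm normrN. Qed.

Lemma nrmBC {V : normedZmodType R[i]} (x y : V) : nrm (x - y) = nrm (y - x).
Proof. by rewrite /nrm distrC. Qed.

Lemma nrmB {V : normedZmodType R[i]} (x y : V) : nrm (x - y) <= nrm x + nrm y.
Proof. by rewrite -(nrmN y) nrmD. Qed.

Lemma nrmBD {V : normedZmodType R[i]} (z x y : V) :
  nrm (x - y) <= nrm (x - z) + nrm (z - y).
Proof. by rewrite (le_trans _ (nrmD _ _)) // addrA subrK. Qed.

Lemma nrm0 {V : normedZmodType R[i]} : nrm (0 : V) = 0.
Proof. by rewrite /nrm normr0. Qed.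

Lemma nrm_eq0 {V : normedZmodType R[i]} (x : V) : nrm x = 0 -> x = 0.
Proof. by move=> x0; apply/eqP; rewrite -normr_eq0 nrmE x0. Qed.

Lemma nrmZ {V : normedModType R[i]} (c : R[i]) (x : V) :
  nrm (c *: x) = nrm c * nrm x.
Proof. by apply: complexI; rewrite rcM -!nrmE normrZ. Qed.

Lemma nrmM (c d : R[i]) : nrm (c * d) = nrm c * nrm d.
Proof. by apply: complexI; rewrite rcM -!nrmE normrM. Qed.

Lemma nrm_conj (c : R[i]) : nrm c^*%R = nrm c.
Proof. by rewrite /nrm norm_conjC. Qed.

Lemma nrm_real (r : R) : nrm (r%:C) = `|r|.
Proof. by rewrite /nrm normc_def /= expr0n addr0 sqrtr_sqr. Qed.

Lemma nrm_sum {V : normedZmodType R[i]} (n : nat) (x : 'I_n -> V) :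
  nrm (\sum_(i < n) x i) <= \sum_(i < n) nrm (x i).
Proof.
elim/big_ind2: _ => [|u1 u2 v1 v2 h1 h2|//]; first by rewrite nrm0.
by rewrite (le_trans (nrmD _ _)) // lerD.
Qed.

Lemma le_nrm_sum {V : normedZmodType R[i]} (n : nat) (x : 'I_n -> V) (b : R) :
  (forall i, nrm (x i) <= b) -> nrm (\sum_(i < n) x i) <= n%:R * b.
Proof.
move=> h; rewrite (le_trans (nrm_sum x)) //.
rewrite (le_trans (ler_sum _ (fun i _ => h i))) //.
by rewrite sumr_const card_ord mulr_natl.
Qed.

Lemma conjCE (z : R[i]) : (z^*)%R = conjc z.
Proof. by case: z. Qed.

Lemma conjC_real (r : R) : ((r%:C)^*)%R = r%:C.
Proof. by rewrite conjCE conjc_real. Qed.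

Lemma ge0_ReImP (z : R[i]) : 0 <= z <-> 0 <= complex.Re z /\ complex.Im z = 0.
Proof.
rewrite lecE /=; split=> [/andP[/eqP -> ->] //|[-> ->]].
by rewrite eqxx.
Qed.

Lemma ge0E (z : R[i]) : 0 <= z -> z = (complex.Re z)%:C.
Proof. by move=> z0; rewrite RRe_real // ger0_real. Qed.

Lemma nrm_Re (z : R[i]) : `|complex.Re z| <= nrm z.
Proof. by rewrite -lecR -nrmE normc_ge_Re. Qed.

Lemma ReD (z w : R[i]) : complex.Re (z + w) = complex.Re z + complex.Re w.
Proof. by case: z; case: w. Qed.

Lemma ReN (z : R[i]) : complex.Re (- z) = - complex.Re z.
Proof. by case: z. Qed.

Lemma ImD (z w : R[i]) : complex.Im (z + w) = complex.Im z + complex.Im w.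
Proof. by case: z; case: w. Qed.

Lemma ImN (z : R[i]) : complex.Im (- z) = - complex.Im z.
Proof. by case: z. Qed.

Lemma ReZ (r : R) (z : R[i]) : complex.Re (r%:C * z) = r * complex.Re z.
Proof. by case: z => a b /=; rewrite mul0r subr0. Qed.

Lemma Re_conj (z : R[i]) : complex.Re z^*%R = complex.Re z.
Proof. by rewrite conjCE; case: z. Qed.

Lemma nrm_Im (z : R[i]) : `|complex.Im z| <= nrm z.
Proof.
have -> : complex.Im z = - complex.Re ('i%C * z).
  by rewrite mulrC ReiNIm opprK.
rewrite normrN (le_trans (nrm_Re _)) // nrmM.
suff -> : nrm ('i%C : R[i]) = 1 by rewrite mul1r.
by rewrite /nrm normc_def /= expr0n /= add0r expr1n sqrtr1.
Qed.

Lemma mul_conj (z : R[i]) : z * z^*%R = (nrm z ^+ 2)%:C.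
Proof. by rewrite -normCK nrmE !expr2 rcM. Qed.

(** The order of [R[i]] also demands a vanishing imaginary part, so the approximation by [w] is used
    once for each part. *)
Lemma ge0_closed (z : R[i]) :
  (forall e : R, 0 < e -> exists2 w : R[i], 0 <= w & nrm (z - w) <= e) -> 0 <= z.
Proof.
move=> h; apply/ge0_ReImP; split.
  apply/ler_addgt0Pr => e e0.
  have [w /ge0_ReImP[w0 _] we] := h _ e0.
  have := le_trans (nrm_Re _) we; rewrite ReD ReN ler_norml => /andP[]; lra.
apply/eqP; rewrite -normr_le0; apply/ler_addgt0Pr => e e0.
have [w /ge0_ReImP[_ w0] we] := h _ e0.
by have := le_trans (nrm_Im _) we; rewrite ImD ImN w0 subr0 add0r.
Qed.

Lemma nrm_small_eq0 {V : normedZmodType R[i]} (x : V) :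
  (forall e : R, 0 < e -> nrm x <= e) -> x = 0.
Proof.
move=> h; apply: nrm_eq0; apply/eqP; rewrite eq_le nrm_ge0 andbT.
by apply/ler_addgt0Pr => e e0; rewrite add0r h.
Qed.

Lemma small_inv (e : R) : 0 < e -> exists k : nat, k.+1%:R^-1 < e.
Proof.
move=> e0; have [k hk] := ltr_add_invr e0.
by exists k; rewrite add0r in hk.
Qed.

Lemma small_inv_mul (C e : R) : 0 < e -> exists k : nat, C * k.+1%:R^-1 <= e.
Proof.
move=> e0; have C1 : 0 < `|C| + 1 by rewrite ltr_wpDl.
have [k hk] := small_inv (divr_gt0 e0 C1); exists k.
have k0 : 0 <= k.+1%:R^-1 :> R by rewrite invr_ge0.
rewrite (le_trans (_ : _ <= (`|C| + 1) * k.+1%:R^-1)) //.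
  by rewrite ler_wpM2r // (le_trans (ler_norm _)) // lerDl.
by rewrite -ler_pdivlMl // mulrC ltW.
Qed.

End RealNorm.

(** * Semi-inner products *)

Section PreHilbert.
Context {R : realType}.
Local Open Scope complex_scope.

(** Definiteness is left out because the form of [compression_defect] may degenerate, and no
    topology is asked for, so that tuples of vectors qualify without a Hilbert structure on the
    direct sum. *)
Definition semi_inner (E : lmodType R[i]) (f : E -> E -> R[i]) : Prop :=
  [/\ forall x y z, f (x + y) z = f x z + f y z,
      forall c x y, f (c *: x) y = c * f x y,
      forall x y, f y x = (f x y)^*%R &
      forall x, 0 <= f x x].

Definition semi_norm (E : lmodType R[i]) (f : E -> E -> R[i]) (x : E) : R :=
  Num.sqrt (complex.Re (f x x)).

Section Form.
Context {E : lmodType R[i]} {f : E -> E -> R[i]} (hf : semi_inner f).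
Local Notation sn := (semi_norm f).

Let fDl x y z : f (x + y) z = f x z + f y z. Proof. by case: hf. Qed.
Let fZl c x y : f (c *: x) y = c * f x y. Proof. by case: hf. Qed.
Let fC x y : f y x = (f x y)^*%R. Proof. by case: hf. Qed.
Let f_ge0 x : 0 <= f x x. Proof. by case: hf. Qed.

Lemma formDr x y z : f x (y + z) = f x y + f x z.
Proof. by rewrite fC fDl rmorphD /= -!fC. Qed.

Lemma formZr c x y : f x (c *: y) = c^*%R * f x y.
Proof. by rewrite fC fZl rmorphM /= -fC. Qed.

Lemma formNl x y : f (- x) y = - f x y.
Proof. by rewrite -scaleN1r fZl mulN1r. Qed.

Lemma formNr x y : f x (- y) = - f x y.
Proof. by rewrite fC formNl rmorphN /= -fC. Qed.

Lemma formBl x y z : f (x - y) z = f x z - f y z.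
Proof. by rewrite fDl formNl. Qed.

Lemma formBr x y z : f x (y - z) = f x y - f x z.
Proof. by rewrite formDr formNr. Qed.

Lemma form0l y : f 0 y = 0.
Proof. by rewrite -(scale0r (0 : E)) fZl mul0r. Qed.

Lemma form0r x : f x 0 = 0.
Proof. by rewrite fC form0l conjC0. Qed.

Lemma form_suml (n : nat) (x : 'I_n -> E) y :
  f (\sum_(i < n) x i) y = \sum_(i < n) f (x i) y.
Proof. by elim/big_ind2: _ => [|u1 u2 v1 v2 <- <-|//]; rewrite ?form0l ?fDl. Qed.

Lemma form_sumr (n : nat) x (y : 'I_n -> E) :
  f x (\sum_(i < n) y i) = \sum_(i < n) f x (y i).
Proof. by elim/big_ind2: _ => [|u1 u2 v1 v2 <- <-|//]; rewrite ?form0r ?formDr. Qed.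

Lemma semi_norm_ge0 x : 0 <= sn x. Proof. exact: sqrtr_ge0. Qed.

Lemma semi_normE x : f x x = (sn x ^+ 2)%:C.
Proof.
have /ge0_ReImP[h _] := f_ge0 x.
by rewrite /semi_norm sqr_sqrtr // -ge0E.
Qed.

Lemma Re_form x : complex.Re (f x x) = sn x ^+ 2.
Proof. by rewrite semi_normE. Qed.

Lemma form_CS x y : nrm (f x y) <= sn x * sn y.
Proof.
set m := nrm (f x y); set p := sn x; set q := sn y.
(* The coefficient of [y] carries the factor [f x y], so that the nonnegative number obtained is a
   real quadratic in [t]. *)
have key (t : R) : 0 <= p ^+ 2 - 2 * t * m ^+ 2 + t ^+ 2 * m ^+ 2 * q ^+ 2.
  have := f_ge0 (x - (t%:C * f x y) *: y).
  rewrite formBl !formBr fZl !formZr fZl (fC x y) rmorphM /= conjC_real !semi_normE.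
  rewrite -/p -/q.
  have zz := mul_conj (f x y); rewrite -/m in zz.
  move: (f x y) zz => z zz.
  set w := (z^*)%R in zz *.
  suff -> : forall (p' q' t' : R[i]),
    p' - t' * w * z - (t' * z * w - t' * w * (t' * z * q')) =
    p' - t' * (z * w) - t' * (z * w) + t' * t' * (z * w) * q'.
    rewrite zz -!(rcN, rcM, rcD) ler0c; lra.
  by move=> *; ring.

have m0 : 0 <= m := nrm_ge0 _.
have p0 : 0 <= p := semi_norm_ge0 _.
have q0 : 0 <= q := semi_norm_ge0 _.
rewrite -(ler_pXn2r (n := 2)) // ?nnegrE ?mulr_ge0 // exprMn.
(* If [q = 0], the quadratic is affine with slope [- 2 * m ^+ 2], and the chosen [t] makes it
   negative unless [m = 0]. Otherwise its minimum is at [t = (q ^+ 2)^-1]. *)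
have [q00|q1] := eqVneq q 0.
  rewrite q00 expr0n /= mulr0; rewrite leNgt; apply/negP => m1.
  have := key ((p ^+ 2 + 1) / m ^+ 2); rewrite q00 expr0n mulr0 addr0.
  have -> : 2 * ((p ^+ 2 + 1) / m ^+ 2) * m ^+ 2 = 2 * (p ^+ 2 + 1).
    by field; rewrite gt_eqF // -(@pmulrn_lgt0 _ _ 1) //; move: m1; rewrite expr2; nra.
  nra.
have q2 : 0 < q ^+ 2 by rewrite exprn_gt0 // lt_def q1.
have := key (q ^+ 2)^-1.
have -> : p ^+ 2 - 2 * (q ^+ 2)^-1 * m ^+ 2 + (q ^+ 2)^-1 ^+ 2 * m ^+ 2 * q ^+ 2 =
          p ^+ 2 - m ^+ 2 / q ^+ 2 by field.
by rewrite subr_ge0 ler_pdivrMr.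
Qed.

Lemma semi_normD x y : sn (x + y) <= sn x + sn y.
Proof.
rewrite -(ler_pXn2r (n := 2)) // ?nnegrE ?addr_ge0 ?semi_norm_ge0 //.
rewrite -Re_form fDl !formDr !ReD !Re_form (fC x y) Re_conj.
have := le_trans (ler_norm _) (le_trans (nrm_Re _) (form_CS x y)).
nra.
Qed.

Lemma semi_normZ c x : sn (c *: x) = nrm c * sn x.
Proof.
rewrite {1}/semi_norm fZl formZr mulrA mul_conj semi_normE -rcM /=.
by rewrite -exprMn sqrtr_sqr ger0_norm // mulr_ge0 ?nrm_ge0 ?semi_norm_ge0.
Qed.

Lemma semi_normN x : sn (- x) = sn x.
Proof. by rewrite -scaleN1r semi_normZ nrmN nrm_real normr1 mul1r. Qed.

Lemma semi_norm0 : sn 0 = 0.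
Proof. by rewrite /semi_norm form0l sqrtr0. Qed.

(* Splitting off the component along [y ord0] leaves a product of [c] with
   a rank one form, plus a family whose first vector has norm zero. *)
Lemma schur_psd (n : nat) (c : 'I_n -> 'I_n -> R[i]) (y : 'I_n -> E) :
  (forall a : 'I_n -> R[i],
     0 <= \sum_(i < n) \sum_(j < n) c i j * (a j * (a i)^*%R)) ->
  0 <= \sum_(i < n) \sum_(j < n) c i j * f (y j) (y i).
Proof.
elim: n c y => [|n IH] c y hc; first by rewrite big_ord0.
pose z := y ord0; pose q := f z z.
pose a j := f (y j) z / q.
pose w j := y j - a j *: z.
(* If [q = 0], the division is harmless: [f (y j) z] vanishes anyway by Cauchy-Schwarz. *)
have wz j : f (w j) z = 0.
  rewrite /w formBl fZl /a; have [q0|q0] := eqVneq q 0.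
    rewrite -/q q0 mulr0 subr0; apply: nrm_eq0; apply/eqP.
    rewrite eq_le nrm_ge0 andbT (le_trans (form_CS _ _)) //.
    by rewrite /semi_norm -[f z z]/q q0 sqrtr0 mulr0.
  by rewrite -/q divfK // subrr.
have zw j : f z (w j) = 0 by rewrite fC wz conjC0.
have w0 j : f (w j) (w ord0) = 0.
  have -> : w ord0 = z - a ord0 *: z by [].
  by rewrite formBr formZr wz mulr0 subr0.
have w0' j : f (w ord0) (w j) = 0 by rewrite fC w0 conjC0.
have yE i j : f (y j) (y i) = q * (a j * (a i)^*%R) + f (w j) (w i).
  have yw k : y k = a k *: z + w k by rewrite /w addrC subrK.
  rewrite [in LHS](yw j) [in LHS](yw i); move: {yw w0 w0'} w wz zw => w wz zw.
  rewrite fDl !formDr !fZl !formZr zw wz.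
  by rewrite -/q; ring.
under eq_bigr => i _ do under eq_bigr => j _ do rewrite yE mulrDr.
under eq_bigr => i _ do rewrite big_split /=.
rewrite big_split /= addr_ge0 //.
  rewrite (_ : \sum_(i < n.+1) _ =
    q * \sum_(i < n.+1) \sum_(j < n.+1) c i j * (a j * (a i)^*%R)).
    by rewrite mulr_ge0 // f_ge0.
  by rewrite mulr_sumr; apply: eq_bigr => i _; rewrite mulr_sumr;
     apply: eq_bigr => j _; ring.
rewrite big_ord_recl big1 ?add0r => [|j _]; last by rewrite w0 mulr0.
under eq_bigr => i _ do rewrite big_ord_recl w0' mulr0 add0r.
apply: (IH (fun i j => c (lift ord0 i) (lift ord0 j)) (fun i => w (lift ord0 i))).
(* Extending [b] by zero at [ord0] restricts the hypothesis on [c] to the block without the first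
   row and column. *)
move=> b; pose b' := fun i => if unlift ord0 i is Some k then b k else 0.
have := hc b'; rewrite big_ord_recl big1 ?add0r => [|j _]; last first.
  by rewrite /b' unlift_none conjC0 !mulr0.
under eq_bigr => i _ do rewrite big_ord_recl {1}/b' unlift_none mul0r mulr0 add0r.
by under eq_bigr => i _ do under eq_bigr => j _ do rewrite /b' !liftK.
Qed.

End Form.
End PreHilbert.

Section LinearMaps.
Context {K : pzRingType} {U V W : lmodType K}.

Lemma lin_add (T : U -> V) : linear T -> forall x y, T (x + y) = T x + T y.
Proof. by move=> lT x y; have := lT 1 x y; rewrite !scale1r. Qed.

Lemma lin0 (T : U -> V) : linear T -> T 0 = 0.
Proof. by move=> lT; apply: (addrI (T 0)); rewrite -lin_add // !addr0. Qed.

Lemma lin_scale (T : U -> V) : linear T -> forall c x, T (c *: x) = c *: T x.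
Proof. by move=> lT c x; have := lT c x 0; rewrite !addr0 (lin0 lT) addr0. Qed.

Lemma lin_opp (T : U -> V) : linear T -> forall x, T (- x) = - T x.
Proof. by move=> lT x; rewrite -scaleN1r lin_scale // scaleN1r. Qed.

Lemma lin_sub (T : U -> V) : linear T -> forall x y, T (x - y) = T x - T y.
Proof. by move=> lT x y; rewrite lin_add // lin_opp. Qed.

Lemma lin_sum (T : U -> V) : linear T -> forall (n : nat) (x : 'I_n -> U),
  T (\sum_(i < n) x i) = \sum_(i < n) T (x i).
Proof.
move=> lT n x; elim/big_ind2: _ => [|u1 u2 v1 v2 <- <-|//]; first exact: lin0.
by rewrite lin_add.
Qed.

Lemma linear_comp (S : V -> W) (T : U -> V) :
  linear S -> linear T -> linear (S \o T).
Proof. by move=> lS lT c x y /=; rewrite lT lS. Qed.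

End LinearMaps.

(** * Square roots by a polynomial iteration *)

Section SqrtIteration.
Context {R : realType} {E : lmodType R[i]} {f : E -> E -> R[i]}.
Hypothesis hf : semi_inner f.
Local Open Scope complex_scope.
Local Notation sn := (semi_norm f).

(* The iterates converge to the solution of [2 Y = A + Y^2], for which
   [(1 - Y)^2 = 1 - A]. *)
Fixpoint sqrt_iter (A : E -> E) (k : nat) (x : E) : E :=
  if k is k'.+1
  then (2^-1)%:C *: (A x + sqrt_iter A k' (sqrt_iter A k' x))
  else 0.

Variables (A : E -> E) (rho : R).
Hypothesis linA : linear A.
Hypothesis rho0 : 0 <= rho.
Hypothesis rho1 : rho <= 1.
Hypothesis Arho : forall x, sn (A x) <= rho * sn x.

Lemma sqrt_iter_linear k : linear (sqrt_iter A k).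
Proof.
elim: k => [|k IH] c x y /=; first by rewrite scaler0 addr0.
by rewrite linA !IH addrACA -[c *: _ + _]scalerDr [LHS]scalerDr !scalerA mulrC.
Qed.

Lemma nrm_half : nrm ((2^-1)%:C : R[i]) = 2^-1.
Proof. by rewrite nrm_real ger0_norm. Qed.

(** The bound [rho] reproduces itself, since [(rho + rho ^+ 2) / 2 <= rho] when [rho <= 1]. *)
Lemma sqrt_iter_le k x : sn (sqrt_iter A k x) <= rho * sn x.
Proof.
elim: k x => [|k IH] x /=.
  by rewrite semi_norm0 ?mulr_ge0 ?semi_norm_ge0.
rewrite (semi_normZ hf) nrm_half.
have h1 := semi_normD hf (A x) (sqrt_iter A k (sqrt_iter A k x)).
have h2 := Arho x.
have h3 := le_trans (IH (sqrt_iter A k x)) (ler_wpM2l rho0 (IH x)).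
have h4 : rho * (rho * sn x) <= rho * sn x.
  by rewrite ler_wpM2l // ler_piMl // semi_norm_ge0.
lra.
Qed.

(** The identity [U^2 - W^2 = U (U - W) + (U - W) W] requires no commutation; each of the two terms
    gains a factor [rho], and the factor one half absorbs their number. *)
Lemma sqrt_iter_step k x :
  sn (sqrt_iter A k.+1 x - sqrt_iter A k x) <= rho ^+ k.+1 * sn x.
Proof.
elim: k x => [|k IH] x.
  rewrite /= subr0 addr0 (semi_normZ hf) nrm_half expr1.
  by have := Arho x; have : 0 <= sn (A x) := semi_norm_ge0 _; lra.
have lY := sqrt_iter_linear.
have -> : sqrt_iter A k.+2 x - sqrt_iter A k.+1 x = (2^-1)%:C *:
   (sqrt_iter A k.+1 (sqrt_iter A k.+1 x - sqrt_iter A k x) +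
    (sqrt_iter A k.+1 (sqrt_iter A k x) - sqrt_iter A k (sqrt_iter A k x))).
  rewrite (lin_sub (lY k.+1)) addrA subrK.
  rewrite [sqrt_iter A k.+2 x]/= -/(sqrt_iter A k.+1 x) {4}/sqrt_iter -/sqrt_iter.
  by rewrite -scalerBr opprD addrACA subrr add0r.
rewrite (semi_normZ hf) nrm_half.
set u := sqrt_iter A k.+1 _; set v := _ - sqrt_iter A k (sqrt_iter A k x).
have h1 := semi_normD hf u v.
have h2 : sn u <= rho ^+ k.+2 * sn x.
  by rewrite (le_trans (sqrt_iter_le _ _)) // exprS -mulrA ler_wpM2l.
have h3 : sn v <= rho ^+ k.+2 * sn x.
  rewrite (le_trans (IH _)) // [rho ^+ k.+2]exprSr -mulrA ler_wpM2l ?exprn_ge0 //.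
  exact: sqrt_iter_le.
lra.
Qed.

Lemma sqrt_iter_sym : (forall x y, f (A x) y = f x (A y)) ->
  forall k x y, f (sqrt_iter A k x) y = f x (sqrt_iter A k y).
Proof.
move=> sA; elim=> [|k IH] x y /=; first by rewrite form0l // form0r.
case: (hf) => fDl fZl _ _.
by rewrite fZl (formZr hf) conjC_real fDl (formDr hf) sA !IH.
Qed.

(** By the recursion, the defect [(1 - Y_k)^2 - (1 - A) = A + Y_k^2 - 2 Y_k] equals
    [2 (Y_{k+1} - Y_k)], which the step estimate controls. *)
Lemma sqrt_iter_sq k x :
  sn ((x - sqrt_iter A k x) - sqrt_iter A k (x - sqrt_iter A k x) - (x - A x))
    <= 2 * rho ^+ k.+1 * sn x.
Proof.
have -> : (x - sqrt_iter A k x) - sqrt_iter A k (x - sqrt_iter A k x) - (x - A x)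
   = (2 : R)%:C *: (sqrt_iter A k.+1 x - sqrt_iter A k x).
  rewrite (lin_sub (sqrt_iter_linear k)) /= scalerBr scalerA -rcM divff ?pnatr_eq0 //.
  rewrite scale1r; set y := sqrt_iter A k x; set z := sqrt_iter A k y.
  rewrite (_ : (2 : R)%:C = 2%:R) ?scaler_nat; last by rewrite -[RHS](rmorph_nat (real_complex R)).
  rewrite mulr2n -[x - y - (y - z)]addrA -opprD (opprB x).
  rewrite [LHS]addrC [LHS]addrA subrK.
  by rewrite addrA opprB addrA.
by rewrite (semi_normZ hf) nrm_real ger0_norm // -mulrA ler_wpM2l // sqrt_iter_step.
Qed.

End SqrtIteration.

(** * Coercive and positive operators for a semi-inner product *)

Section FormOperators.
Context {R : realType} {E : lmodType R[i]} {f : E -> E -> R[i]}.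
Hypothesis hf : semi_inner f.
Local Open Scope complex_scope.
Local Notation sn := (semi_norm f).

(** Expanding the square bounds [|z - c T z|^2] by [1 - 2 c delta + c^2 D^2] times [|z|^2]. The
    value [c = delta / D^2] minimises this factor, leaving [1 - delta^2 / D^2]. Adding [delta] to
    the bound in [D] keeps the factor nonnegative. *)
Lemma coercive_contraction (T : E -> E) (delta B : R) : 0 < delta ->
  (forall z, delta * sn z ^+ 2 <= complex.Re (f (T z) z)) ->
  (forall z, sn (T z) <= B * sn z) ->
  exists c rho : R, [/\ 0 < c, 0 <= rho, rho < 1 &
    forall z, sn (z - c%:C *: T z) <= rho * sn z].
Proof.
move=> d0 hT hB; pose D := `|B| + delta; have D0 : 0 < D by rewrite ltr_wpDl.
have hD z : sn (T z) <= D * sn z.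
  rewrite (le_trans (hB z)) // ler_wpM2r ?semi_norm_ge0 //.
  by rewrite (le_trans (ler_norm _)) // lerDl ltW.
pose q := delta ^+ 2 / D ^+ 2.
have D20 : 0 < D ^+ 2 by rewrite exprn_gt0.
have q0 : 0 < q by rewrite divr_gt0 // exprn_gt0.
have q1 : q <= 1.
  by rewrite ler_pdivrMr // mul1r ler_pXn2r ?nnegrE ?(ltW d0) ?(ltW D0) // /D lerDr.
exists (delta / D ^+ 2), (Num.sqrt (1 - q)).
have q2 : 0 <= 1 - q by rewrite subr_ge0.
split; [by rewrite divr_gt0|exact: sqrtr_ge0| |].
  rewrite -(ltr_pXn2r (n := 2)) // ?nnegrE ?sqrtr_ge0 // sqr_sqrtr // expr1n; lra.
move=> z; rewrite -(ler_pXn2r (n := 2)) // ?nnegrE ?semi_norm_ge0 ?mulr_ge0 //;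
  rewrite ?semi_norm_ge0 ?sqrtr_ge0 //.
rewrite exprMn (sqr_sqrtr q2); set c := delta / _.
have [fDl fZl fC f_ge0] := hf.
have -> : sn (z - c%:C *: T z) ^+ 2 =
   sn z ^+ 2 - 2 * c * complex.Re (f (T z) z) + c ^+ 2 * sn (T z) ^+ 2.
  rewrite -(Re_form hf) (formBl hf) !(formBr hf) !fZl !(formZr hf) conjC_real.
  rewrite !ReD !ReN !ReD !ReN !ReZ !(Re_form hf).
  rewrite -[complex.Re (f z (T z))]Re_conj -fC; ring.
have h1 : sn (T z) ^+ 2 <= D ^+ 2 * sn z ^+ 2.
  by rewrite -exprMn ler_pXn2r // ?nnegrE ?mulr_ge0 ?semi_norm_ge0 ?(ltW D0) // hD.
have c0 : 0 < c by rewrite divr_gt0.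
have h2 := ler_wpM2l (ltW c0) (hT z).
have h3 := ler_wpM2l (sqr_ge0 c) h1.
have h4 : c * (delta * sn z ^+ 2) = q * sn z ^+ 2 by rewrite /c /q; ring.
have h5 : c ^+ 2 * (D ^+ 2 * sn z ^+ 2) = q * sn z ^+ 2.
  by rewrite /c /q; field; rewrite gt_eqF.
rewrite h4 in h2; rewrite h5 in h3; lra.
Qed.

(** Polarisation: the form [g] is sesquilinear with zero diagonal, and the vectors [x + y] and
    [x + i y] give [g x y + g y x = 0] and [g y x - g x y = 0]. *)
Lemma positive_symmetric (T : E -> E) : linear T -> (forall z, 0 <= f (T z) z) ->
  forall x y, f (T x) y = f x (T y).
Proof.
move=> lT pT x y; have [fDl fZl fC f_ge0] := hf.
pose g u v := f (T u) v - f u (T v).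
have g0 u : g u u = 0.
  by rewrite /g (fC (T u) u) (ge0E (pT u)) conjC_real subrr.
have gD u v : g (u + v) (u + v) = g u u + g v v + (g u v + g v u).
  by rewrite /g !(lin_add lT) !fDl !(formDr hf); ring.
have gZ a u v : g u (a *: v) = a^*%R * g u v.
  by rewrite /g !(lin_scale lT) !(formZr hf) mulrBr.
have gZl a u v : g (a *: u) v = a * g u v.
  by rewrite /g !(lin_scale lT) !fZl mulrBr.
have h1 : g x y + g y x = 0 by have := gD x y; rewrite !g0 !add0r => <-.
have h2 : - g x y + g y x = 0.
  have := gD x ('i%C *: y); rewrite !g0 !add0r gZ gZl => /esym h.
  have i0 : 'i%C != 0 :> R[i] by rewrite eq_complex /= oner_eq0 andbF.
  apply: (mulfI i0); rewrite mulr0 mulrDr -[RHS]h; congr (_ + _).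
  by rewrite conjCE /= (_ : 0 -i* 1 = - 'i%C :> R[i]) ?mulNr ?mulrN //;
     apply/eqP; rewrite eq_complex /= oppr0 !eqxx.
apply/eqP; rewrite -subr_eq0 -/(g x y); apply/eqP.
have : g x y *+ 2 = 0.
  have -> : g x y *+ 2 = (g x y + g y x) - (- g x y + g y x) by rewrite mulr2n; ring.
  by rewrite h1 h2 subr0.
by move/eqP; rewrite mulrn_eq0 /= => /eqP.
Qed.

End FormOperators.

(** * Hilbert spaces and bounded operators *)

Section Completeness.
Context {R : realType}.
Local Open Scope complex_scope.

Lemma gt0_real (e : R[i]) : 0 < e -> exists2 r : R, 0 < r & e = r%:C.
Proof.
move=> e0; exists (complex.Re e); last exact/ge0E/ltW.
by move: e0; rewrite ltcE => /andP[].
Qed.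

Lemma nbhs_nrmP {V : normedModType R[i]} (x : V) (P : set V) :
  nbhs x P <-> exists2 r : R, 0 < r & forall y, nrm (x - y) < r -> P y.
Proof.
split=> [/nbhs_normP[e /= /gt0_real[r r0 ->] h]|[r r0 h]].
  by exists r => // y xy; apply: h; rewrite /= nrmE ltcR.
by apply/nbhs_normP; exists r%:C; rewrite /= ?ltcR // => y; rewrite /= nrmE ltcR => /h.
Qed.

Lemma closure_nrmP {V : normedModType R[i]} (D : set V) (x : V) :
  closure D x <-> forall e : R, 0 < e -> exists2 y, D y & nrm (x - y) < e.
Proof.
split=> [h e e0|h B /nbhs_nrmP[r /h[y Dy xy] hr]]; last by exists y; split => //; exact: hr.
have [|y [Dy xy]] := h [set y | nrm (x - y) < e]; last by exists y.
by apply/nbhs_nrmP; exists e.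
Qed.

(** The explicit rate [eps] survives the limit, so that later arguments compare with one
    sufficiently late term instead of handling convergence. *)
Lemma cauchy_limit {V : completeNormedModType R[i]} (u : nat -> V) (eps : nat -> R) :
  (forall k l, (k <= l)%N -> nrm (u k - u l) <= eps k) ->
  (forall e, 0 < e -> exists k, eps k <= e) ->
  exists l, forall k, nrm (u k - l) <= eps k.
Proof.
move=> hu heps.
have /cauchy_cvgP cu : cauchy (u @ \oo).
  apply: cauchy_exP => _ /gt0_real[r r0 ->].
  have r2 : 0 < r / 2 by rewrite divr_gt0.
  have [k hk] := heps _ r2; exists (u k).
  exists k => // l /= kl; rewrite -ball_normE /= nrmE ltcR.
  by rewrite (le_lt_trans (hu _ _ kl)) // (le_lt_trans hk) // ltr_pdivrMr // mulr2n mulrDr mulr1 ltrDl.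
have [l ul] := (cvg_ex (u @ \oo)).1 cu; exists l => k.
apply/ler_addgt0Pr => e e0.
have [m _ hm] : (u @ \oo) [set y | nrm (l - y) < e].
  by apply: ul; apply/nbhs_nrmP; exists e.
have := hm (maxn k m) (leq_maxr _ _) => /= h.
rewrite (le_trans (nrmBD (u (maxn k m)) _ _)) // lerD ?hu ?leq_maxl //.
by rewrite nrmBC ltW.
Qed.

Lemma geom_small (rho C e : R) : 0 <= rho -> rho < 1 -> 0 < e ->
  exists k, C * rho ^+ k <= e.
Proof.
move=> r0 r1 e0; have C1 : 0 < `|C| + 1 by rewrite ltr_wpDl.
have /cvgrPdist_lt/(_ _ (divr_gt0 e0 C1))[k _ hk] :
    rho ^+ n @[n --> \oo] --> (0 : R) by apply: cvg_expr; rewrite ger0_norm.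
exists k; have := hk k (leqnn k) => /=.
rewrite sub0r normrN ger0_norm ?exprn_ge0 // ltr_pdivlMr // => h.
rewrite (le_trans _ (ltW h)) // mulrC ler_wpM2l ?exprn_ge0 //.
by rewrite (le_trans (ler_norm _)) // lerDl.
Qed.

End Completeness.

Section Hilbert.
Context {R : realType}.
Local Open Scope complex_scope.

Lemma dotp_semi_inner {H : hilbertType R} : semi_inner (@dotp R H).
Proof.
split; [exact: dotpDl|exact: dotpZl|by move=> x y; exact: dotpC|].
by move=> x; rewrite dotpE exprn_ge0.
Qed.

Lemma semi_norm_dotp {H : hilbertType R} (x : H) : semi_norm dotp x = nrm x.
Proof.
by rewrite /semi_norm dotpE nrmE expr2 -rcM -expr2 sqrtr_sqr ger0_norm ?nrm_ge0.
Qed.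

Lemma dotpp {H : hilbertType R} (x : H) : dotp x x = (nrm x ^+ 2)%:C.
Proof. by rewrite (semi_normE dotp_semi_inner) semi_norm_dotp. Qed.

Lemma dotp_CS {H : hilbertType R} (x y : H) : nrm (dotp x y) <= nrm x * nrm y.
Proof. by rewrite -!semi_norm_dotp (form_CS dotp_semi_inner). Qed.

Section Dotp.
Context {H : hilbertType R}.
Implicit Types x y z : H.

Lemma dotpDr x y z : dotp x (y + z) = dotp x y + dotp x z.
Proof. exact: (formDr dotp_semi_inner). Qed.
Lemma dotpZr c x y : dotp x (c *: y) = c^*%R * dotp x y.
Proof. exact: (formZr dotp_semi_inner). Qed.
Lemma dotpNr x y : dotp x (- y) = - dotp x y.
Proof. exact: (formNr dotp_semi_inner). Qed.
Lemma dotpBl x y z : dotp (x - y) z = dotp x z - dotp y z.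
Proof. exact: (formBl dotp_semi_inner). Qed.
Lemma dotpBr x y z : dotp x (y - z) = dotp x y - dotp x z.
Proof. exact: (formBr dotp_semi_inner). Qed.
Lemma dotp0l y : dotp (0 : H) y = 0.
Proof. exact: (form0l dotp_semi_inner). Qed.
Lemma dotp0r x : dotp x (0 : H) = 0.
Proof. exact: (form0r dotp_semi_inner). Qed.
Lemma dotp_suml (n : nat) (u : 'I_n -> H) y :
  dotp (\sum_(i < n) u i) y = \sum_(i < n) dotp (u i) y.
Proof. exact: (form_suml dotp_semi_inner). Qed.
Lemma dotp_sumr (n : nat) x (u : 'I_n -> H) :
  dotp x (\sum_(i < n) u i) = \sum_(i < n) dotp x (u i).
Proof. exact: (form_sumr dotp_semi_inner). Qed.

Lemma dotpP x y : (forall z, dotp z x = dotp z y) -> x = y.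
Proof.
move=> h; apply/eqP; rewrite -subr_eq0; apply/eqP/nrm_eq0/eqP.
by rewrite -sqrf_eq0; apply/eqP/complexI; rewrite -dotpp dotpBr h subrr.
Qed.

Lemma dense_orth (D : set H) z : closure D = setT ->
  (forall d, D d -> dotp z d = 0) -> z = 0.
Proof.
move=> cD hz; apply: nrm_small_eq0 => e e0.
have /closure_nrmP/(_ _ e0)[d Dd zd] : closure D z by rewrite cD.
have h : nrm z ^+ 2 <= nrm z * nrm (z - d).
  rewrite (le_trans _ (dotp_CS _ _)) // dotpBr (hz d Dd) subr0 dotpp nrm_real.
  by rewrite ler_norm.
have z0 := nrm_ge0 z; rewrite leNgt; apply/negP => ez.
by have : nrm z * nrm (z - d) < nrm z * e; [rewrite ltr_pM2l //; lra|nra].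
Qed.

Lemma parallelogram x y :
  nrm (x - y) ^+ 2 = 2 * nrm x ^+ 2 + 2 * nrm y ^+ 2 - nrm (x + y) ^+ 2.
Proof.
apply: complexI; rewrite -dotpp dotpBl !dotpBr.
have -> : (2 * nrm x ^+ 2 + 2 * nrm y ^+ 2 - nrm (x + y) ^+ 2)%:C =
  (nrm x ^+ 2)%:C + (nrm x ^+ 2)%:C + ((nrm y ^+ 2)%:C + (nrm y ^+ 2)%:C)
  - (nrm (x + y) ^+ 2)%:C.
  by rewrite -!rcD -rcN -rcD; congr (_%:C); ring.
by rewrite -!dotpp dotpDl !dotpDr; ring.
Qed.

End Dotp.

Lemma bounded_opP {H K : hilbertType R} (T : H -> K) :
  bounded_op T <-> linear T /\ exists2 C : R, 0 <= C & forall x, nrm (T x) <= C * nrm x.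
Proof.
split=> [[lT cT]|[lT [C C0 hC]]]; split => //; last first.
  move=> x P /nbhs_nrmP[r r0 hr]; apply/nbhs_nrmP.
  have C1 : 0 < C + 1 by rewrite ltr_wpDl.
  exists (r / (C + 1)); first by rewrite divr_gt0.
  move=> y xy; apply: hr; rewrite -lin_sub //.
  rewrite (le_lt_trans (hC _)) // (le_lt_trans (_ : _ <= (C + 1) * nrm (x - y))) //.
    by rewrite ler_wpM2r ?nrm_ge0 // lerDl.
  by rewrite mulrC -ltr_pdivlMr.
have /cT/nbhs_nrmP[r r0 hr] : nbhs (T 0) [set y : K | nrm (T 0 - y) < 1].
  by apply/nbhs_nrmP; exists 1.
exists (2 / r) => [|x]; first by rewrite divr_ge0 // ltW.
have [->|x0] := eqVneq x 0; first by rewrite lin0 // !nrm0 mulr0.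
have nx : 0 < nrm x.
  by rewrite lt_def nrm_ge0 andbT; apply/eqP => /nrm_eq0 /eqP; apply/negP.
(* This multiple of [x] has norm [r / 2], inside the ball on which [T] stays below one; hence the
   constant [2 / r]. *)
have := hr ((r / (2 * nrm x))%:C *: x).
rewrite /= !(lin0 lT) !sub0r !nrmN (lin_scale lT) !nrmZ nrm_real ger0_norm; last first.
  by rewrite divr_ge0 ?mulr_ge0 // ltW.
have -> : r / (2 * nrm x) * nrm x = r / 2 by field; rewrite gt_eqF.
move=> /(_ _)/ltW h; rewrite -ler_pdivrMl ?divr_gt0 //.
have -> : (2 / r)^-1 * nrm (T x) = r / (2 * nrm x) * nrm (T x) * nrm x.
  by field; rewrite !gt_eqF.
rewrite -[leRHS]mul1r ler_wpM2r ?nrm_ge0 // h //.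
by rewrite ltr_pdivrMr // mulr2n mulrDr mulr1 ltrDl.
Qed.

End Hilbert.

Section BoundedOperators.
Context {R : realType}.
Local Open Scope complex_scope.

Definition nrm_le {H K : hilbertType R} (C : R) (T : H -> K) : Prop :=
  forall x, nrm (T x) <= C * nrm x.

Lemma norm_le_real {H K : hilbertType R} (C : R) (T : H -> K) :
  norm_le C%:C T <-> nrm_le C T.
Proof. by split=> h x; have := h x; rewrite !nrmE -rcM lecR. Qed.

Lemma bounded_op_bound {H K : hilbertType R} (T : H -> K) :
  bounded_op T -> exists2 C : R, 0 < C & nrm_le C T.
Proof.
move=> /bounded_opP[_ [C C0 h]]; exists (C + 1); first by rewrite ltr_wpDl.
by move=> x; rewrite (le_trans (h x)) // ler_wpM2r ?nrm_ge0 // lerDl.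
Qed.

Lemma bounded_op_intro {H K : hilbertType R} (C : R) (T : H -> K) :
  linear T -> nrm_le C T -> bounded_op T.
Proof.
move=> lT h; apply/bounded_opP; split=> //; exists `|C| => // x.
by rewrite (le_trans (h x)) // ler_wpM2r ?nrm_ge0 // ler_norm.
Qed.

Lemma nrm_le_mono {H K : hilbertType R} (C D : R) (T : H -> K) :
  C <= D -> nrm_le C T -> nrm_le D T.
Proof. by move=> CD h x; rewrite (le_trans (h x)) // ler_wpM2r ?nrm_ge0. Qed.

Lemma nrm_le_comp {H K L : hilbertType R} (C D : R) (S : K -> L) (T : H -> K) :
  0 <= C -> nrm_le C S -> nrm_le D T -> nrm_le (C * D) (S \o T).
Proof. by move=> C0 hS hT x; rewrite (le_trans (hS _)) // -mulrA ler_wpM2l. Qed.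

Lemma nrm_leD {H K : hilbertType R} (C D : R) (S T : H -> K) :
  nrm_le C S -> nrm_le D T -> nrm_le (C + D) (S + T).
Proof. by move=> hS hT x; rewrite (le_trans (nrmD _ _)) // mulrDl lerD. Qed.

Lemma nrm_leN {H K : hilbertType R} (C : R) (T : H -> K) :
  nrm_le C T -> nrm_le C (- T).
Proof. by move=> hT x; rewrite nrmN. Qed.

Lemma nrm_leB {H K : hilbertType R} (C D : R) (S T : H -> K) :
  nrm_le C S -> nrm_le D T -> nrm_le (C + D) (S - T).
Proof. by move=> hS hT; apply: nrm_leD => //; apply: nrm_leN. Qed.

Lemma nrm_leZ {H K : hilbertType R} (C : R) (c : R[i]) (T : H -> K) :
  nrm_le C T -> nrm_le (nrm c * C) (c *: T).
Proof. by move=> hT x; rewrite nrmZ -mulrA ler_wpM2l ?nrm_ge0. Qed.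

Lemma bounded_op_id {H : hilbertType R} : bounded_op (id : H -> H).
Proof. by apply: (@bounded_op_intro _ _ 1) => // x; rewrite mul1r. Qed.

Lemma bounded_op0 {H K : hilbertType R} : bounded_op (0 : H -> K).
Proof.
apply: (@bounded_op_intro _ _ 0) => [c x y|x]; first by rewrite scaler0 addr0.
by rewrite nrm0 mul0r.
Qed.

Lemma bounded_op_comp {H K L : hilbertType R} (S : K -> L) (T : H -> K) :
  bounded_op S -> bounded_op T -> bounded_op (S \o T).
Proof.
move=> bS bT; have [C C0 hS] := bounded_op_bound bS.
have [D D0 hT] := bounded_op_bound bT.
exact: (bounded_op_intro (linear_comp bS.1 bT.1) (nrm_le_comp (ltW C0) hS hT)).
Qed.

Lemma bounded_opD {H K : hilbertType R} (S T : H -> K) :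
  bounded_op S -> bounded_op T -> bounded_op (S + T).
Proof.
move=> bS bT; have [C C0 hS] := bounded_op_bound bS.
have [D D0 hT] := bounded_op_bound bT.
apply: (bounded_op_intro _ (nrm_leD hS hT)) => c x y.
by rewrite !fctE bS.1 bT.1 scalerDr addrACA.
Qed.

Lemma bounded_opZ {H K : hilbertType R} (c : R[i]) (T : H -> K) :
  bounded_op T -> bounded_op (c *: T).
Proof.
move=> bT; have [D D0 hT] := bounded_op_bound bT.
apply: (bounded_op_intro _ (nrm_leZ c hT)) => d x y.
by rewrite !fctE bT.1 scalerDr !scalerA mulrC.
Qed.

Lemma bounded_opN {H K : hilbertType R} (T : H -> K) :
  bounded_op T -> bounded_op (- T).
Proof. by move=> bT; rewrite -scaleN1r; apply: bounded_opZ. Qed.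

Lemma bounded_opB {H K : hilbertType R} (S T : H -> K) :
  bounded_op S -> bounded_op T -> bounded_op (S - T).
Proof. by move=> bS bT; apply: bounded_opD => //; apply: bounded_opN. Qed.

Lemma op_limit {H K : hilbertType R} (T : nat -> H -> K) (eps : nat -> R) :
  (forall k, bounded_op (T k)) ->
  (forall k l, (k <= l)%N -> nrm_le (eps k) (T k - T l)) ->
  (forall e, 0 < e -> exists k, eps k <= e) ->
  exists2 S, bounded_op S & forall k, nrm_le (eps k) (T k - S).
Proof.
move=> bT hT heps.
have /choice[S hS] : forall x, exists y, forall k, nrm (T k x - y) <= eps k * nrm x.
  move=> x; apply: (@cauchy_limit _ _ (fun k => T k x) (fun k => eps k * nrm x)).
    by move=> k l kl; exact: hT.
  move=> e e0; have x1 : 0 < nrm x + 1 by rewrite ltr_wpDl ?nrm_ge0.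
  have [k hk] := heps _ (divr_gt0 e0 x1); exists k.
  rewrite (le_trans (ler_wpM2r (nrm_ge0 _) hk)) // -mulrA ler_piMr //; first exact: ltW.
  by rewrite ler_pdivrMl // mulr1 lerDl.
exists S; last by move=> k x; exact: hS.
have lS : linear S.
  move=> c x y; apply/eqP; rewrite -subr_eq0; apply/eqP/nrm_small_eq0 => e e0.
  pose B := nrm (c *: x + y) + (nrm c * nrm x + nrm y).
  have B0 : 0 <= B by rewrite !addr_ge0 ?mulr_ge0 ?nrm_ge0.
  have B1 : 0 < B + 1 by rewrite ltr_wpDl.
  have [k hk] := heps _ (divr_gt0 e0 B1).
  have -> : S (c *: x + y) - (c *: S x + S y) =
     (c *: (T k x - S x) + (T k y - S y)) - (T k (c *: x + y) - S (c *: x + y)).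
    rewrite (bT k).1 scalerBr addrACA -opprD opprB.
    by rewrite [RHS]addrC [RHS]addrA subrK.
  rewrite (le_trans (nrmB _ _)) // (le_trans (lerD (nrmD _ _) (hS _ _))) // nrmZ.
  have h1 := ler_wpM2l (nrm_ge0 c) (hS x k); have h2 := hS y k.
  have h3 : eps k * B <= e.
    rewrite (le_trans (ler_wpM2r B0 hk)) // -mulrA ler_piMr //; first exact: ltW.
    by rewrite ler_pdivrMl // mulr1 lerDl.
  by rewrite /B in h3; lra.
have [k hk] := heps 1 ltr01; have [C C0 hC] := bounded_op_bound (bT k).
apply: (bounded_op_intro (C := C + 1) lS) => x.
rewrite -(subrK (T k x) (S x)) addrC mulrDl mul1r (le_trans (nrmD _ _)) // lerD //.
by rewrite nrmBC (le_trans (hS _ _)) // ler_piMl ?nrm_ge0.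
Qed.

(** The representing vector minimises the energy [J x = |x|^2 - 2 Re (g x)], which is bounded below
    by completing the square. The Euler equation at the minimum is the representation of [g]. *)
Lemma riesz {H : hilbertType R} (g : H -> R[i]) (C : R) :
  (forall c x y, g (c *: x + y) = c * g x + g y) ->
  (forall x, nrm (g x) <= C * nrm x) ->
  exists y, forall x, g x = dotp x y.
Proof.
move=> lg bg.
have lg' : linear (g : H -> R[i]^o) by exact: lg.
pose J x := nrm x ^+ 2 - 2 * complex.Re (g x).
have J_lb x : - C ^+ 2 <= J x.
  have := le_trans (ler_norm _) (le_trans (nrm_Re _) (bg x)).
  by rewrite /J; have := sqr_ge0 (nrm x - C); nra.
have hJ : has_inf (range J).
  by split; [exists (J 0), 0|exists (- C ^+ 2) => _ [x _ <-]].
pose m := inf (range J).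
have Jm x : m <= J x by apply: ge_inf; [exact: hJ.2|exists x].
pose eta k : R := k.+1%:R^-1.
have eta0 k : 0 < eta k by rewrite invr_gt0.
have /choice[u hu] : forall k, exists x, J x <= m + eta k ^+ 2.
  move=> k; have [_ [x _ <-] h] := inf_adherent (exprn_gt0 2 (eta0 k)) hJ.
  by exists x; exact: ltW.
(* As [J] is at least [m] at the midpoint and at most [m + eta k ^+ 2] at both ends, this identity
   makes the minimising sequence Cauchy. *)
have Jhalf x y : nrm (x - y) ^+ 2 = 2 * J x + 2 * J y - 4 * J ((2^-1)%:C *: (x + y)).
  rewrite parallelogram /J nrmZ nrm_real (lin_scale lg') (lin_add lg').
  by rewrite ReZ ReD ger0_norm // exprMn; field.
have cau : forall k l, (k <= l)%N -> nrm (u k - u l) <= 2 * eta k.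
  move=> k l kl; rewrite -(ler_pXn2r (n := 2)) // ?nnegrE ?nrm_ge0 ?(mulr_ge0 _ (ltW (eta0 k))) //.
  have lk : eta l <= eta k by rewrite lef_pV2 ?posrE ?ltr0n // ler_nat.
  have := hu k; have := hu l; have := Jm ((2^-1)%:C *: (u k + u l)).
  have : eta l ^+ 2 <= eta k ^+ 2 by rewrite ler_pXn2r // nnegrE ltW.
  by rewrite Jhalf exprMn; lra.
have [y hy] := cauchy_limit cau (small_inv_mul 2).
exists y.
(* An approximate Euler equation at [u k]: moving by [eta k] in the directions [h] and [- h]
   balances the first order term against the minimisation error [eta k ^+ 2]. *)
have key h k : `|complex.Re (g h - dotp h (u k))| <= eta k * (1 + nrm h ^+ 2).
  have hE t : J (u k + t%:C *: h) =
      J (u k) - 2 * t * complex.Re (g h - dotp h (u k)) + t ^+ 2 * nrm h ^+ 2.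
    rewrite /J (_ : g (u k + _) = g (u k) + t%:C * g h); last first.
      by rewrite addrC lg addrC.
    rewrite !ReD ReZ ReN.
    rewrite -[nrm (u k + _) ^+ 2]/(complex.Re (nrm (u k + t%:C *: h) ^+ 2)%:C).
    rewrite -dotpp dotpDl !dotpDr !dotpZl !dotpZr conjC_real !ReD !ReZ !dotpp /=.
    by rewrite -[complex.Re (dotp (u k) h)]Re_conj -dotpC; ring.
  have := Jm (u k + (eta k)%:C *: h); have := Jm (u k + (- eta k)%:C *: h).
  rewrite !hE; have := hu k; have e0 := eta0 k.
  set a := complex.Re _; rewrite ler_norml => h1 h2 h3.
  have h4 : eta k * (- 2 * a) <= eta k * (eta k * (1 + nrm h ^+ 2)) by nra.
  have h5 : eta k * (2 * a) <= eta k * (eta k * (1 + nrm h ^+ 2)) by nra.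
  rewrite !ler_pM2l // in h4 h5.
  have : 0 <= eta k * (1 + nrm h ^+ 2) by rewrite mulr_ge0 ?addr_ge0 ?sqr_ge0 // ltW.
  by move=> h6; apply/andP; split; lra.
have Re0 h : complex.Re (g h - dotp h y) = 0.
  apply/eqP; rewrite -normr_le0; apply/ler_addgt0Pr => e e0; rewrite add0r.
  have [k hk] := small_inv_mul (1 + nrm h ^+ 2 + 2 * nrm h) e0.
  have -> : g h - dotp h y = (g h - dotp h (u k)) + dotp h (u k - y).
    by rewrite dotpBr addrA subrK.
  rewrite ReD (le_trans (ler_normD _ _)) // (le_trans _ hk) //.
  have h1 := key h k; have h2 := le_trans (nrm_Re _) (dotp_CS h (u k - y)).
  have h3 := ler_wpM2l (nrm_ge0 h) (hy k).
  by rewrite -/(eta k); lra.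
move=> h; apply/eqP; rewrite -subr_eq0; apply/eqP/nrm_eq0/eqP.
rewrite -sqrf_eq0; apply/eqP/complexI; rewrite -mul_conj.
(* Only real parts are known to vanish; multiplying [h] by the conjugate of the error turns the real
   part into its squared modulus. *)
have := Re0 ((g h - dotp h y)^*%R *: h).
rewrite (lin_scale lg') dotpZl -[X in complex.Re (X - _)]/(_ * _) -mulrBr.
by rewrite mulrC mul_conj /= => ->.
Qed.

Lemma adjP {H K : hilbertType R} (T : H -> K) : bounded_op T ->
  forall x y, dotp (T x) y = dotp x (adj T y).
Proof.
move=> bT; rewrite /adj.
suff hex : exists T' : K -> H, forall x y, dotp (T x) y = dotp x (T' y).
  exact: (@xgetPex _ (cst 0) [set T' | forall x y, dotp (T x) y = dotp x (T' y)]).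
have [C C0 hC] := bounded_op_bound bT.
suff /choice[T' hT'] : forall y, exists z, forall x, dotp (T x) y = dotp x z.
  by exists T'.
move=> y; apply: (@riesz _ _ (C * nrm y)) => [c x1 x2|x].
  by rewrite bT.1 dotpDl dotpZl.
by rewrite (le_trans (dotp_CS _ _)) // mulrAC ler_wpM2r ?nrm_ge0.
Qed.

Lemma adjPr {H K : hilbertType R} (T : H -> K) : bounded_op T ->
  forall x y, dotp (adj T y) x = dotp y (T x).
Proof. by move=> bT x y; rewrite dotpC -adjP // -dotpC. Qed.

Lemma adj_uniq {H K : hilbertType R} (T : H -> K) (T' : K -> H) : bounded_op T ->
  (forall x y, dotp (T x) y = dotp x (T' y)) -> adj T = T'.
Proof. by move=> bT h; apply/funext => y; apply: dotpP => x; rewrite -adjP. Qed.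

Lemma nrm_le_adj {H K : hilbertType R} (C : R) (T : H -> K) : bounded_op T ->
  0 <= C -> nrm_le C T -> nrm_le C (adj T).
Proof.
move=> bT C0 hC y; have := nrm_ge0 (adj T y).
rewrite le0r => /orP[/eqP->|a0]; first by rewrite mulr_ge0 ?nrm_ge0.
suff : nrm (adj T y) ^+ 2 <= C * nrm y * nrm (adj T y) by rewrite expr2 ler_pM2r.
rewrite -[leLHS]/(complex.Re (nrm (adj T y) ^+ 2)%:C) -dotpp -adjP //.
rewrite (le_trans (ler_norm _)) // (le_trans (nrm_Re _)) //.
by rewrite (le_trans (dotp_CS _ _)) // mulrAC ler_wpM2r ?nrm_ge0.
Qed.

Lemma bounded_op_adj {H K : hilbertType R} (T : H -> K) :
  bounded_op T -> bounded_op (adj T).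
Proof.
move=> bT; have [C C0 hC] := bounded_op_bound bT.
apply: (bounded_op_intro _ (nrm_le_adj bT (ltW C0) hC)) => c x y.
by apply: dotpP => z; rewrite dotpDr dotpZr -!adjP // dotpDr dotpZr.
Qed.

Lemma adjK {H K : hilbertType R} (T : H -> K) : bounded_op T -> adj (adj T) = T.
Proof.
by move=> bT; apply: adj_uniq => [|x y]; [exact: bounded_op_adj|rewrite adjPr].
Qed.

Lemma adj_comp {H K L : hilbertType R} (S : K -> L) (T : H -> K) :
  bounded_op S -> bounded_op T -> adj (S \o T) = adj T \o adj S.
Proof.
move=> bS bT; apply: adj_uniq => [|x y /=]; first exact: bounded_op_comp.
by rewrite adjP // adjP.
Qed.

Lemma adjD {H K : hilbertType R} (S T : H -> K) :
  bounded_op S -> bounded_op T -> adj (S + T) = adj S + adj T.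
Proof.
move=> bS bT; apply: adj_uniq => [|x y]; first exact: bounded_opD.
by rewrite !fctE dotpDl dotpDr -!adjP.
Qed.

Lemma adjB {H K : hilbertType R} (S T : H -> K) :
  bounded_op S -> bounded_op T -> adj (S - T) = adj S - adj T.
Proof.
move=> bS bT; apply: adj_uniq => [|x y]; first exact: bounded_opB.
by rewrite !fctE dotpBl dotpBr -!adjP.
Qed.

Lemma adjZ {H K : hilbertType R} (c : R[i]) (T : H -> K) :
  bounded_op T -> adj (c *: T) = c^*%R *: adj T.
Proof.
move=> bT; apply: adj_uniq => [|x y]; first exact: bounded_opZ.
by rewrite !fctE dotpZl dotpZr conjCK -adjP.
Qed.

Lemma adj_id {H : hilbertType R} : adj (id : H -> H) = id.
Proof. by apply: adj_uniq => //; exact: bounded_op_id. Qed.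

(* [G] is the graph of a densely defined operator. *)
Lemma extend_dense {H K : hilbertType R} (G : H -> K -> Prop) (C : R) :
  0 <= C ->
  (forall c x y x' y', G x y -> G x' y' -> G (c *: x + x') (c *: y + y')) ->
  (forall x y, G x y -> nrm y <= C * nrm x) ->
  closure [set x | exists y, G x y] = setT ->
  exists T, [/\ bounded_op T, nrm_le C T & forall x y, G x y -> T x = y].
Proof.
move=> C0 linG bG dG.
have Gsub x y x' y' : G x y -> G x' y' -> nrm (y - y') <= C * nrm (x - x').
  move=> h h'; apply: bG; have := linG (-1) _ _ _ _ h' h.
  by rewrite !scaleN1r ![- _ + _]addrC.
have near x (e : R) : 0 < e -> exists x' y', G x' y' /\ nrm (x - x') <= e.
  move=> e0; have /closure_nrmP/(_ _ e0)[x' [y' Gy] h] :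
    closure [set x | exists y, G x y] x by rewrite dG.
  by exists x', y'; split => //; exact: ltW.
have /choice[T hT] : forall x, exists y, forall x' y', G x' y' ->
    nrm (y - y') <= C * nrm (x - x').
  move=> x; have /choice[p hp] : forall k : nat, exists p : H * K,
      G p.1 p.2 /\ nrm (x - p.1) <= k.+1%:R^-1.
    by move=> k; have [|x' [y' h]] := near x k.+1%:R^-1; [rewrite invr_gt0|exists (x', y')].
  have cau k l : (k <= l)%N -> nrm ((p k).2 - (p l).2) <= C * 2 * k.+1%:R^-1.
    move=> kl; rewrite (le_trans (Gsub _ _ _ _ (hp k).1 (hp l).1)) // -mulrA ler_wpM2l //.
    rewrite (le_trans (nrmBD x _ _)) // mulr_natl mulr2n lerD //.
      by rewrite nrmBC (hp k).2.
    by rewrite (le_trans (hp l).2) // lef_pV2 ?posrE ?ltr0n // ler_nat.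
  have [y hy] := cauchy_limit cau (small_inv_mul (C * 2)).
  exists y => x' y' h; apply/ler_addgt0Pr => e e0.
  have [k hk] := small_inv_mul (C * 3) e0.
  rewrite (le_trans (nrmBD (p k).2 _ _)) // (nrmBC y).
  have h1 := Gsub _ _ _ _ (hp k).1 h; have h2 := hy k.
  have h3 := nrmBD x (p k).1 x'; rewrite (nrmBC _ x) in h3.
  have h4 := ler_wpM2l C0 (le_trans h3 (lerD (hp k).2 (lexx _))).
  by move: h2 h4 hk; set q := k.+1%:R^-1 => h2 h4 hk; lra.
have TG x y : G x y -> T x = y.
  move=> h; apply/eqP; rewrite -subr_eq0; apply/eqP/nrm_eq0/eqP.
  by rewrite eq_le nrm_ge0 andbT (le_trans (hT x x y h)) // subrr nrm0 mulr0.
have G0 : G 0 0.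
  have [x' [y' [h _]]] := near 0 1 ltr01.
  by have := linG (-1) _ _ _ _ h h; rewrite !scaleN1r !addNr.
have bT : nrm_le C T by move=> x; have := hT x 0 0 G0; rewrite !subr0.
exists T; split=> //; apply: (bounded_op_intro _ bT) => c x y.
apply/eqP; rewrite -subr_eq0; apply/eqP/nrm_small_eq0 => e e0.
pose B := C * (nrm c + 1) * 2; have B0 : 0 <= B by rewrite !mulr_ge0 ?addr_ge0 ?nrm_ge0.
have B1 : 0 < B + 1 by rewrite ltr_wpDl.
have r0 : 0 < e / (B + 1) by rewrite divr_gt0.
have [x1 [x2 [Gx hx]]] := near x _ r0.
have [y1 [y2 [Gy hy]]] := near y _ r0.
have h1 := hT _ _ _ (linG c _ _ _ _ Gx Gy).
have h2 := hT _ _ _ Gx; have h3 := hT _ _ _ Gy.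
have -> : T (c *: x + y) - (c *: T x + T y) =
  (T (c *: x + y) - (c *: x2 + y2)) - (c *: (T x - x2) + (T y - y2)).
  rewrite scalerBr addrACA -opprD opprB [RHS]addrA.
  by rewrite subrK.
rewrite (le_trans (nrmB _ _)) // (le_trans (lerD (h1 _) (nrmD _ _))) // nrmZ.
have h4 := ler_wpM2l (nrm_ge0 c) (h2 x).
have h5 : nrm (c *: x + y - (c *: x1 + y1)) <= nrm c * nrm (x - x1) + nrm (y - y1).
  by rewrite opprD addrACA -scalerBr -nrmZ nrmD.
have h6 : nrm c * nrm (x - x1) <= nrm c * (e / (B + 1)) by rewrite ler_wpM2l ?nrm_ge0.
have h7 : B * (e / (B + 1)) <= e.
  by rewrite mulrA ler_pdivrMr // mulrC ler_wpM2l ?lerDl // ltW.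
have h8 := ler_wpM2l C0 h5; have h9 := ler_wpM2l C0 h6.
have h10 := ler_wpM2l C0 hy; have h11 := h3 y.
have h12 := ler_wpM2l (nrm_ge0 c) (ler_wpM2l C0 hx).
move: h7 h8 h9 h10 h12; rewrite /B; set q := e / _ => h7 h8 h9 h10 h12; lra.
Qed.

End BoundedOperators.

(** * Compact operators *)

Section Compactness.
Context {R : realType}.
Local Open Scope complex_scope.

(** The net may consist of any points of [K], not only values of [T], so that sums of nets are nets
    for sums of operators. *)
Definition totally_bounded_op {H K : hilbertType R} (T : H -> K) : Prop :=
  forall e : R, 0 < e -> exists s : seq K, forall x, nrm x <= 1 ->
    exists2 p, p \in s & nrm (T x - p) <= e.

Lemma compact_totally_bounded {H K : hilbertType R} (T : H -> K) :
  compact_op T -> totally_bounded_op T.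
Proof.
move=> [_]; rewrite compact_cover => cT e e0.
have [] := cT K setT (fun p => ball p (e%:C)).
- by move=> p _; exact: ball_open.
- move=> x _; exists x => //; apply: ballxx; by rewrite ltcR.
move=> D _ hD; exists (enum_fset D) => x x1.
have : closure (T @` [set x | `|x| <= 1]) (T x).
  by apply: subset_closure; exists x => //=; rewrite nrmE lecR.
move=> /hD[p /= pD]; rewrite -ball_normE /= nrmE ltcR => h.
by exists p => //; rewrite nrmBC ltW.
Qed.

Lemma ultra_has (T : Type) (U : eqType) (F : set_system T) (s : seq U) (A : U -> set T) :
  UltraFilter F -> F [set x | exists2 p, p \in s & A p x] -> exists2 p, p \in s & F (A p).
Proof.
move=> UF; elim: s => [h|q s IH h].
  have := filter_not_empty F; case; apply: filterS h => x [p] ; by rewrite in_nil.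
have [Fq|FqC] := in_ultra_setVsetC (A q) UF; first by exists q => //; rewrite mem_head.
have [|p ps Fp] := IH; last by exists p => //; rewrite in_cons ps orbT.
apply: filterS (filterI h FqC) => x [[p]]; rewrite in_cons => /orP[/eqP->//|ps Ap _].
by exists p.
Qed.

(** An ultrafilter on the closure of the image contains one ball around some point of each finite
    net; it is therefore Cauchy and converges by completeness of [K]. *)
Lemma totally_bounded_compact {H K : hilbertType R} (T : H -> K) :
  bounded_op T -> totally_bounded_op T -> compact_op T.
Proof.
move=> bT tT; split=> //; rewrite compact_ultra => F UF Fcl.
have /cauchy_cvgP cF : cauchy F.
  apply: cauchy_exP => _ /gt0_real[e e0 ->].
  have e2 : 0 < e / 2 by rewrite divr_gt0.
  have e4 : 0 < e / 4 by rewrite divr_gt0.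
  have [s hs] := tT _ e4.
  have [|p _ Fp] := @ultra_has _ _ F s (fun p => ball p e%:C) UF; last by exists p.
  apply: filterS Fcl => y /closure_nrmP/(_ _ e2)[_ [x /= x1 <-] yx].
  have [|p ps hp] := hs x; first by move: x1; rewrite nrmE lecR.
  exists p => //; rewrite -ball_normE /= nrmE ltcR nrmBC.
  rewrite (le_lt_trans (nrmBD (T x) _ _)) //.
  by rewrite (lt_le_trans (ltr_leD yx hp)) //; lra.
have [l Fl] := (cvg_ex F).1 cF; exists l; split => //.
have : closure (closure (T @` [set x | `|x| <= 1])) l.
  by move=> C /Fl FC; exact: filter_ex (filterI Fcl FC).
by rewrite -(closure_id _).1 //; exact: closed_closure.
Qed.

Lemma compact_opP {H K : hilbertType R} (T : H -> K) :
  compact_op T <-> bounded_op T /\ totally_bounded_op T.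
Proof.
split=> [cT|[bT tT]]; last exact: totally_bounded_compact.
by split; [case: cT|exact: compact_totally_bounded].
Qed.

Lemma compact_op_bounded {H K : hilbertType R} (T : H -> K) :
  compact_op T -> bounded_op T.
Proof. by case. Qed.

Lemma compact_op0 {H K : hilbertType R} : compact_op (0 : H -> K).
Proof.
apply/compact_opP; split=> [|e e0]; first exact: bounded_op0.
by exists [:: 0] => x _; exists 0; rewrite ?mem_head // subrr nrm0 ltW.
Qed.

Lemma compact_opD {H K : hilbertType R} (S T : H -> K) :
  compact_op S -> compact_op T -> compact_op (S + T).
Proof.
move=> /compact_opP[bS tS] /compact_opP[bT tT]; apply/compact_opP.
split=> [|e e0]; first exact: bounded_opD.
have e2 : 0 < e / 2 by rewrite divr_gt0.
have [s hs] := tS _ e2; have [s' hs'] := tT _ e2.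
exists [seq p + q | p <- s, q <- s'] => x x1.
have [p ps hp] := hs _ x1; have [q qs hq] := hs' _ x1.
exists (p + q); first exact: allpairs_f.
rewrite !fctE opprD addrACA (le_trans (nrmD _ _)) //.
by rewrite (le_trans (lerD hp hq)) //; lra.
Qed.

Lemma compact_op_compl {H K L : hilbertType R} (S : K -> L) (T : H -> K) :
  bounded_op S -> compact_op T -> compact_op (S \o T).
Proof.
move=> bS /compact_opP[bT tT]; apply/compact_opP.
split=> [|e e0]; first exact: bounded_op_comp.
have [C C0 hC] := bounded_op_bound bS.
have [s hs] := tT _ (divr_gt0 e0 C0).
exists [seq S p | p <- s] => x x1; have [p ps hp] := hs _ x1.
exists (S p); first exact: map_f.
rewrite /= -(lin_sub bS.1) (le_trans (hC _)) // mulrC -ler_pdivlMr //.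
Qed.

(** [T] maps the unit ball into the ball of radius [C], so a net for [S] at scale [e / C] is dilated
    by [C]. *)
Lemma compact_op_compr {H K L : hilbertType R} (S : K -> L) (T : H -> K) :
  compact_op S -> bounded_op T -> compact_op (S \o T).
Proof.
move=> /compact_opP[bS tS] bT; apply/compact_opP.
split=> [|e e0]; first exact: bounded_op_comp.
have [C C0 hC] := bounded_op_bound bT.
have [s hs] := tS _ (divr_gt0 e0 C0).
exists [seq C%:C *: p | p <- s] => x x1.
have [|p ps hp] := hs (C^-1%:C *: T x).
  rewrite nrmZ nrm_real ger0_norm ?invr_ge0 ?(ltW C0) // mulrC ler_pdivrMr // mul1r.
  by rewrite (le_trans (hC x)) // ler_piMr // ltW.
exists (C%:C *: p); first exact: map_f.
rewrite /= -[T x]scale1r -[1]/(1%:C) -(divff (lt0r_neq0 C0)) rcM -scalerA.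
rewrite (lin_scale bS.1) -scalerBr nrmZ nrm_real ger0_norm ?(ltW C0) //.
by rewrite mulrC -ler_pdivlMr.
Qed.

Lemma compact_opZ {H K : hilbertType R} (c : R[i]) (T : H -> K) :
  compact_op T -> compact_op (c *: T).
Proof.
by move=> cT; apply: compact_op_compl cT; apply/bounded_opZ/bounded_op_id.
Qed.

Lemma compact_opN {H K : hilbertType R} (T : H -> K) :
  compact_op T -> compact_op (- T).
Proof. by move=> cT; rewrite -scaleN1r; apply: compact_opZ. Qed.

Lemma compact_opB {H K : hilbertType R} (S T : H -> K) :
  compact_op S -> compact_op T -> compact_op (S - T).
Proof. by move=> cS cT; apply: compact_opD => //; apply: compact_opN. Qed.

Lemma compact_op_limit {H K : hilbertType R} (T : H -> K) :
  bounded_op T ->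
  (forall e : R, 0 < e -> exists2 S, compact_op S & nrm_le e (T - S)) ->
  compact_op T.
Proof.
move=> bT hT; apply/compact_opP; split=> // e e0.
have e2 : 0 < e / 2 by rewrite divr_gt0.
have [S /compact_opP[bS /(_ _ e2)[s hs]] TS] := hT _ e2.
exists s => x x1; have [p ps hp] := hs _ x1; exists p => //.
rewrite (le_trans (nrmBD (S x) _ _)) // (_ : e = e / 2 + e / 2); last by field.
by rewrite lerD // (le_trans (TS x)) // ler_piMr // ltW.
Qed.

(* [|T^* (x - y)|^2 = <T T^* (x - y), x - y>], and [T T^*] is compact. *)
Lemma compact_op_adj {H K : hilbertType R} (T : H -> K) :
  compact_op T -> compact_op (adj T).
Proof.
move=> cT; have bT := compact_op_bounded cT; have bT' := bounded_op_adj bT.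
have /compact_opP[_ tT] := compact_op_compr cT bT'.
apply/compact_opP; split=> // e e0.
have e2 : 0 < e ^+ 2 / 4 by rewrite divr_gt0 ?exprn_gt0.
have [s hs] := tT _ e2.
(* Each net point [p] of [T \o adj T] is replaced by a vector of the unit ball mapped near it, with
   default [0] if there is none. Images of such vectors then differ by at most [e ^+ 2 / 2], and the
   vectors themselves by at most [2]. *)
pose near p x := nrm x <= 1 /\ nrm ((T \o adj T) x - p) <= e ^+ 2 / 4.
pose pick p := xget 0 (near p).
exists [seq adj T (pick p) | p <- s] => x x1.
have [p ps hp] := hs _ x1; exists (adj T (pick p)); first exact: map_f.
have [y1 hy] : near p (pick p) by apply: (@xgetPex _ 0 (near p)); exists x.
rewrite -(ler_pXn2r (n := 2)) // ?nnegrE ?nrm_ge0 ?(ltW e0) // -(lin_sub bT'.1).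
rewrite -[leLHS]/(complex.Re (nrm (adj T (x - pick p)) ^+ 2)%:C) -dotpp -adjP //.
rewrite (le_trans (ler_norm _)) // (le_trans (nrm_Re _)) //.
rewrite (le_trans (dotp_CS _ _)) // (lin_sub bT'.1) (lin_sub bT.1).
have h1 : nrm (x - pick p) <= 2 by rewrite (le_trans (nrmB _ _)) //; lra.
have h2 : nrm (T (adj T x) - T (adj T (pick p))) <= e ^+ 2 / 2.
  rewrite (le_trans (nrmBD p _ _)) // (nrmBC p) (_ : _ / 2 = e ^+ 2 / 4 + e ^+ 2 / 4).
    exact: lerD.
  by field.
have := ler_pM (nrm_ge0 _) (nrm_ge0 _) h2 h1.
by rewrite divfK.
Qed.

Lemma interval_net (B e : R) : 0 < e -> exists s : seq R, forall x, `|x| <= B ->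
  exists2 p, p \in s & `|x - p| <= e.
Proof.
move=> e0; pose N := (Num.trunc (2 * B / e)).+1.
exists [seq k%:R * e - B | k <- iota 0 N] => x; rewrite ler_norml => /andP[x1 x2].
have h0 : 0 <= (x + B) / e by rewrite divr_ge0 ?(ltW e0) //; lra.
have /andP[h1 h2] := truncn_itv h0; set k := Num.trunc _ in h1 h2.
exists (k%:R * e - B).
  apply: (map_f (fun i : nat => i%:R * e - B)); rewrite mem_iota add0n ltnS /=.
  apply: le_truncn.
  by rewrite ler_pM2r ?invr_gt0 //; lra.
rewrite ler_pdivlMr // in h1; rewrite ltr_pdivrMr // -natr1 mulrDl mul1r in h2.
by rewrite ler_norml; apply/andP; split; lra.
Qed.

Lemma compact_op_rank1 {H K : hilbertType R} (u : H) (v : K) :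
  compact_op (fun x => dotp x u *: v).
Proof.
apply/compact_opP; split=> [|e e0].
  apply: (bounded_op_intro (C := nrm u * nrm v)) => [c x y|x].
    by rewrite dotpDl dotpZl scalerDl scalerA.
  by rewrite nrmZ mulrAC ler_wpM2r ?nrm_ge0 // mulrC dotp_CS.
have v1 : 0 < nrm v + 1 by rewrite ltr_wpDl ?nrm_ge0.
have d0 : 0 < e / 2 / (nrm v + 1) by rewrite !divr_gt0.
have [s hs] := interval_net (nrm u) d0.
exists [seq (p +i* q) *: v | p <- s, q <- s] => x x1.
have hx : nrm (dotp x u) <= nrm u.
  by rewrite (le_trans (dotp_CS _ _)) // ler_piMl ?nrm_ge0.
have [p ps hp] := hs _ (le_trans (nrm_Re _) hx).
have [q qs hq] := hs _ (le_trans (nrm_Im _) hx).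
exists ((p +i* q) *: v); first exact: allpairs_f.
rewrite -scalerBl nrmZ.
have h : nrm (dotp x u - (p +i* q)) <= e / (nrm v + 1).
  have -> : dotp x u - (p +i* q) = (complex.Re (dotp x u) - p)%:C +
      'i%C * (complex.Im (dotp x u) - q)%:C.
    by rewrite {1}[dotp x u]complexE !rcD !rcN [p +i* q]complexE /=; ring.
  rewrite (le_trans (nrmD _ _)) // nrmM !nrm_real.
  rewrite (_ : nrm 'i%C = 1) ?mul1r; last first.
    by rewrite /nrm normc_def /= expr0n /= add0r expr1n sqrtr1.
  by rewrite (le_trans (lerD hp hq)) // -mulrDl ler_wpM2r ?invr_ge0 ?(ltW v1) //; lra.
rewrite (le_trans (ler_wpM2r (nrm_ge0 v) h)) // mulrAC ler_pdivrMr // ler_pM2l //.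
by rewrite lerDl.
Qed.

End Compactness.

(** * Coercivity and inverse square roots *)

Section Coercivity.
Context {R : realType}.
Local Open Scope complex_scope.

Lemma geometric_cauchy {V : normedZmodType R[i]} (u : nat -> V) (C rho : R) :
  0 <= C -> 0 <= rho -> rho < 1 ->
  (forall k, nrm (u k.+1 - u k) <= C * rho ^+ k) ->
  forall k l, (k <= l)%N -> nrm (u k - u l) <= C / (1 - rho) * rho ^+ k.
Proof.
move=> C0 r0 r1 h k l /subnKC <-; set j := (l - k)%N.
have r2 : 0 < 1 - rho by rewrite subr_gt0.
(* The induction on [j] carries the exact partial sum of the geometric series. *)
suff : nrm (u k - u (k + j)%N) <= C / (1 - rho) * (rho ^+ k - rho ^+ (k + j)).
  move/le_trans; apply; rewrite ler_wpM2l ?divr_ge0 ?(ltW r2) //.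
  by rewrite gerBl exprn_ge0.
elim: j => [|j IH]; first by rewrite addn0 !subrr nrm0 mulr0.
rewrite addnS (le_trans (nrmBD (u (k + j)%N) _ _)) //.
rewrite (nrmBC (u (k + j)%N)) (le_trans (lerD IH (h _))) // exprS.
rewrite le_eqVlt; apply/orP; left; apply/eqP; field.
by rewrite gt_eqF.
Qed.

(* Gliding hump: the signs in [hump] are chosen so that [dotp (z n) y] is at
   least half of [3 ^- n * nrm (z n)] for the limit [y]. *)
Lemma uniformly_bounded_vectors {H : hilbertType R} (Z : set H) :
  (forall y, exists M : R, forall z, Z z -> nrm (dotp z y) <= M) ->
  exists2 M : R, 0 < M & forall z, Z z -> nrm z <= M.
Proof.
move=> hZ; apply: contrapT => hM.
(* The growth [4 ^+ n] is chosen to outrun the weights [3 ^- n] of the series for [y]. *)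
have /choice[z hz] : forall n : nat, exists z, Z z /\ (4 : R) ^+ n <= nrm z.
  move=> n; apply: contrapT => hn; apply: hM; exists (4 ^+ n); first exact: exprn_gt0.
  move=> z Zz; rewrite leNgt; apply/negP => /ltW h; apply: hn.
  by exists z.
have z0 n : 0 < nrm (z n) by rewrite (lt_le_trans _ (hz n).2) // exprn_gt0.
pose r : R := 3^-1.
have r0 : 0 <= r by rewrite invr_ge0.
have r1 : r < 1 by rewrite invf_lt1 // ltr1n.
pose v n : H := (r ^+ n / nrm (z n))%:C *: z n.
have nv n : nrm (v n) = r ^+ n.
  rewrite nrmZ nrm_real ger0_norm ?divr_ge0 ?exprn_ge0 ?nrm_ge0 //.
  by rewrite divfK // gt_eqF.
have zv n : dotp (z n) (v n) = (r ^+ n * nrm (z n))%:C.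
  rewrite dotpZr conjC_real dotpp -rcM; congr (_%:C); rewrite expr2 mulrA.
  by rewrite divfK ?gt_eqF.
pose hump := fix hump n := if n is m.+1 then
   if r ^+ m * nrm (z m) <= nrm (dotp (z m) (hump m + v m)) then hump m + v m
   else hump m - v m else (0 : H).
have hump_step n : nrm (hump n.+1 - hump n) <= 1 * r ^+ n.
  by rewrite mul1r /=; case: ifP => _; rewrite addrC addKr ?nrmN nv.
have hump_big n : r ^+ n * nrm (z n) <= nrm (dotp (z n) (hump n.+1)).
  rewrite /=; case: ifP => // /negbT; rewrite -ltNge => h.
  have : nrm (dotp (z n) (v n) + dotp (z n) (v n)) = 2 * (r ^+ n * nrm (z n)).
    by rewrite zv -rcD nrm_real ger0_norm ?addr_ge0 ?mulr_ge0 ?exprn_ge0 ?nrm_ge0 //; ring.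
  have -> : dotp (z n) (v n) + dotp (z n) (v n) =
     dotp (z n) (hump n + v n) - dotp (z n) (hump n - v n).
    by rewrite dotpDr dotpBr; ring.
  have := nrmB (dotp (z n) (hump n + v n)) (dotp (z n) (hump n - v n)); lra.
have cau := geometric_cauchy ler01 r0 r1 hump_step.
have [y hy] := cauchy_limit cau (fun e e0 => geom_small _ r0 r1 e0).
have [M hMy] := hZ y.
(* The factor [3 / 4] is the inverse of [4 / 3], the ratio at which [r ^+ n * 4 ^+ n] grows; [n] is
   taken so large that this growth exceeds [2 * M]. *)
have q0 : 0 <= 3 / 4 :> R by rewrite divr_ge0.
have q1 : 3 / 4 < 1 :> R by rewrite ltr_pdivrMr // mul1r ltr_nat.
have e0 : 0 < 4^-1 :> R by rewrite invr_gt0.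
have [n hn] := geom_small M q0 q1 e0.
(* All later humps together have norm at most [r ^+ n / 2], because [3^-1 / (1 - 3^-1) = 2^-1]; they
   cancel at most half of the [n]-th one. *)
have h1 : nrm (dotp (z n) (hump n.+1)) <= M + nrm (z n) * (r ^+ n / 2).
  have -> : dotp (z n) (hump n.+1) = dotp (z n) y + dotp (z n) (hump n.+1 - y).
    by rewrite dotpBr addrC subrK.
  rewrite (le_trans (nrmD _ _)) // lerD ?(hMy _ (hz n).1) //.
  rewrite (le_trans (dotp_CS _ _)) // ler_wpM2l ?nrm_ge0 // (le_trans (hy _)) //.
  by rewrite exprS /r le_eqVlt; apply/orP; left; apply/eqP; field.
have h2 : r ^+ n * 4 ^+ n <= r ^+ n * nrm (z n).
  by rewrite ler_wpM2l ?exprn_ge0 // (hz n).2.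
have h3 : (3 / 4) ^+ n * (r ^+ n * 4 ^+ n) = 1.
  by rewrite -!exprMn (_ : 3 / 4 * (r * 4) = 1) ?expr1n // /r; field.
have h4 : r ^+ n * 4 ^+ n <= 2 * M.
  by have := hump_big n; lra.
have := ler_wpM2l (exprn_ge0 n q0) h4; rewrite h3 mulrCA => h5.
by rewrite mulrC in hn; lra.
Qed.

(* [W] complements the range of [S^* S], so the functionals [dotp z] with
   [S z] and the [dotp z (u i)] bounded are pointwise bounded. *)
Lemma fredholm_coercive {H K : hilbertType R} (S : H -> K) :
  bounded_op S -> fredholm (adj S \o S) ->
  exists (n : nat) (u : 'I_n -> H) (M : R), 0 < M /\
    forall z, nrm z ^+ 2 <=
      M ^+ 2 * (nrm (S z) ^+ 2 + \sum_(i < n) nrm (dotp z (u i)) ^+ 2).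
Proof.
move=> bS [_ _ _ [W [[n [u hW]] hfull]]]; exists n, u.
have [|M M0 hM] := @uniformly_bounded_vectors H
    [set z | nrm (S z) <= 1 /\ forall i, nrm (dotp z (u i)) <= 1].
  move=> y; have [x [w [Ww ->]]] := hfull y.
  have [m [c [g [hg ->]]]] := hW _ Ww.
  exists (nrm (S x) + \sum_(i < m) nrm (c i)) => z [Sz uz].
  rewrite dotpDr (le_trans (nrmD _ _)) // lerD //.
    rewrite /= -adjP // (le_trans (dotp_CS _ _)) // ler_piMl ?nrm_ge0 //.
  rewrite dotp_sumr (le_trans (nrm_sum _)) //; apply: ler_sum => i _.
  have [j _ <-] := hg i.
  by rewrite dotpZr nrmM nrm_conj ler_piMr ?nrm_ge0.
exists M; split=> // z; set q := nrm (S z) ^+ 2 + _.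
have sum0 : 0 <= \sum_(i < n) nrm (dotp z (u i)) ^+ 2.
  by apply: sumr_ge0 => i _; exact: sqr_ge0.
have q0 : 0 <= q by rewrite addr_ge0 ?sqr_ge0.
(* Dividing by [r] moves [z] into the bounded set. Since [q] may vanish, [r] is later taken slightly
   larger than its square root. *)
have hr r : 0 < r -> q <= r ^+ 2 -> nrm z <= M * r.
  move=> r0 qr; have rr : nrm ((r^-1)%:C : R[i]) = r^-1.
    by rewrite nrm_real ger0_norm // invr_ge0 ltW.
  have le_r a : 0 <= a -> a ^+ 2 <= q -> r^-1 * a <= 1.
    move=> a0 aq; rewrite ler_pdivrMl // mulr1.
    rewrite -(ler_pXn2r (n := 2)) // ?nnegrE ?(ltW r0) //.
    exact: le_trans qr.
  have := hM ((r^-1)%:C *: z); rewrite nrmZ rr => h.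
  rewrite mulrC -ler_pdivrMl //; apply: h; split=> [|i].
    by rewrite (lin_scale bS.1) nrmZ rr le_r ?nrm_ge0 // lerDl.
  rewrite dotpZl nrmM rr le_r ?nrm_ge0 //.
  rewrite /q (bigD1 i) //= addrCA lerDl addr_ge0 ?sqr_ge0 //.
  by apply: sumr_ge0 => j _; exact: sqr_ge0.
have : nrm z <= M * Num.sqrt q.
  apply/ler_addgt0Pr => e e0; have r0 : 0 < Num.sqrt q + e / M.
    by rewrite ltr_wpDl ?sqrtr_ge0 // divr_gt0.
  rewrite (le_trans (hr _ r0 _)) //; last first.
    by rewrite mulrDr mulrCA divff ?mulr1 // gt_eqF.
  rewrite -{1}(sqr_sqrtr q0) ler_pXn2r // ?nnegrE ?sqrtr_ge0 ?(ltW r0) //.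
  by rewrite lerDl divr_ge0 // ltW.
rewrite -(ler_pXn2r (n := 2)) // ?nnegrE ?nrm_ge0 ?mulr_ge0 ?sqrtr_ge0 ?(ltW M0) //.
by rewrite exprMn sqr_sqrtr.
Qed.

End Coercivity.

Section InverseSqrt.
Context {R : realType}.
Local Open Scope complex_scope.

Definition symmetric_op {H : hilbertType R} (T : H -> H) : Prop :=
  forall x y, dotp (T x) y = dotp x (T y).

Definition commutator {H : hilbertType R} (S T : H -> H) : H -> H :=
  (S \o T) - (T \o S).

(** Compactness of commutators passes to polynomials by the Leibniz rule [[Y^2, L] = Y [Y, L] +
    [Y, L] Y]. *)
Lemma commutator_compact_sqrt_iter {H : hilbertType R} (A L : H -> H) k :
  (forall k, bounded_op (sqrt_iter A k)) -> bounded_op A -> bounded_op L ->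
  compact_op (commutator A L) -> compact_op (commutator (sqrt_iter A k) L).
Proof.
move=> bY bA bL cA; elim: k => [|k IH].
  rewrite (_ : commutator _ _ = 0); first exact: compact_op0.
  by apply/funext => x; rewrite /commutator !fctE /= (lin0 bL.1) subrr.
rewrite (_ : commutator _ _ = (2^-1)%:C *: (commutator A L +
   ((sqrt_iter A k \o commutator (sqrt_iter A k) L) +
    (commutator (sqrt_iter A k) L \o sqrt_iter A k)))).
  apply: compact_opZ.
  exact: (compact_opD cA (compact_opD (compact_op_compl (bY k) IH) (compact_op_compr IH (bY k)))).
apply/funext => x; rewrite /commutator !fctE /= (lin_scale bL.1) -scalerBr.
rewrite (lin_add bL.1) (lin_sub (bY k).1); congr (_ *: _).
(* Pairing with an arbitrary vector turns an additive identity between vectors into one in [R[i]],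
   within reach of [ring]. *)
by apply: dotpP => w; rewrite !(dotpDr, dotpBr, dotpNr); ring.
Qed.

Lemma commutatorN {H : hilbertType R} (T L : H -> H) (c : R[i]) :
  linear L -> commutator (id - c *: T) L = - (c *: commutator T L).
Proof.
move=> lL; apply/funext => x; rewrite /commutator !fctE /=.
rewrite (lin_sub lL) (lin_scale lL) scalerBr !opprB addrC.
by rewrite addrA subrK addrC.
Qed.

(* [N] is [sqrt c * (1 - Y)^-1] with [Y] the limit of [sqrt_iter (1 - c F)]. *)
Lemma inverse_sqrt {H : hilbertType R} (F : H -> H) (delta : R) :
  bounded_op F -> symmetric_op F -> 0 < delta ->
  (forall z, delta * nrm z ^+ 2 <= complex.Re (dotp (F z) z)) ->
  exists N : H -> H, [/\ bounded_op N, symmetric_op N, N \o F \o N = id &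
    forall L, bounded_op L -> compact_op (commutator F L) ->
      compact_op (commutator N L)].
Proof.
move=> bF sF d0 hF; have [B B0 hB] := bounded_op_bound bF.
have hF' z : delta * semi_norm dotp z ^+ 2 <= complex.Re (dotp (F z) z).
  by rewrite semi_norm_dotp.
have hB' z : semi_norm dotp (F z) <= B * semi_norm dotp z.
  by rewrite !semi_norm_dotp.
have [c [rho [c0 r0 r1 hA']]] := coercive_contraction dotp_semi_inner d0 hF' hB'.
pose A := id - c%:C *: F; rewrite -/A in hA'; have bA : bounded_op A.
  by apply: bounded_opB; [exact: bounded_op_id|exact: bounded_opZ].
have lY := sqrt_iter_linear bA.1.
have hY := sqrt_iter_le dotp_semi_inner r0 (ltW r1) hA'.
have step := sqrt_iter_step dotp_semi_inner bA.1 r0 (ltW r1) hA'.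
have sqY := sqrt_iter_sq dotp_semi_inner bA.1 r0 (ltW r1) hA'.
have sA : symmetric_op A.
  by move=> x y; rewrite /A !fctE dotpBl dotpBr dotpZl dotpZr conjC_real sF.
have sY := sqrt_iter_sym dotp_semi_inner sA.
set Yk := sqrt_iter A in lY hY step sqY sY.
have {}hY k : nrm_le rho (Yk k) by move=> x; have := hY k x; rewrite !semi_norm_dotp.
have bYk k : bounded_op (Yk k) := bounded_op_intro (lY k) (hY k).
have r2 : 0 < 1 - rho by rewrite subr_gt0.
have [Y bY YkY] : exists2 Y, bounded_op Y &
    forall k, nrm_le (rho / (1 - rho) * rho ^+ k) (Yk k - Y).
  apply: op_limit => // [k l kl x|e e0]; last exact: geom_small.
  have := @geometric_cauchy _ _ (fun k => Yk k x) (rho * nrm x) rho.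
  rewrite mulr_ge0 ?nrm_ge0 // => /(_ isT r0 r1) h.
  rewrite (le_trans (h _ k l kl)) //; last first.
    by rewrite le_eqVlt; apply/orP; left; apply/eqP; ring.
  move=> j; have := step j x; rewrite !semi_norm_dotp exprS.
  by rewrite mulrAC.
have small (C e : R) : 0 < e -> exists k, C * rho ^+ k <= e by exact: geom_small.
have Yrho : nrm_le rho Y.
  move=> x; apply/ler_addgt0Pr => e e0.
  have [k hk] := small (rho / (1 - rho) * nrm x) _ e0.
  rewrite -[Y x](subrK (Yk k x)) (le_trans (nrmD _ _)) // addrC lerD ?hY //.
  rewrite nrmBC (le_trans (YkY k x)) // (le_trans _ hk) //.
  by rewrite le_eqVlt; apply/orP; left; apply/eqP; ring.
have symY : symmetric_op Y.
  move=> x y; apply/eqP; rewrite -subr_eq0; apply/eqP/nrm_small_eq0 => e e0.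
  have [k hk] := small (2 * (rho / (1 - rho) * (nrm x * nrm y))) _ e0.
  have -> : dotp (Y x) y - dotp x (Y y) =
      dotp x ((Yk k - Y) y) - dotp ((Yk k - Y) x) y.
    by rewrite !fctE dotpBl dotpBr sY; ring.
  rewrite (le_trans (nrmB _ _)) // (le_trans (lerD (dotp_CS _ _) (dotp_CS _ _))) //.
  have h1 := ler_wpM2l (nrm_ge0 x) (YkY k y).
  have h2 := ler_wpM2r (nrm_ge0 y) (YkY k x).
  rewrite (le_trans (lerD h1 h2)) // (le_trans _ hk) //.
  by rewrite le_eqVlt; apply/orP; left; apply/eqP; ring.
(* The limit of [sqrt_iter_sq], that is [(1 - Y)^2 = 1 - A = c F]; the correction terms replace
   [Yk k] by [Y] one factor at a time. *)
have Zsq x : (x - Y x) - Y (x - Y x) = c%:C *: F x.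
  apply/eqP; rewrite -subr_eq0; apply/eqP/nrm_small_eq0 => e e0.
  pose D := 2 * rho * nrm x + rho / (1 - rho) * (nrm x + nrm (x - Y x) + rho * nrm x).
  have [k hk] := small D _ e0.
  have -> : x - Y x - Y (x - Y x) - c%:C *: F x =
     ((x - Yk k x) - Yk k (x - Yk k x) - (x - A x)) +
     ((Yk k - Y) x + (Yk k - Y) (x - Y x) + Yk k (Y x - Yk k x)).
    rewrite !fctE (lin_sub (lY k) x (Yk k x)) (lin_sub (lY k) (Y x)).
    rewrite (lin_sub (lY k) x (Y x)) /A !fctE.
    by apply: dotpP => z; rewrite !(dotpDr, dotpBr, dotpNr); ring.
  have h1 := sqY k x; rewrite !semi_norm_dotp in h1.
  have h2 := YkY k x; have h3 := YkY k (x - Y x).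
  have h4 : nrm (Yk k (Y x - Yk k x)) <= rho * (rho / (1 - rho) * rho ^+ k * nrm x).
    by rewrite (le_trans (hY _ _)) // ler_wpM2l // nrmBC; exact: YkY.
  rewrite (le_trans (nrmD _ _)) // (le_trans (lerD h1 (le_trans (nrmD _ _)
    (lerD (le_trans (nrmD _ _) (lerD h2 h3)) h4)))) // (le_trans _ hk) //.
  by rewrite exprS le_eqVlt; apply/orP; left; apply/eqP; rewrite /D; ring.
pose Z x := x - Y x.
have Zbelow x : (1 - rho) * nrm x <= nrm (Z x).
  have := nrmD (x - Y x) (Y x); rewrite subrK; have := Yrho x; rewrite /Z; lra.
have lZ : linear Z.
  by move=> a x y; rewrite /Z bY.1 scalerBr opprD addrACA.
have Zinj x y : Z x = Z y -> x = y.
  move=> xy; apply/eqP; rewrite -subr_eq0; apply/eqP/nrm_eq0/eqP.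
  rewrite eq_le nrm_ge0 andbT -(pmulr_rle0 _ r2) (le_trans (Zbelow _)) //.
  by rewrite (lin_sub lZ) xy subrr nrm0.
have /choice[N0 ZN0] : forall x, exists z, Z z = x.
  (* Surjectivity of [1 - Y] by the Neumann series, whose partial sums obey this recursion. *)
  move=> x; pose n := fix n k := if k is k'.+1 then x + Y (n k') else (0 : H).
  have nstep k : nrm (n k.+1 - n k) <= nrm x * rho ^+ k.
    elim: k => [|k IH]; first by rewrite /= (lin0 bY.1) addr0 subr0 mulr1.
    rewrite -[n k.+2]/(x + Y (n k.+1)) {2}/n -/n opprD addrACA subrr add0r.
    rewrite -(lin_sub bY.1) (le_trans (Yrho _)) // exprS mulrCA ler_wpM2l //.
  have cau := geometric_cauchy (nrm_ge0 x) r0 r1 nstep.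
  have [z hz] := cauchy_limit cau (small _).
  exists z; apply/eqP; rewrite -subr_eq0; apply/eqP/nrm_small_eq0 => e e0.
  have [k hk] := small (nrm x / (1 - rho) * (rho + rho)) _ e0.
  have -> : Z z - x = Y (n k - z) - (n k.+1 - z).
    rewrite /Z /= (lin_sub bY.1).
    by apply: dotpP => w; rewrite !(dotpDr, dotpBr, dotpNr); ring.
  rewrite (le_trans (nrmB _ _)) // (le_trans (lerD (le_trans (Yrho _)
    (ler_wpM2l r0 (hz k))) (hz k.+1))) // (le_trans _ hk) // exprS.
  by rewrite le_eqVlt; apply/orP; left; apply/eqP; ring.
have N0Z x : N0 (Z x) = x by apply: Zinj; rewrite ZN0.
have bN0 : bounded_op N0.
  apply: (bounded_op_intro (C := (1 - rho)^-1)) => [a x y|x].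
    by apply: Zinj; rewrite lZ !ZN0.
  by rewrite ler_pdivlMl // -{2}(ZN0 x).
have sZ : symmetric_op Z by move=> x y; rewrite /Z dotpBl dotpBr symY.
have sN0 : symmetric_op N0.
  by move=> x y; rewrite -{1}(ZN0 y) -sZ ZN0.
pose s : R[i] := (Num.sqrt c)%:C.
have ss : s * s = c%:C by rewrite /s -rcM -expr2 sqr_sqrtr // ltW.
exists (s *: N0); split.
- exact: bounded_opZ.
- by move=> x y; rewrite !fctE dotpZl dotpZr conjC_real sN0.
- apply/funext => x; rewrite /= !fctE (lin_scale bF.1) (lin_scale bN0.1).
  rewrite scalerA ss -(lin_scale bN0.1) -Zsq -/(Z (N0 x)) -/(Z (Z (N0 x))).
  by rewrite ZN0 N0Z.
move=> L bL cF; have cA : compact_op (commutator A L).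
  by rewrite /A commutatorN //; [apply/compact_opN/compact_opZ|exact: bL.1].
have cY : compact_op (commutator Y L).
  apply: compact_op_limit => [|e e0].
    by apply: bounded_opB; apply: bounded_op_comp.
  have [C C0 hC] := bounded_op_bound bL.
  have [k hk] := small (rho / (1 - rho) * (2 * C)) _ e0.
  exists (commutator (Yk k) L).
    exact: commutator_compact_sqrt_iter.
  have -> : commutator Y L - commutator (Yk k) L =
     (L \o (Yk k - Y)) - ((Yk k - Y) \o L).
    apply/funext => x; rewrite /commutator !fctE /= (lin_sub bL.1).
    by apply: dotpP => w; rewrite !(dotpDr, dotpBr, dotpNr); ring.
  apply: nrm_le_mono (nrm_leB (nrm_le_comp (ltW C0) hC (YkY k)) (nrm_le_comp _ (YkY k) hC)).
    by rewrite (le_trans _ hk) // le_eqVlt; apply/orP; left; apply/eqP; ring.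
  by rewrite mulr_ge0 ?exprn_ge0 // divr_ge0 // ltW.
(* Since [N0] inverts [1 - Y], one has [[N0, L] = N0 [L, 1 - Y] N0 = N0 [Y, L] N0]. *)
rewrite (_ : commutator _ _ = s *: (N0 \o commutator Y L \o N0)).
  by apply/compact_opZ/compact_op_compr => //; exact: compact_op_compl.
apply/funext => x; rewrite /commutator !fctE /= (lin_scale bL.1) -scalerBr.
congr (_ *: _); set y := N0 x.
rewrite -[in LHS](N0Z (L y)) -[in N0 (L x)](ZN0 x) -/y -(lin_sub bN0.1).
congr N0; rewrite /Z (lin_sub bL.1); apply: dotpP => w.
by rewrite !(dotpDr, dotpBr, dotpNr); ring.
Qed.

End InverseSqrt.

(** * Tensor products and the standard form *)

Section Spans.
Context {R : realType}.
Implicit Type V : lmodType R[i].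

Lemma lin_span_gen {V} (G : set V) g : G g -> lin_span G g.
Proof.
by move=> Gg; exists 1%N, (fun=> 1), (fun=> g); split => //; rewrite big_ord1 scale1r.
Qed.

Lemma lin_span0 {V} (G : set V) : lin_span G 0.
Proof. by exists 0%N, (fun=> 0), (fun=> 0); split => [[]//|]; rewrite big_ord0. Qed.

Lemma lin_spanD {V} (G : set V) v w :
  lin_span G v -> lin_span G w -> lin_span G (v + w).
Proof.
move=> [n [c [g [hg ->]]]] [m [d [h [hh ->]]]].
exists (n + m)%N,
  (fun i : 'I_(n + m) => match fintype.split i with inl j => c j | inr j => d j end),
  (fun i : 'I_(n + m) => match fintype.split i with inl j => g j | inr j => h j end).
split=> [i|]; first by case: (fintype.split i).
rewrite big_split_ord /=; congr (_ + _); apply: eq_bigr => i _.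
  by rewrite (unsplitK (inl _ i)).
by rewrite (unsplitK (inr _ i)).
Qed.

Lemma lin_spanZ {V} (G : set V) a v : lin_span G v -> lin_span G (a *: v).
Proof.
move=> [n [c [g [hg ->]]]]; exists n, (fun i => a * c i), g; split => //.
by rewrite scaler_sumr; apply: eq_bigr => i _; rewrite scalerA.
Qed.

Lemma lin_span_ind {V} (G : set V) (P : V -> Prop) :
  P 0 -> (forall c g v, G g -> P v -> P (c *: g + v)) ->
  forall v, lin_span G v -> P v.
Proof.
move=> P0 PS v [n [c [g [hg ->]]]]; elim: n c g hg => [|n IH] c g hg.
  by rewrite big_ord0.
by rewrite big_ord_recl; apply: PS => //; exact: IH.
Qed.

End Spans.

Section Tensor.
Context {R : realType}.
Local Open Scope complex_scope.

Lemma dense_eq_op {H K : hilbertType R} (D : set H) (S T : H -> K) :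
  closure D = setT -> bounded_op S -> bounded_op T ->
  (forall x, D x -> S x = T x) -> S = T.
Proof.
move=> cD bS bT h; have bST := bounded_opB bS bT.
apply/funext => x; apply/eqP; rewrite -subr_eq0; apply/eqP.
apply: dotpP => y; rewrite dotp0r -[S x - T x]/((S - T) x) -adjPr //.
suff -> : adj (S - T) y = 0 by rewrite dotp0l.
apply: (dense_orth cD) => z Dz.
by rewrite adjPr // !fctE h // subrr dotp0r.
Qed.

Lemma dotp_sum2 {H : hilbertType R} (n : nat) (u : 'I_n -> H) :
  (nrm (\sum_(i < n) u i) ^+ 2)%:C = \sum_(i < n) \sum_(j < n) dotp (u j) (u i).
Proof.
by rewrite -dotpp dotp_sumr; apply: eq_bigr => i _; rewrite dotp_suml.
Qed.

(* The kernel [C^2 <x_j, x_i> - <T x_j, T x_i>] is positive semidefinite. *)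
Lemma gram_contraction {H H' K : hilbertType R} (C : R) (T : H -> H') (n : nat)
    (x : 'I_n -> H) (y : 'I_n -> K) : linear T -> nrm_le C T ->
  0 <= \sum_(i < n) \sum_(j < n)
    ((C ^+ 2)%:C * dotp (x j) (x i) - dotp (T (x j)) (T (x i))) * dotp (y j) (y i).
Proof.
move=> lT hT; apply: (schur_psd dotp_semi_inner) => a.
have -> : \sum_(i < n) \sum_(j < n)
    ((C ^+ 2)%:C * dotp (x j) (x i) - dotp (T (x j)) (T (x i))) * (a j * (a i)^*%R) =
  (C ^+ 2 * nrm (\sum_(i < n) a i *: x i) ^+ 2
   - nrm (T (\sum_(i < n) a i *: x i)) ^+ 2)%:C.
  rewrite rcD rcN rcM (lin_sum lT) !dotp_sum2 mulr_sumr -sumrB.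
  apply: eq_bigr => i _; rewrite mulr_sumr -sumrB; apply: eq_bigr => j _.
  by rewrite !(lin_scale lT) !dotpZl !dotpZr; ring.
rewrite ler0c subr_ge0 (le_trans (_ : _ <= (C * nrm (\sum_(i < n) a i *: x i)) ^+ 2)) //.
  by rewrite ler_sqr ?nnegrE ?nrm_ge0 // (le_trans (nrm_ge0 _) (hT _)).
by rewrite exprMn.
Qed.

Context {H1 H2 H : hilbertType R} (t : H1 -> H2 -> H).
Hypothesis ht : is_hilbert_tensor t.

Let tE x x' y y' : dotp (t x y) (t x' y') = dotp x x' * dotp y y'.
Proof. by case: ht. Qed.
Let tl y : linear (t ^~ y). Proof. by case: ht. Qed.
Let tr x : linear (t x). Proof. by case: ht. Qed.

(** The difference of the two squared norms is exactly the sum in [gram_contraction]; this bounds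
    [T (x) 1] without orthonormal bases. *)
Lemma tensor_contraction_l {n : nat} (C : R) (T : H1 -> H1)
    (x : 'I_n -> H1) (y : 'I_n -> H2) : 0 <= C -> linear T -> nrm_le C T ->
  nrm (\sum_(i < n) t (T (x i)) (y i)) <= C * nrm (\sum_(i < n) t (x i) (y i)).
Proof.
move=> C0 lT hT; rewrite -ler_sqr ?nnegrE ?mulr_ge0 ?nrm_ge0 // exprMn.
rewrite -subr_ge0 -ler0c rcD rcN rcM !dotp_sum2 mulr_sumr -sumrB.
have := gram_contraction x y lT hT; congr (0 <= _); apply: eq_bigr => i _.
rewrite mulr_sumr -sumrB; apply: eq_bigr => j _; rewrite !tE; ring.
Qed.

Lemma tensor_contraction_r {n : nat} (C : R) (T : H2 -> H2)
    (x : 'I_n -> H1) (y : 'I_n -> H2) : 0 <= C -> linear T -> nrm_le C T ->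
  nrm (\sum_(i < n) t (x i) (T (y i))) <= C * nrm (\sum_(i < n) t (x i) (y i)).
Proof.
move=> C0 lT hT; rewrite -ler_sqr ?nnegrE ?mulr_ge0 ?nrm_ge0 // exprMn.
rewrite -subr_ge0 -ler0c rcD rcN rcM !dotp_sum2 mulr_sumr -sumrB.
have := gram_contraction y x lT hT; congr (0 <= _); apply: eq_bigr => i _.
rewrite mulr_sumr -sumrB; apply: eq_bigr => j _; rewrite !tE; ring.
Qed.

Lemma tensor_eq_op {K : hilbertType R} (S T : H -> K) :
  bounded_op S -> bounded_op T -> (forall x y, S (t x y) = T (t x y)) -> S = T.
Proof.
move=> bS bT h; have [_ _ _ dt] := ht.
apply: (dense_eq_op dt bS bT); apply: lin_span_ind => [|c z v [x [y ->]] IH].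
  by rewrite (lin0 bS.1) (lin0 bT.1).
by rewrite bS.1 bT.1 h IH.
Qed.

(** [T1 (x) T2] is [T1 (x) 1] after [1 (x) T2], and each is bounded on finite sums of simple
    tensors. Such a sum does not determine its terms, so the operator first appears as a relation
    [G]; the bound makes it single valued. *)
Lemma tensor_op_spec (C1 C2 : R) (T1 : H1 -> H1) (T2 : H2 -> H2) :
  0 <= C1 -> 0 <= C2 -> linear T1 -> linear T2 -> nrm_le C1 T1 -> nrm_le C2 T2 ->
  [/\ bounded_op (tensor_op t T1 T2), nrm_le (C1 * C2) (tensor_op t T1 T2) &
      forall x y, tensor_op t T1 T2 (t x y) = t (T1 x) (T2 y)].
Proof.
move=> C10 C20 lT1 lT2 hT1 hT2.
pose G z w := exists (n : nat) (x : 'I_n -> H1) (y : 'I_n -> H2),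
  z = \sum_(i < n) t (x i) (y i) /\ w = \sum_(i < n) t (T1 (x i)) (T2 (y i)).
have [] := @extend_dense _ _ _ G (C1 * C2).
- exact: mulr_ge0.
- move=> c _ _ _ _ [n [x [y [-> ->]]]] [m [x' [y' [-> ->]]]].
  exists (n + m)%N, (fun i : 'I_(n + m) => match fintype.split i with inl j => c *: x j | inr j => x' j end),
    (fun i : 'I_(n + m) => match fintype.split i with inl j => y j | inr j => y' j end).
  rewrite !big_split_ord /= !scaler_sumr; split; congr (_ + _); apply: eq_bigr => i _.
  + by rewrite (unsplitK (inl _ i)) (lin_scale (tl _)).
  + by rewrite (unsplitK (inr _ i)).
  + by rewrite (unsplitK (inl _ i)) (lin_scale lT1) (lin_scale (tl _)).
  + by rewrite (unsplitK (inr _ i)).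
- move=> _ _ [n [x [y [-> ->]]]].
  rewrite (le_trans (tensor_contraction_l x _ C10 lT1 hT1)) // -mulrA ler_wpM2l //.
  exact: tensor_contraction_r.
- have [_ _ _ dt] := ht; apply/seteqP; split=> // z _.
  have : closure (lin_span [set z | exists x y, z = t x y]) z by rewrite dt.
  apply: closure_subset => _ [n [c [g [hg ->]]]].
  have /choice[x hx] : forall i, exists x, exists y, g i = t x y by [].
  have /choice[y hy] := hx.
  exists (\sum_(i < n) t (T1 (c i *: x i)) (T2 (y i))), n, (fun i => c i *: x i), y.
  by split=> //; apply: eq_bigr => i _; rewrite hy (lin_scale (tl _)).
move=> T [bT hT GT].
have Tt x y : T (t x y) = t (T1 x) (T2 y).
  by apply: GT; exists 1%N, (fun=> x), (fun=> y); rewrite !big_ord1.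
pose P := [set T | bounded_op T /\ forall x y, T (t x y) = t (T1 x) (T2 y)].
have [bS hS] : P (tensor_op t T1 T2) by apply: (@xgetPex _ (cst 0) P); exists T.
have -> : tensor_op t T1 T2 = T.
  by apply: tensor_eq_op => // x y; rewrite hS Tt.
by [].
Qed.

End Tensor.

(** * Norm closures and the left and right actions on the L2 space *)

Section StandardForm.
Context {R : realType}.
Local Open Scope complex_scope.

Lemma norm_closureP {H K : hilbertType R} (D : set (H -> K)) (T : H -> K) :
  norm_closure D T <-> bounded_op T /\
    forall e : R, 0 < e -> exists2 S, D S & nrm_le e (T - S).
Proof.
split=> [[bT hT]|[bT hT]]; split=> // e e0.
  have [|S DS /norm_le_real TS] := hT e%:C; first by rewrite ltcR.
  by exists S.
have [r r0 ->] := gt0_real e0; have [S DS TS] := hT _ r0.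
by exists S => //; apply/norm_le_real.
Qed.

Lemma norm_closure_sub {H K : hilbertType R} (D : set (H -> K)) :
  D `<=` bounded_op -> D `<=` norm_closure D.
Proof.
move=> bD T DT; apply/norm_closureP; split=> [|e e0]; first exact: bD.
by exists T => // x; rewrite subrr nrm0 mulr_ge0 ?nrm_ge0 // ltW.
Qed.

Lemma lim_norm_le (u : nat -> R[i]^o) (B : R) : 0 <= B ->
  (forall n, nrm (u n) <= B) -> nrm (limn u) <= B.
Proof.
(* For a divergent sequence [limn] is the default point [0], which satisfies the bound. *)
move=> B0 hu; have [cu|ncu] := pselect (cvgn u); last first.
  by rewrite (dvgP ncu) nrm0.
apply/ler_addgt0Pr => e e0.
have [m _ hm] : (u @ \oo) [set y | nrm (limn u - y) < e].
  by apply: cu; apply/nbhs_nrmP; exists e.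
have := hm m (leqnn m) => /= h.
rewrite -[X in nrm X](subrK (u m)) (le_trans (nrmD _ _)) // addrC lerD //.
exact: ltW.
Qed.

Lemma square_summable_bound {H : hilbertType R} (x : nat -> H) :
  square_summable x -> exists B : R, 0 <= B /\
    forall n, \sum_(0 <= k < n) nrm (x k) ^+ 2 <= B.
Proof.
move=> hx; set s : R[i]^o := limn (series (fun k => `|x k| ^+ 2 : R[i]^o)).
have [m _ hm] : (series (fun k => `|x k| ^+ 2 : R[i]^o) @ \oo)
    [set y | nrm (s - y) < 1].
  by apply: hx; apply/nbhs_nrmP; exists 1.
have sE n : nrm (series (fun k => `|x k| ^+ 2 : R[i]^o) n : R[i]) =
    \sum_(0 <= k < n) nrm (x k) ^+ 2.
  have -> : series (fun k => `|x k| ^+ 2 : R[i]^o) n =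
      (\sum_(0 <= k < n) nrm (x k) ^+ 2)%:C.
    rewrite /series /=; elim/big_ind2: _ => [//|a b c d -> ->|k _].
      by rewrite rcD.
    by rewrite nrmE !expr2 -rcM.
  by rewrite nrm_real ger0_norm // sumr_ge0 // => k _; exact: sqr_ge0.
exists (nrm (s : R[i]) + 1); split=> [|n]; first by rewrite addr_ge0 ?nrm_ge0.
have mono : \sum_(0 <= k < n) nrm (x k) ^+ 2 <= \sum_(0 <= k < maxn n m) nrm (x k) ^+ 2.
  rewrite [leRHS](big_cat_nat (n := n)) ?leq_maxl //= lerDl sumr_ge0 // => k _.
  exact: sqr_ge0.
rewrite (le_trans mono) // -sE; have := hm (maxn n m) (leq_maxr _ _) => /= h.
rewrite -[X in nrm X](subrK (s : R[i])) addrC (le_trans (nrmD _ _)) // lerD //.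
by rewrite nrmBC ltW.
Qed.

(** A vector functional is at most the operator norm times the sum of all [|x_k|^2 + |y_k|^2], so
    one norm approximation serves finitely many functionals. This places the norm closure of [cA]
    inside [M]. *)
Lemma norm_closure_sigma_weak {H : hilbertType R} (D : set (H -> H)) :
  norm_closure D `<=` sigma_weak_closure D.
Proof.
move=> T /norm_closureP[bT hT]; split=> // n x y hx hy e /gt0_real[r r0 ->].
have /choice[bx hbx] := fun i => square_summable_bound (hx i).
have /choice[yb hyb] := fun i => square_summable_bound (hy i).
pose B := \sum_(i < n) (bx i + yb i).
have B0 : 0 <= B by apply: sumr_ge0 => i _; rewrite addr_ge0 ?(hbx i).1 ?(hyb i).1.
have B1 : 0 < B + 1 by rewrite ltr_wpDl.
pose q := r / 2 / (B + 1); have e0 : 0 < q by rewrite !divr_gt0.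
have [S DS TS] := hT _ e0; exists S => // i.
rewrite nrmE ltcR (le_lt_trans (_ : _ <= r / 2)) //; last by rewrite ltr_pdivrMr //; lra.
apply: lim_norm_le => [|m]; first by rewrite divr_ge0 // ltW.
have bB : bx i + yb i <= B.
  rewrite /B (bigD1 i) //= lerDl sumr_ge0 // => j _.
  by rewrite addr_ge0 ?(hbx j).1 ?(hyb j).1.
have bnd : \sum_(0 <= k < m) nrm (dotp ((T - S) (x i k)) (y i k)) <=
    q * (bx i + yb i).
  apply: (@le_trans _ _ (\sum_(0 <= k < m)
      q * (nrm (x i k) ^+ 2 + nrm (y i k) ^+ 2))).
    apply: ler_sum => k _; rewrite (le_trans (dotp_CS _ _)) //.
    rewrite (le_trans (ler_wpM2r (nrm_ge0 _) (TS _))) // -mulrA ler_wpM2l ?(ltW e0) //.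
    have := sqr_ge0 (nrm (x i k) - nrm (y i k)).
    have := sqr_ge0 (nrm (x i k)); have := sqr_ge0 (nrm (y i k)); nra.
  by rewrite -mulr_sumr big_split /= ler_wpM2l ?(ltW e0) // lerD ?(hbx i).2 ?(hyb i).2.
rewrite (le_trans (_ : _ <= \sum_(0 <= k < m) nrm (dotp ((T - S) (x i k)) (y i k)))) //.
  rewrite /series /=; elim/big_ind2: _ => [|a b c d ha hb|//]; first by rewrite nrm0.
  by rewrite (le_trans (nrmD _ _)) // lerD.
rewrite (le_trans bnd) // /q mulrAC ler_pdivrMr // ler_wpM2l ?divr_ge0 ?(ltW r0) //.
by rewrite (le_trans bB) // lerDl.
Qed.

Context {K L2 : hilbertType R} {M : set (K -> K)} {tau : (K -> K) -> R[i]}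
  {eta : (K -> K) -> L2}.
Hypothesis hM : von_neumann_algebra M.
Hypothesis htau : faithful_normal_trace M tau.
Hypothesis hL2 : is_L2_space M tau eta.

Let M_bounded x : M x -> bounded_op x.
Proof. by case: hM => [[h _] _]; exact: h. Qed.
Let M_id : M id. Proof. by case: hM => [[_ []]]. Qed.
Let M_add x y : M x -> M y -> M (x + y).
Proof. by case: hM => [[_ [_ h _ _ _]] _]; exact: h. Qed.
Let M_scale c x : M x -> M (c *: x).
Proof. by case: hM => [[_ [_ _ h _ _]] _]; exact: h. Qed.
Let M_comp x y : M x -> M y -> M (x \o y).
Proof. by case: hM => [[_ [_ _ _ h _]] _]; exact: h. Qed.
Let M_adj x : M x -> M (adj x).
Proof. by case: hM => [[_ [_ _ _ _ h]] _]; exact: h. Qed.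
Let etaD x y : M x -> M y -> eta (x + y) = eta x + eta y.
Proof. by case: hL2 => [[h _] _ _]; exact: h. Qed.
Let etaZ c x : M x -> eta (c *: x) = c *: eta x.
Proof. by case: hL2 => [[_ h] _ _]; exact: h. Qed.
Let eta_dotp x y : M x -> M y -> dotp (eta x) (eta y) = tau (adj y \o x).
Proof. by case: hL2 => [_ h _]; exact: h. Qed.
Let eta_dense : closure (eta @` M) = setT.
Proof. by case: hL2. Qed.
Let tauC x y : M x -> M y -> tau (x \o y) = tau (y \o x).
Proof. by case: htau => [_ _ h _ _]; exact: h. Qed.

Let M_sub x y : M x -> M y -> M (x - y).
Proof. by move=> Mx My; rewrite -scaleN1r; apply/M_add/M_scale. Qed.

Let etaB x y : M x -> M y -> eta (x - y) = eta x - eta y.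
Proof.
by move=> Mx My; rewrite -scaleN1r etaD ?etaZ ?(scaleN1r (eta y)) //; exact: M_scale.
Qed.

Let nrm_eta x : M x -> (nrm (eta x) ^+ 2)%:C = tau (adj x \o x).
Proof. by move=> Mx; rewrite -dotpp eta_dotp. Qed.

Let nrm_eta_adj x : M x -> nrm (eta (adj x)) = nrm (eta x).
Proof.
move=> Mx; apply/eqP; rewrite -(eqrXn2 (n := 2)) ?nrm_ge0 //.
apply/eqP/complexI; rewrite (nrm_eta (M_adj Mx)) (nrm_eta Mx).
by rewrite (adjK (M_bounded Mx)) (tauC Mx (M_adj Mx)).
Qed.

Let tau_le x y : M x -> M y -> positive_op (y - x) ->
  complex.Re (tau x) <= complex.Re (tau y).
Proof.
move=> Mx My pxy; have [[tauD tauZ] taupos _ _ _] := htau.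
have := taupos _ (M_sub My Mx) pxy.
have -> : tau (y - x) = tau y - tau x.
  rewrite -scaleN1r tauD //; last exact: M_scale.
  by rewrite tauZ // mulN1r.
by move=> /ge0_ReImP[]; rewrite ReD ReN subr_ge0.
Qed.

(** The operator [C^2 (adj x \o x) - adj (a \o x) \o (a \o x)] is positive, and [tau] is monotone on
    [M]. *)
Let nrm_eta_comp (C : R) a x : 0 <= C -> M a -> M x -> nrm_le C a ->
  nrm (eta (a \o x)) <= C * nrm (eta x).
Proof.
move=> C0 Ma Mx ha; have [[tauD tauZ] _ _ _ _] := htau.
rewrite -ler_sqr ?nnegrE ?mulr_ge0 ?nrm_ge0 // exprMn.
have Max := M_comp Ma Mx; have Mxx := M_comp (M_adj Mx) Mx.
have -> : C ^+ 2 * nrm (eta x) ^+ 2 = complex.Re (tau ((C ^+ 2)%:C *: (adj x \o x))).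
  by rewrite tauZ // -nrm_eta // ReZ.
rewrite -[leLHS]/(complex.Re (nrm (eta (a \o x)) ^+ 2)%:C) nrm_eta //.
have Maa := M_comp (M_adj Max) Max.
apply: tau_le => //; first exact: M_scale.
split=> [|v]; first by apply: M_bounded; apply: M_sub => //; exact: M_scale.
rewrite !fctE dotpBl dotpZl /= (adjPr (M_bounded Mx)) (adjPr (M_bounded Max)).
rewrite !dotpp -rcM -rcN -rcD ler0c subr_ge0 -exprMn.
by rewrite ler_sqr ?nnegrE ?mulr_ge0 ?nrm_ge0.
Qed.

(** Right multiplication is left multiplication conjugated by [adj], which is isometric for the L2
    norm because [tau] is a trace. *)
Let nrm_eta_comp_r (C : R) a x : 0 <= C -> M a -> M x -> nrm_le C a ->
  nrm (eta (x \o a)) <= C * nrm (eta x).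
Proof.
move=> C0 Ma Mx ha; rewrite -(nrm_eta_adj Mx) -(nrm_eta_adj (M_comp Mx Ma)).
rewrite (adj_comp (M_bounded Mx) (M_bounded Ma)).
apply: nrm_eta_comp => //; [exact: M_adj|exact: M_adj|].
exact: nrm_le_adj (M_bounded Ma) C0 ha.
Qed.

(** Covers left and right multiplication at once. Density of the range of [eta] identifies the
    operator selected by [xget] with the one that [extend_dense] constructs. *)
Let extend_eta (C : R) (m : (K -> K) -> (K -> K)) : 0 <= C ->
  (forall x, M x -> M (m x)) ->
  (forall x y, M x -> M y -> m (x + y) = m x + m y) ->
  (forall c x, M x -> m (c *: x) = c *: m x) ->
  (forall x, M x -> nrm (eta (m x)) <= C * nrm (eta x)) ->
  let T := xget (cst 0) [set T | bounded_op T /\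
    forall x, M x -> T (eta x) = eta (m x)] in
  [/\ bounded_op T, nrm_le C T & forall x, M x -> T (eta x) = eta (m x)].
Proof.
move=> C0 Mm mD mZ hm T.
pose G z w := exists x, M x /\ z = eta x /\ w = eta (m x).
have [] := @extend_dense _ _ _ G C C0.
- move=> c _ _ _ _ [x [Mx [-> ->]]] [y [My [-> ->]]]; exists (c *: x + y).
  have Mcx := M_scale c Mx; rewrite mD // mZ // !etaD ?etaZ //; try exact: Mm.
    by split => //; exact: M_add.
  exact/M_scale/Mm.
- by move=> _ _ [x [Mx [-> ->]]]; exact: hm.
- apply/seteqP; split=> // z _; have : closure (eta @` M) z by rewrite eta_dense.
  by apply: closure_subset => _ [x Mx <-]; exists (eta (m x)), x.
move=> T' [bT' hT' ET'].
pose P := [set T | bounded_op T /\ forall x, M x -> T (eta x) = eta (m x)].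
have PT' : P T' by split=> // x Mx; apply: ET'; exists x.
have [bT hT] : P T by apply: (@xgetPex _ (cst 0) P); exists T'.
have -> : T = T'.
  by apply: (dense_eq_op eta_dense bT PT'.1) => _ [x Mx <-]; rewrite hT // PT'.2.
by split=> // x Mx; exact: PT'.2.
Qed.

Lemma L2_left_spec (C : R) a : 0 <= C -> M a -> nrm_le C a ->
  [/\ bounded_op (L2_left M eta a), nrm_le C (L2_left M eta a) &
      forall x, M x -> L2_left M eta a (eta x) = eta (a \o x)].
Proof.
move=> C0 Ma ha; have ba := M_bounded Ma.
apply: (extend_eta (m := fun x => a \o x) C0).
- by move=> x; exact: M_comp.
- by move=> x y Mx My; apply/funext => v /=; rewrite (lin_add ba.1).
- by move=> c x Mx; apply/funext => v /=; rewrite (lin_scale ba.1).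
- by move=> x Mx; exact: nrm_eta_comp.
Qed.

Lemma L2_right_spec (C : R) a : 0 <= C -> M a -> nrm_le C a ->
  [/\ bounded_op (L2_right M eta a), nrm_le C (L2_right M eta a) &
      forall x, M x -> L2_right M eta a (eta x) = eta (x \o a)].
Proof.
move=> C0 Ma ha; apply: (extend_eta (m := fun x => x \o a) C0) => //.
- by move=> x Mx; exact: M_comp.
- by move=> x Mx; exact: nrm_eta_comp_r.
Qed.

Local Notation Lm := (L2_left M eta).
Local Notation Rm := (L2_right M eta).

Lemma L2_left_bounded a : M a -> bounded_op (Lm a).
Proof.
by move=> Ma; have [C C0 hC] := bounded_op_bound (M_bounded Ma);
   case: (L2_left_spec (ltW C0) Ma hC).
Qed.

Lemma L2_right_bounded a : M a -> bounded_op (Rm a).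
Proof.
by move=> Ma; have [C C0 hC] := bounded_op_bound (M_bounded Ma);
   case: (L2_right_spec (ltW C0) Ma hC).
Qed.

Lemma L2_leftE a x : M a -> M x -> Lm a (eta x) = eta (a \o x).
Proof.
move=> Ma Mx; have [C C0 hC] := bounded_op_bound (M_bounded Ma).
by case: (L2_left_spec (ltW C0) Ma hC) => _ _; exact.
Qed.

Lemma L2_rightE a x : M a -> M x -> Rm a (eta x) = eta (x \o a).
Proof.
move=> Ma Mx; have [C C0 hC] := bounded_op_bound (M_bounded Ma).
by case: (L2_right_spec (ltW C0) Ma hC) => _ _; exact.
Qed.

Lemma L2_left_nrm_le (C : R) a : 0 <= C -> M a -> nrm_le C a -> nrm_le C (Lm a).
Proof. by move=> C0 Ma ha; case: (L2_left_spec C0 Ma ha). Qed.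

Lemma L2_right_nrm_le (C : R) a : 0 <= C -> M a -> nrm_le C a -> nrm_le C (Rm a).
Proof. by move=> C0 Ma ha; case: (L2_right_spec C0 Ma ha). Qed.

Lemma eta_eq_op {H : hilbertType R} (S T : L2 -> H) : bounded_op S -> bounded_op T ->
  (forall x, M x -> S (eta x) = T (eta x)) -> S = T.
Proof.
by move=> bS bT h; apply: (dense_eq_op eta_dense bS bT) => _ [x Mx <-]; exact: h.
Qed.

Lemma L2_left_id : Lm id = id.
Proof.
apply: eta_eq_op => [||x Mx]; [exact: L2_left_bounded|exact: bounded_op_id|].
by rewrite L2_leftE.
Qed.

Lemma L2_right_id : Rm id = id.
Proof.
apply: eta_eq_op => [||x Mx]; [exact: L2_right_bounded|exact: bounded_op_id|].
by rewrite L2_rightE.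
Qed.

Lemma L2_left_comp a b : M a -> M b -> Lm (a \o b) = Lm a \o Lm b.
Proof.
move=> Ma Mb; have Mab := M_comp Ma Mb; apply: eta_eq_op => [||x Mx].
- exact: L2_left_bounded.
- by apply: bounded_op_comp; exact: L2_left_bounded.
by rewrite /= !L2_leftE //; exact: M_comp.
Qed.

Lemma L2_right_comp a b : M a -> M b -> Rm (a \o b) = Rm b \o Rm a.
Proof.
move=> Ma Mb; have Mab := M_comp Ma Mb; apply: eta_eq_op => [||x Mx].
- exact: L2_right_bounded.
- by apply: bounded_op_comp; exact: L2_right_bounded.
by rewrite /= !L2_rightE //; exact: M_comp.
Qed.

Lemma L2_left_sub a b : M a -> M b -> Lm (a - b) = Lm a - Lm b.
Proof.
move=> Ma Mb; have Mab := M_sub Ma Mb; apply: eta_eq_op => [||x Mx].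
- exact: L2_left_bounded.
- by apply: bounded_opB; exact: L2_left_bounded.
rewrite !fctE !L2_leftE // -[_ \o x]/((a \o x) - (b \o x)).
by rewrite etaB //; exact: M_comp.
Qed.

Lemma L2_right_sub a b : M a -> M b -> Rm (a - b) = Rm a - Rm b.
Proof.
move=> Ma Mb; have Mab := M_sub Ma Mb; apply: eta_eq_op => [||x Mx].
- exact: L2_right_bounded.
- by apply: bounded_opB; exact: L2_right_bounded.
rewrite !fctE !L2_rightE // -etaB; try exact: M_comp.
by congr eta; apply/funext => v; rewrite !fctE /= (lin_sub (M_bounded Mx).1).
Qed.

Lemma L2_comm a b : M a -> M b -> Lm a \o Rm b = Rm b \o Lm a.
Proof.
move=> Ma Mb; apply: eta_eq_op => [||x Mx].
- by apply: bounded_op_comp; [exact: L2_left_bounded|exact: L2_right_bounded].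
- by apply: bounded_op_comp; [exact: L2_right_bounded|exact: L2_left_bounded].
by rewrite /= L2_rightE // !L2_leftE // ?L2_rightE //; exact: M_comp.
Qed.

Lemma L2_left_adj a : M a -> adj (Lm a) = Lm (adj a).
Proof.
move=> Ma; have bL := L2_left_bounded Ma; have Ma' := M_adj Ma.
apply: eta_eq_op => [||y My]; [exact: bounded_op_adj|exact: L2_left_bounded|].
rewrite L2_leftE //; apply/eqP; rewrite -subr_eq0; apply/eqP.
apply: (dense_orth eta_dense) => _ [x Mx <-].
rewrite dotpBl adjPr // L2_leftE // !eta_dotp //; try exact: M_comp.
by rewrite (adj_comp (M_bounded Ma) (M_bounded Mx)) subrr.
Qed.

(** In contrast with the left action, cyclicity of [tau] is required to bring [adj a] to the right
    of [y]. *)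
Lemma L2_right_adj a : M a -> adj (Rm a) = Rm (adj a).
Proof.
move=> Ma; have bL := L2_right_bounded Ma; have Ma' := M_adj Ma.
apply: eta_eq_op => [||y My]; [exact: bounded_op_adj|exact: L2_right_bounded|].
rewrite L2_rightE //; apply/eqP; rewrite -subr_eq0; apply/eqP.
apply: (dense_orth eta_dense) => _ [x Mx <-].
rewrite dotpBl adjPr // L2_rightE // !eta_dotp //; try exact: M_comp.
rewrite (adj_comp (M_bounded Mx) (M_bounded Ma)).
rewrite -[X in tau X]/(adj a \o (adj x \o y)).
rewrite (tauC Ma' (M_comp (M_adj Mx) My)); apply/eqP; rewrite subr_eq0; apply/eqP.
by congr tau.
Qed.

End StandardForm.

(** * Extension of homomorphisms and complete positivity *)

Section TupleForm.
Context {R : realType} {H : hilbertType R} {n : nat}.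
Local Open Scope complex_scope.
Implicit Types (u v w : 'I_n -> H) (G : 'I_n -> 'I_n -> H -> H).

Definition tuple_dotp v w : R[i] := \sum_(i < n) dotp (v i) (w i).

Lemma tuple_dotp_semi_inner : semi_inner tuple_dotp.
Proof.
split=> [u v w|c v w|v w|v].
- by rewrite /tuple_dotp -big_split; apply: eq_bigr => i _; rewrite !fctE dotpDl.
- by rewrite /tuple_dotp mulr_sumr; apply: eq_bigr => i _; rewrite !fctE dotpZl.
- by rewrite /tuple_dotp rmorph_sum; apply: eq_bigr => i _; rewrite /= -dotpC.
- by apply: sumr_ge0 => i _; rewrite dotpp ler0c sqr_ge0.
Qed.

Local Notation sn := (semi_norm tuple_dotp).

Definition tuple_at (i : 'I_n) (x : H) : 'I_n -> H :=
  fun k => if k == i then x else 0.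

Definition mx_act G v : 'I_n -> H := fun i => \sum_(j < n) G i j (v j).

Lemma tuple_dotp_at v i x : tuple_dotp v (tuple_at i x) = dotp (v i) x.
Proof.
rewrite /tuple_dotp (bigD1 i) //= /tuple_at eqxx big1 ?addr0 // => k /negPf ->.
by rewrite dotp0r.
Qed.

Lemma semi_norm_at i x : sn (tuple_at i x) = nrm x.
Proof.
rewrite /semi_norm tuple_dotp_at /tuple_at eqxx dotpp sqrtr_sqr ger0_norm //.
exact: nrm_ge0.
Qed.

Lemma nrm_le_semi_norm v i : nrm (v i) <= sn v.
Proof.
rewrite -(ler_pXn2r (n := 2)) // ?nnegrE ?nrm_ge0 ?semi_norm_ge0 // -lecR.
rewrite -(semi_normE tuple_dotp_semi_inner) /tuple_dotp (bigD1 i) //= dotpp.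
by rewrite lerDl sumr_ge0 // => k _; rewrite dotpp ler0c sqr_ge0.
Qed.

Lemma semi_norm_tuple_le v : sn v <= \sum_(i < n) nrm (v i).
Proof.
have -> : v = \sum_(i < n) tuple_at i (v i).
  apply/funext => k; rewrite fct_sumE (bigD1 k) //= {1}/tuple_at eqxx big1 ?addr0 // => j.
  by rewrite /tuple_at eq_sym => /negPf ->.
rewrite (eq_bigr (fun i => sn (tuple_at i (v i)))) => [|i _]; last first.
  rewrite fct_sumE (bigD1 i) //= {1}/tuple_at eqxx big1 ?addr0 ?semi_norm_at // => j.
  by rewrite /tuple_at eq_sym => /negPf ->.
elim/big_rec2: _ => [|i r x _ h]; first by rewrite semi_norm0 //; exact: tuple_dotp_semi_inner.
by rewrite (le_trans (semi_normD tuple_dotp_semi_inner _ _)) // lerD2l.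
Qed.

Lemma mx_act_at G j x : (forall i j, linear (G i j)) ->
  mx_act G (tuple_at j x) = fun i => G i j x.
Proof.
move=> lG; apply/funext => i; rewrite /mx_act (bigD1 j) //= /tuple_at eqxx.
by rewrite big1 ?addr0 // => k /negPf ->; rewrite lin0.
Qed.

Lemma mx_act_linear G : (forall i j, linear (G i j)) -> linear (mx_act G).
Proof.
move=> lG c v w; apply/funext => i; rewrite /mx_act !fctE scaler_sumr -big_split /=.
by apply: eq_bigr => j _; rewrite lG.
Qed.

Lemma mx_act_bounded G : (forall i j, bounded_op (G i j)) ->
  exists B : R, forall v, sn (mx_act G v) <= B * sn v.
Proof.
move=> bG; have /choice[b hb] : forall p : 'I_n * 'I_n, exists C, 0 < C /\ nrm_le C (G p.1 p.2).
  by move=> p; have [C C0 hC] := bounded_op_bound (bG p.1 p.2); exists C.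
exists (\sum_(i < n) \sum_(j < n) b (i, j)) => v.
rewrite (le_trans (semi_norm_tuple_le _)) // mulr_suml; apply: ler_sum => i _.
rewrite (le_trans (nrm_sum _)) // mulr_suml; apply: ler_sum => j _.
rewrite (le_trans ((hb (i, j)).2 _)) // ler_wpM2l ?nrm_le_semi_norm //.
exact/ltW/(hb (i, j)).1.
Qed.

Lemma mx_act_sym_adj G : (forall i j, bounded_op (G i j)) ->
  (forall v w, tuple_dotp (mx_act G v) w = tuple_dotp v (mx_act G w)) ->
  forall i j, adj (G i j) = G j i.
Proof.
move=> bG sG i j; apply: adj_uniq => // x y.
have lG k l : linear (G k l) by case: (bG k l).
have := sG (tuple_at j x) (tuple_at i y); rewrite tuple_dotp_at mx_act_at //.
move=> ->; case: tuple_dotp_semi_inner => _ _ fC _.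
rewrite fC tuple_dotp_at -dotpC mx_act_at //.
Qed.

Lemma mx_act_adj_sym G : (forall i j, bounded_op (G i j)) ->
  (forall i j, adj (G i j) = G j i) ->
  forall v w, tuple_dotp (mx_act G v) w = tuple_dotp v (mx_act G w).
Proof.
move=> bG aG v w; rewrite /tuple_dotp /mx_act.
under eq_bigr => i _ do rewrite dotp_suml.
under [RHS]eq_bigr => i _ do rewrite dotp_sumr.
rewrite exchange_big; apply: eq_bigr => i _; apply: eq_bigr => j _.
by rewrite adjP // aG.
Qed.

End TupleForm.

Section MatrixForms.
Context {R : realType}.
Local Open Scope complex_scope.

Lemma mx_form_le {H : hilbertType R} (n : nat) (v : 'I_n -> H) :
  exists2 B : R, 0 <= B & forall (P : 'I_n -> 'I_n -> H -> H) (delta : R),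
    (forall i j, nrm_le delta (P i j)) ->
    nrm (\sum_(i < n) \sum_(j < n) dotp (P i j (v j)) (v i)) <= delta * B.
Proof.
exists (\sum_(i < n) \sum_(j < n) nrm (v j) * nrm (v i)).
  by apply: sumr_ge0 => i _; apply: sumr_ge0 => j _; rewrite mulr_ge0 ?nrm_ge0.
move=> P delta hP; rewrite (le_trans (nrm_sum _)) // mulr_sumr; apply: ler_sum => i _.
rewrite (le_trans (nrm_sum _)) // mulr_sumr; apply: ler_sum => j _.
by rewrite (le_trans (dotp_CS _ _)) // mulrA ler_wpM2r ?nrm_ge0 // hP.
Qed.

Lemma mx_form_ge0_closed {H : hilbertType R} (n : nat) (v : 'I_n -> H)
    (Q : 'I_n -> 'I_n -> H -> H) :
  (forall e : R, 0 < e -> exists2 P : 'I_n -> 'I_n -> H -> H,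
     forall i j, nrm_le e (Q i j - P i j) &
     0 <= \sum_(i < n) \sum_(j < n) dotp (P i j (v j)) (v i)) ->
  0 <= \sum_(i < n) \sum_(j < n) dotp (Q i j (v j)) (v i).
Proof.
move=> hQ; apply: ge0_closed => e e0; have [B B0 hB] := mx_form_le v.
have B1 : 0 < B + 1 by rewrite ltr_wpDl.
have [P QP P0] := hQ _ (divr_gt0 e0 B1).
exists (\sum_(i < n) \sum_(j < n) dotp (P i j (v j)) (v i)) => //.
have -> : \sum_(i < n) \sum_(j < n) dotp (Q i j (v j)) (v i) -
   \sum_(i < n) \sum_(j < n) dotp (P i j (v j)) (v i) =
   \sum_(i < n) \sum_(j < n) dotp ((Q i j - P i j) (v j)) (v i).
  rewrite -sumrB; apply: eq_bigr => i _; rewrite -sumrB; apply: eq_bigr => j _.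
  by rewrite !fctE dotpBl.
rewrite (le_trans (hB _ _ QP)) // mulrAC ler_pdivrMr // ler_wpM2l ?(ltW e0) //.
by rewrite lerDl.
Qed.

End MatrixForms.

Section Extension.
Context {R : realType} {H K : hilbertType R} {D : set (H -> H)}.
Context {Phi : (H -> H) -> (K -> K)} {c : R}.
Local Open Scope complex_scope.
Hypothesis hD : unital_star_subalgebra D.
Hypothesis hPhi : star_hom_on D Phi.
Hypothesis c0 : 0 <= c.
Hypothesis Phi_le : forall T (b : R), D T -> 0 <= b -> nrm_le b T -> nrm_le (c * b) (Phi T).

Let D_bounded T : D T -> bounded_op T. Proof. by case: hD => h _; exact: h. Qed.
Let D_id : D id. Proof. by case: hD => _ []. Qed.
Let D_add S T : D S -> D T -> D (S + T).
Proof. by case: hD => _ [_ h _ _ _]; exact: h. Qed.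
Let D_scale a T : D T -> D (a *: T).
Proof. by case: hD => _ [_ _ h _ _]; exact: h. Qed.
Let D_comp S T : D S -> D T -> D (S \o T).
Proof. by case: hD => _ [_ _ _ h _]; exact: h. Qed.
Let D_adj T : D T -> D (adj T).
Proof. by case: hD => _ [_ _ _ _ h]; exact: h. Qed.
Let D_sub S T : D S -> D T -> D (S - T).
Proof. by move=> DS DT; rewrite -scaleN1r; apply/D_add/D_scale. Qed.
Let D_0 : D 0. Proof. by rewrite -(scale0r id); exact: D_scale. Qed.
Let Phi_bounded T : D T -> bounded_op (Phi T).
Proof. by case: hPhi => h _ _ _; exact: h. Qed.
Let PhiD S T : D S -> D T -> Phi (S + T) = Phi S + Phi T.
Proof. by case: hPhi => _ [h _] _ _; exact: h. Qed.
Let PhiZ a T : D T -> Phi (a *: T) = a *: Phi T.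
Proof. by case: hPhi => _ [_ h] _ _; exact: h. Qed.
Let PhiM S T : D S -> D T -> Phi (S \o T) = Phi S \o Phi T.
Proof. by case: hPhi => _ _ h _; exact: h. Qed.
Let Phi_adj T : D T -> Phi (adj T) = adj (Phi T).
Proof. by case: hPhi => _ _ _ h; exact: h. Qed.
Let PhiB S T : D S -> D T -> Phi (S - T) = Phi S - Phi T.
Proof.
by move=> DS DT; rewrite -scaleN1r PhiD ?PhiZ ?(scaleN1r (Phi T)) //; exact: D_scale.
Qed.
Let Phi0 : Phi 0 = 0.
Proof. by rewrite -(scale0r id) PhiZ // scale0r. Qed.

Let D_sum (n : nat) (T : 'I_n -> H -> H) : (forall i, D (T i)) -> D (\sum_(i < n) T i).
Proof. by move=> hT; elim/big_ind: _ => // S S' hS hS'; exact: D_add. Qed.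
Let Phi_sum (n : nat) (T : 'I_n -> H -> H) : (forall i, D (T i)) ->
  Phi (\sum_(i < n) T i) = \sum_(i < n) Phi (T i).
Proof.
elim: n T => [|n IH] T hT; first by rewrite !big_ord0.
by rewrite !big_ord_recl PhiD ?IH //; exact: D_sum.
Qed.

(** The estimate against every [S] in [D], not just along one sequence, determines [F]; linearity,
    agreement with [Phi] and positivity are all read off from it. *)
Lemma hom_extension : exists F : (H -> H) -> (K -> K),
  forall T, norm_closure D T -> bounded_op (F T) /\
    forall S (b : R), D S -> 0 <= b -> nrm_le b (T - S) -> nrm_le (c * b) (F T - Phi S).
Proof.
suff /choice[F hF] : forall T, exists F : K -> K, norm_closure D T -> bounded_op F /\
    forall S (b : R), D S -> 0 <= b -> nrm_le b (T - S) -> nrm_le (c * b) (F - Phi S).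
  by exists F.
move=> T; have [cT|] := pselect (norm_closure D T); last by exists 0.
have [bT hT] := (norm_closureP _ _).1 cT.
have inv0 k : 0 < k.+1%:R^-1 :> R by rewrite invr_gt0.
have /choice[S hS] : forall k : nat, exists S, D S /\ nrm_le (k.+1%:R^-1) (T - S).
  by move=> k; have [S DS TS] := hT _ (inv0 k); exists S.
have [|k l kl||F bF hF] := @op_limit _ _ _ (fun k => Phi (S k)) (fun k => c * 2 * k.+1%:R^-1).
- by move=> k; apply: Phi_bounded; exact: (hS k).1.
- rewrite -PhiB ?(hS k).1 ?(hS l).1 //; try exact: (hS _).1.
  rewrite -mulrA; apply: Phi_le; first by apply: D_sub; exact: (hS _).1.
    by rewrite mulr_ge0 // ltW.
  have -> : S k - S l = (T - S l) - (T - S k).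
    by apply/funext => x; rewrite !fctE; apply: dotpP => w; rewrite !(dotpDr, dotpBr, dotpNr); ring.
  apply: nrm_le_mono (nrm_leB (hS l).2 (hS k).2); rewrite mulr_natl mulr2n lerD2r.
  by rewrite lef_pV2 ?posrE ?ltr0n // ler_nat.
- exact: small_inv_mul.
exists F => _; split=> // S' b DS' b0 TS' x.
apply/ler_addgt0Pr => e e0; have [k hk] := small_inv_mul (c * 3 * nrm x) e0.
have -> : (F - Phi S') x = Phi (S k - S') x - (Phi (S k) - F) x.
  rewrite PhiB //; last exact: (hS k).1.
  by rewrite !fctE; apply: dotpP => w; rewrite !(dotpDr, dotpBr, dotpNr); ring.
have h1 : nrm_le (c * (b + k.+1%:R^-1)) (Phi (S k - S')).
  apply: Phi_le; [by apply: D_sub => //; exact: (hS k).1|by rewrite addr_ge0 // ltW|].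
  have -> : S k - S' = (T - S') - (T - S k).
    by apply/funext => y; rewrite !fctE; apply: dotpP => w; rewrite !(dotpDr, dotpBr, dotpNr); ring.
  exact: nrm_leB TS' (hS k).2.
rewrite (le_trans (nrmB _ _)) // (le_trans (lerD (h1 x) (hF k x))) //.
rewrite (le_trans _ (lerD (lexx _) hk)) //.
by rewrite le_eqVlt; apply/orP; left; apply/eqP; ring.
Qed.

(** As [G] is hermitian and [Phi] is multiplicative on [D], the form is the sum over [l] of the
    squared norms of the vectors with terms [Phi (G l j) (v j)]. *)
Lemma hom_square_ge0 (n : nat) (G : 'I_n -> 'I_n -> H -> H) (v : 'I_n -> K) :
  (forall i j, D (G i j)) -> (forall i j, adj (G i j) = G j i) ->
  0 <= \sum_(i < n) \sum_(j < n)
    dotp (Phi (\sum_(l < n) (G i l \o G l j)) (v j)) (v i).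
Proof.
move=> DG aG; have DGG i l j : D (G i l \o G l j) by exact: D_comp.
rewrite (_ : \sum_(i < n) _ = \sum_(l < n)
    (nrm (\sum_(j < n) Phi (G l j) (v j)) ^+ 2)%:C).
  by apply: sumr_ge0 => l _; rewrite ler0c sqr_ge0.
under [RHS]eq_bigr => l _ do rewrite dotp_sum2.
rewrite [RHS]exchange_big; apply: eq_bigr => i _.
rewrite [RHS]exchange_big; apply: eq_bigr => j _.
rewrite Phi_sum // fct_sumE dotp_suml; apply: eq_bigr => l _.
by rewrite PhiM //= -(aG l i) Phi_adj // adjPr //; exact: Phi_bounded.
Qed.

(* [1 - c B] has norm less than one on the direct sum; the iterates of its
   square root stay in the matrices over [D], where [Phi] is multiplicative. *)
Lemma hom_coercive_ge0 (n : nat) (B : 'I_n -> 'I_n -> H -> H) (delta : R)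
    (v : 'I_n -> K) :
  (forall i j, D (B i j)) -> (forall i j, adj (B i j) = B j i) -> 0 < delta ->
  (forall w, delta * semi_norm tuple_dotp w ^+ 2
               <= complex.Re (tuple_dotp (mx_act B w) w)) ->
  0 <= \sum_(i < n) \sum_(j < n) dotp (Phi (B i j) (v j)) (v i).
Proof.
move=> DB aB d0 posB; have bB i j := D_bounded (DB i j).
have lB i j : linear (B i j) by case: (bB i j).
have [C hC] := mx_act_bounded bB.
have tsi := @tuple_dotp_semi_inner R H n.
have [s [rho [s0 r0 r1 hA]]] := coercive_contraction tsi d0 posB hC.
pose A (w : 'I_n -> H) : 'I_n -> H := w - s%:C *: mx_act B w.
have lA : linear A.
  move=> a x y; rewrite /A (mx_act_linear lB) scalerBr !scalerDr !scalerA.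
  by rewrite (mulrC s%:C) opprD addrACA.
have sA x y : tuple_dotp (A x) y = tuple_dotp x (A y).
  have [_ fZl _ _] := tsi.
  by rewrite /A (formBl tsi) (formBr tsi) fZl (formZr tsi) conjC_real (mx_act_adj_sym bB aB).
have lY := sqrt_iter_linear lA.
have sqY := sqrt_iter_sq tsi lA r0 (ltW r1) hA.
have sY := sqrt_iter_sym tsi sA.
have matY k : exists G, (forall i j, D (G i j)) /\ sqrt_iter A k = mx_act G.
  elim: k => [|k [G [DG GE]]].
    exists (fun _ _ => 0); split=> //; apply/funext => w; apply/funext => i.
    by rewrite /mx_act /= big1.
  exists (fun i j => (2^-1)%:C *: ((if i == j then id else 0) - s%:C *: B i j +
            \sum_(l < n) (G i l \o G l j))).
  split=> [i j|]; first by apply: D_scale; apply: D_add; [|apply: D_sum => l; exact: D_comp];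
    apply: D_sub; [case: ifP|exact: D_scale].
  apply/funext => w; apply/funext => i; rewrite /= GE /A /mx_act !fctE.
  rewrite -scaler_sumr; congr (_ *: _); rewrite big_split /=; congr (_ + _).
    rewrite sumrB -scaler_sumr; congr (_ - _).
    rewrite (bigD1 i) //= eqxx big1 ?addr0 // => j.
    by rewrite eq_sym => /negPf ->.
  under [RHS]eq_bigr => j _ do rewrite fct_sumE.
  rewrite exchange_big; apply: eq_bigr => l _.
  by rewrite (lin_sum (D_bounded (DG i l)).1).
suff h : 0 <= \sum_(i < n) \sum_(j < n) dotp ((s%:C *: Phi (B i j)) (v j)) (v i).
  rewrite -(pmulr_rge0 _ (_ : 0 < s%:C)) ?ltcR // mulr_sumr.
  move: h; congr (0 <= _); apply: eq_bigr => i _; rewrite mulr_sumr.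
  by apply: eq_bigr => j _; rewrite !fctE dotpZl.
(* The matrix [s B = 1 - A] is within [2 * rho ^+ k.+1] of the square of the hermitian matrix
   [1 - Y_k], and [Phi] enlarges this distance by a factor at most [c]. *)
apply: (@mx_form_ge0_closed _ _ _ v (fun i j => s%:C *: Phi (B i j))) => e e0.
have [k hk] := geom_small (c * (2 * rho)) r0 r1 e0.
have [G [DG GE]] := matY k.
pose Z i j : H -> H := (if i == j then id else 0) - G i j.
have DZ i j : D (Z i j) by apply: D_sub => //; case: ifP.
have bZ i j := D_bounded (DZ i j).
have lZ i j : linear (Z i j) by case: (bZ i j).
have ZE w : mx_act Z w = w - sqrt_iter A k w.
  apply/funext => i; rewrite GE /mx_act !fctE sumrB; congr (_ - _).
  rewrite (bigD1 i) //= eqxx big1 ?addr0 // => j.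
  by rewrite eq_sym => /negPf ->.
have aZ : forall i j, adj (Z i j) = Z j i.
  apply: mx_act_sym_adj => // x y; rewrite !ZE (formBl tsi) (formBr tsi).
  by rewrite sY.
exists (fun i j => Phi (\sum_(l < n) (Z i l \o Z l j))); last exact: hom_square_ge0.
move=> i j; have DZZ : D (\sum_(l < n) (Z i l \o Z l j)).
  by apply: D_sum => l; exact: D_comp.
rewrite -PhiZ // -PhiB //; last exact: D_scale.
apply: nrm_le_mono (Phi_le (b := 2 * rho ^+ k.+1) _ _ _).
- by rewrite (le_trans _ hk) // exprS le_eqVlt; apply/orP; left; apply/eqP; ring.
- by apply: D_sub => //; exact: D_scale.
- by rewrite mulr_ge0 ?exprn_ge0.
(* An entry is bounded by the whole matrix: apply the latter to the tuple supported at [j] and read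
   off coordinate [i]. *)
move=> x; rewrite -[nrm x](@semi_norm_at _ _ _ j).
apply: le_trans (sqY k (tuple_at j x)).
rewrite -(semi_normN tsi) opprB; apply: le_trans (nrm_le_semi_norm _ i).
rewrite -!ZE /A opprB [tuple_at j x + _]addrC subrK.
rewrite le_eqVlt; apply/orP; left; apply/eqP; congr nrm.
rewrite !fctE (mx_act_at _ _ lB) (mx_act_at _ _ lZ) /mx_act fct_sumE.
by [].
Qed.

Section Extended.
Context {F : (H -> H) -> (K -> K)}.
Hypothesis hF : forall T, norm_closure D T -> bounded_op (F T) /\
    forall S (b : R), D S -> 0 <= b -> nrm_le b (T - S) -> nrm_le (c * b) (F T - Phi S).

Lemma ext_agree T : D T -> F T = Phi T.
Proof.
move=> DT; have [_ h] := hF (norm_closure_sub D_bounded DT).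
apply/funext => x; apply/eqP; rewrite -subr_eq0; apply/eqP/nrm_small_eq0 => e e0.
have := h T 0 DT (lexx _) _ x; rewrite mulr0 mul0r => h'.
rewrite (le_trans (h' _)) ?(ltW e0) // => y.
by rewrite subrr nrm0 mul0r.
Qed.

Lemma norm_closureD S T : norm_closure D S -> norm_closure D T -> norm_closure D (S + T).
Proof.
move=> /norm_closureP[bS hS] /norm_closureP[bT hT]; apply/norm_closureP.
split=> [|e e0]; first exact: bounded_opD.
have e2 : 0 < e / 2 by rewrite divr_gt0.
have [S' DS SS'] := hS _ e2; have [T' DT TT'] := hT _ e2.
exists (S' + T'); first exact: D_add.
rewrite opprD addrACA (_ : e = e / 2 + e / 2); [exact: nrm_leD|by field].
Qed.

Lemma norm_closureZ a T : norm_closure D T -> norm_closure D (a *: T).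
Proof.
move=> /norm_closureP[bT hT]; apply/norm_closureP; split=> [|e e0]; first exact: bounded_opZ.
have a1 : 0 < nrm a + 1 by rewrite ltr_wpDl ?nrm_ge0.
have [T' DT TT'] := hT _ (divr_gt0 e0 a1).
exists (a *: T'); first exact: D_scale.
rewrite -scalerBr; apply: nrm_le_mono (nrm_leZ a TT').
by rewrite mulrA ler_pdivrMr // mulrC ler_wpM2l ?lerDl // ltW.
Qed.

Lemma ext_linear : linear_on (norm_closure D) F.
Proof.
split=> [S T|a T] cT; [move=> cT'|]; apply/funext => x; apply/eqP; rewrite -subr_eq0;
  apply/eqP/nrm_small_eq0 => e e0.
- have [bS hS] := hF cT; have [bT hT] := hF cT'.
  have [bST hST] := hF (norm_closureD cT cT').
  pose q := e / (c * 4 * nrm x + 1).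
  have q1 : 0 < c * 4 * nrm x + 1 by rewrite ltr_wpDl ?mulr_ge0 ?nrm_ge0.
  have q0 : 0 < q by rewrite divr_gt0.
  have [S' DS SS'] := ((norm_closureP _ _).1 cT).2 _ q0.
  have [T' DT TT'] := ((norm_closureP _ _).1 cT').2 _ q0.
  have hsum : nrm_le (q + q) (S + T - (S' + T')) by rewrite opprD addrACA; exact: nrm_leD.
  have -> : F (S + T) x - (F S + F T) x = (F (S + T) - Phi (S' + T')) x -
      ((F S - Phi S') x + (F T - Phi T') x).
    by rewrite PhiD // !fctE; apply: dotpP => w; rewrite !(dotpDr, dotpBr, dotpNr); ring.
  have h1 := hST _ _ (D_add DS DT) (addr_ge0 (ltW q0) (ltW q0)) hsum x.
  have h2 := hS _ _ DS (ltW q0) SS' x; have h3 := hT _ _ DT (ltW q0) TT' x.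
  rewrite (le_trans (nrmB _ _)) // (le_trans (lerD h1 (le_trans (nrmD _ _) (lerD h2 h3)))) //.
  have -> : c * (q + q) * nrm x + (c * q * nrm x + c * q * nrm x) =
    e * (c * 4 * nrm x) / (c * 4 * nrm x + 1) by rewrite /q; ring.
  by rewrite ler_pdivrMr // ler_wpM2l ?(ltW e0) // lerDl.
have [bT hT] := hF cT; have [baT haT] := hF (norm_closureZ a cT).
pose q := e / (c * 2 * nrm a * nrm x + 1).
have q1 : 0 < c * 2 * nrm a * nrm x + 1 by rewrite ltr_wpDl ?mulr_ge0 ?nrm_ge0.
have q0 : 0 < q by rewrite divr_gt0.
have [T' DT TT'] := ((norm_closureP _ _).1 cT).2 _ q0.
have hZ : nrm_le (nrm a * q) (a *: T - a *: T') by rewrite -scalerBr; exact: nrm_leZ.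
have -> : F (a *: T) x - (a *: F T) x = (F (a *: T) - Phi (a *: T')) x -
    a *: (F T - Phi T') x.
  rewrite PhiZ // !fctE scalerBr.
  by apply: dotpP => w; rewrite !(dotpDr, dotpBr, dotpNr); ring.
have h1 := haT _ _ (D_scale a DT) (mulr_ge0 (nrm_ge0 a) (ltW q0)) hZ x.
have h2 := hT _ _ DT (ltW q0) TT' x.
rewrite (le_trans (nrmB _ _)) // nrmZ (le_trans (lerD h1 (ler_wpM2l (nrm_ge0 a) h2))) //.
have -> : c * (nrm a * q) * nrm x + nrm a * (c * q * nrm x) =
  e * (c * 2 * nrm a * nrm x) / (c * 2 * nrm a * nrm x + 1) by rewrite /q; ring.
by rewrite ler_pdivrMr // ler_wpM2l ?(ltW e0) // lerDl.
Qed.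

(** A positive matrix over the closure is approximated by a matrix over [D], averaged with its
    adjoint to be hermitian and shifted by a multiple of the identity to be coercive, so that
    [hom_coercive_ge0] applies. *)
Lemma ext_completely_positive (n : nat) (X : 'M[H -> H]_n) (v : 'I_n -> K) :
  (forall i j, norm_closure D (X i j)) -> positive_mx X ->
  0 <= \sum_(i < n) \sum_(j < n) dotp (F (X i j) (v j)) (v i).
Proof.
move=> cX pX; have bX i j : bounded_op (X i j) by case: (cX i j).
have lX i j : linear (X i j) by case: (bX i j).
have tsi := @tuple_dotp_semi_inner R H n.
have posX w : 0 <= tuple_dotp (mx_act X w) w.
  have := pX w; congr (0 <= _); apply: eq_bigr => i _.
  by rewrite /mx_act dotp_suml.
have sX := positive_symmetric tsi (mx_act_linear lX) posX.
have aX := mx_act_sym_adj bX sX.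
apply: (@mx_form_ge0_closed _ _ _ v (fun i j => F (X i j))) => e e0.
(* Entrywise errors [q] change the form by at most [N * q] times the squared norm. The denominator
   of [q] provides for a total entry error [(N + 2) * q], multiplied by [c]. *)
pose N : R := n%:R * n%:R; have N0 : 0 <= N by rewrite mulr_ge0.
pose q := e / (c * (N + 2) + 1).
have q1 : 0 < c * (N + 2) + 1 by rewrite ltr_wpDl // mulr_ge0 // addr_ge0.
have q0 : 0 < q by rewrite divr_gt0.
have /choice[X' hX'] : forall p : 'I_n * 'I_n, exists S, D S /\ nrm_le q (X p.1 p.2 - S).
  move=> p; have [S DS h] := ((norm_closureP _ _).1 (cX p.1 p.2)).2 _ q0.
  by exists S.
pose X2 i j := (2^-1)%:C *: (X' (i, j) + adj (X' (j, i))).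
have DX2 i j : D (X2 i j).
  by apply: D_scale; apply: D_add; [|apply: D_adj]; exact: (hX' _).1.
have bX' p := D_bounded (hX' p).1.
have aX2 i j : adj (X2 i j) = X2 j i.
  rewrite adjZ ?adjD ?adjK ?conjC_real //; last by apply: bounded_opD => //; exact: bounded_op_adj.
    by rewrite addrC.
  exact: bounded_op_adj.
have XX2 i j : nrm_le q (X i j - X2 i j).
  have -> : X i j - X2 i j = (2^-1)%:C *: ((X i j - X' (i, j)) + adj (X j i - X' (j, i))).
    have -> : adj (X j i - X' (j, i)) = X i j - adj (X' (j, i)).
      by rewrite adjB // aX.
    rewrite addrACA -opprD scalerBr; congr (_ - _).
    rewrite scalerDr -scalerDl -rcD (_ : 2^-1 + 2^-1 = 1 :> R) ?scale1r //.
    by field.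
  apply: nrm_le_mono (nrm_leZ _ (nrm_leD (hX' (i, j)).2
    (nrm_le_adj (bounded_opB (bX j i) (bX' (j, i))) (ltW q0) (hX' (j, i)).2))).
  by rewrite nrm_real ger0_norm //; lra.
(* Of the shift [(N + 1) * q], the part [N * q] pays for the approximation and [q] remains as the
   coercivity constant. *)
pose B i j := X2 i j + (if i == j then (((N + 1) * q)%:C *: id) else 0).
have DB i j : D (B i j) by apply: D_add => //; case: ifP => // _; exact: D_scale.
have XB i j : nrm_le ((N + 2) * q) (X i j - B i j).
  have -> : (N + 2) * q = q + (N + 1) * q by ring.
  rewrite /B opprD addrA; apply: nrm_leB (XX2 i j) _; case: ifP => _ x.
    by rewrite !fctE nrmZ nrm_real ger0_norm // mulr_ge0 ?addr_ge0 // ltW.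
  by rewrite nrm0 mulr_ge0 ?nrm_ge0 // mulr_ge0 ?(ltW q0) // addr_ge0.
exists (fun i j => Phi (B i j)) => [i j|].
  apply: nrm_le_mono ((hF (cX i j)).2 _ ((N + 2) * q) (DB i j) _ (XB i j)).
    rewrite (_ : c * _ = e * (c * (N + 2)) / (c * (N + 2) + 1)); last by rewrite /q; ring.
    by rewrite ler_pdivrMr // ler_wpM2l ?(ltW e0) // lerDl.
  by rewrite mulr_ge0 ?addr_ge0 // ltW.
apply: (hom_coercive_ge0 (delta := q)) => // [i j|w].
  rewrite /B adjD ?aX2 //; last 2 first.
  - by apply: D_bounded.
  - by apply: D_bounded; case: ifP => // _; exact: D_scale.
  congr (_ + _); rewrite (eq_sym j); case: ifP => _.
    by rewrite adjZ ?adj_id ?conjC_real //; exact: bounded_op_id.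
  by rewrite -(scale0r (id : H -> H)) adjZ ?conjC0 ?scale0r //; exact: bounded_op_id.
have tE : tuple_dotp (mx_act B w) w = tuple_dotp (mx_act X w) w -
    \sum_(i < n) \sum_(j < n) dotp ((X i j - X2 i j) (w j)) (w i) +
    (((N + 1) * q)%:C * tuple_dotp w w).
  rewrite /tuple_dotp mulr_sumr -sumrB -big_split /=; apply: eq_bigr => i _.
  rewrite /mx_act !dotp_suml -sumrB.
  under eq_bigr => j _ do rewrite /B !fctE dotpDl.
  rewrite big_split /=; congr (_ + _).
    by apply: eq_bigr => j _; rewrite !fctE dotpBl; ring.
  rewrite (bigD1 i) //= eqxx dotpZl big1 ?addr0 // => j.
  by rewrite eq_sym => /negPf ->; rewrite dotp0l.
have hsum : nrm (\sum_(i < n) \sum_(j < n) dotp ((X i j - X2 i j) (w j)) (w i)) <=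
   q * N * semi_norm tuple_dotp w ^+ 2.
  have -> : q * N * semi_norm tuple_dotp w ^+ 2 =
    n%:R * (n%:R * (q * semi_norm tuple_dotp w * semi_norm tuple_dotp w)).
    by rewrite /N; ring.
  apply: le_nrm_sum => i; apply: le_nrm_sum => j.
  have hw := nrm_le_semi_norm w; rewrite (le_trans (dotp_CS _ _)) //.
  rewrite ler_pM ?nrm_ge0 // (le_trans (XX2 i j _)) // ler_wpM2l ?(ltW q0) //.
rewrite tE !ReD ReN ReZ (Re_form tsi).
have /ge0_ReImP[h1 _] := posX w.
have := le_trans (ler_norm _) (le_trans (nrm_Re _) hsum).
lra.
Qed.

End Extended.
End Extension.

(** * The coarse bimodule *)

Section Coarse.
Context {R : realType} {K L2 LL : hilbertType R} {M : set (K -> K)}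
  {tau : (K -> K) -> R[i]} {eta : (K -> K) -> L2} {t : L2 -> L2 -> LL}.
Hypothesis hM : von_neumann_algebra M.
Hypothesis htau : faithful_normal_trace M tau.
Hypothesis hL2 : is_L2_space M tau eta.
Hypothesis ht : is_hilbert_tensor t.
Local Open Scope complex_scope.

Local Notation Lm := (L2_left M eta).
Local Notation Rm := (L2_right M eta).
Local Notation u x y := (tensor_op t (Lm x) (Rm y)).

Let M_bounded x : M x -> bounded_op x.
Proof. by case: hM => [[h _] _]; exact: h. Qed.
Let M_id : M id. Proof. by case: hM => [[_ []]]. Qed.
Let M_comp x y : M x -> M y -> M (x \o y).
Proof. by case: hM => [[_ [_ _ _ h _]] _]; exact: h. Qed.
Let M_adj x : M x -> M (adj x).
Proof. by case: hM => [[_ [_ _ _ _ h]] _]; exact: h. Qed.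
Let M_sub x y : M x -> M y -> M (x - y).
Proof.
case: hM => [[_ [_ hD hZ _ _]] _] Mx My.
by rewrite -scaleN1r; apply: hD => //; exact: hZ.
Qed.
Let Lm_bounded x : M x -> bounded_op (Lm x). Proof. exact: L2_left_bounded hM htau hL2 x. Qed.
Let Rm_bounded x : M x -> bounded_op (Rm x). Proof. exact: L2_right_bounded hM htau hL2 x. Qed.

Lemma norm_closure_subM (D : set (K -> K)) : D `<=` M -> norm_closure D `<=` M.
Proof.
move=> DM T /norm_closureP[bT hT]; case: hM => _; apply; apply: norm_closure_sigma_weak.
by apply/norm_closureP; split=> // e /hT[S /DM MS TS]; exists S.
Qed.

Lemma coarse_gen_spec (Ca Cb : R) a b : 0 <= Ca -> 0 <= Cb -> M a -> M b ->
  nrm_le Ca a -> nrm_le Cb b ->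
  [/\ bounded_op (u a b), nrm_le (Ca * Cb) (u a b) &
      forall x y, u a b (t x y) = t (Lm a x) (Rm b y)].
Proof.
move=> Ca0 Cb0 Ma Mb ha hb; apply: (tensor_op_spec ht) => //.
- exact: (Lm_bounded Ma).1.
- exact: (Rm_bounded Mb).1.
- exact: (L2_left_nrm_le hM htau hL2 Ca0 Ma ha).
- exact: (L2_right_nrm_le hM htau hL2 Cb0 Mb hb).
Qed.

Lemma coarse_gen_bounded a b : M a -> M b -> bounded_op (u a b).
Proof.
move=> Ma Mb; have [Ca Ca0 ha] := bounded_op_bound (M_bounded Ma).
have [Cb Cb0 hb] := bounded_op_bound (M_bounded Mb).
by case: (coarse_gen_spec (ltW Ca0) (ltW Cb0) Ma Mb ha hb).
Qed.

Lemma coarse_genE a b x y : M a -> M b -> u a b (t x y) = t (Lm a x) (Rm b y).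
Proof.
move=> Ma Mb; have [Ca Ca0 ha] := bounded_op_bound (M_bounded Ma).
have [Cb Cb0 hb] := bounded_op_bound (M_bounded Mb).
by case: (coarse_gen_spec (ltW Ca0) (ltW Cb0) Ma Mb ha hb).
Qed.

Lemma coarse_gen_id : u id id = id.
Proof.
apply: (tensor_eq_op ht) => [||x y]; [exact: coarse_gen_bounded|exact: bounded_op_id|].
by rewrite coarse_genE // (L2_left_id hM htau hL2) (L2_right_id hM htau hL2).
Qed.

Lemma coarse_gen_comp a b a' b' : M a -> M b -> M a' -> M b' ->
  u a b \o u a' b' = u (a \o a') (b' \o b).
Proof.
move=> Ma Mb Ma' Mb'; have Maa := M_comp Ma Ma'; have Mbb := M_comp Mb' Mb.
apply: (tensor_eq_op ht) => [||x y].
- by apply: bounded_op_comp; exact: coarse_gen_bounded.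
- exact: coarse_gen_bounded.
rewrite /= !coarse_genE // (L2_left_comp hM htau hL2 Ma Ma').
by rewrite (L2_right_comp hM htau hL2 Mb' Mb).
Qed.

Lemma coarse_gen_adj a b : M a -> M b -> adj (u a b) = u (adj a) (adj b).
Proof.
move=> Ma Mb; have bu := coarse_gen_bounded Ma Mb.
have Ma' := M_adj Ma; have Mb' := M_adj Mb; case: (ht) => tl tr tE td.
apply: (tensor_eq_op ht) => [||x y].
- exact: bounded_op_adj.
- exact: coarse_gen_bounded.
apply/eqP; rewrite -subr_eq0; apply/eqP; apply: (dense_orth td).
apply: lin_span_ind => [|c g v [x' [y' ->]] IH]; first by rewrite dotp0r.
rewrite dotpDr IH addr0 dotpZr dotpBl adjPr // !coarse_genE // !tE.
rewrite -(L2_left_adj hM htau hL2 Ma) -(L2_right_adj hM htau hL2 Mb).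
by rewrite (adjPr (Lm_bounded Ma)) (adjPr (Rm_bounded Mb)) subrr mulr0.
Qed.

Lemma coarse_gen_subl a a' b : M a -> M a' -> M b ->
  u (a - a') b = u a b - u a' b.
Proof.
move=> Ma Ma' Mb; have Maa := M_sub Ma Ma'; case: (ht) => tl _ _ _.
apply: (tensor_eq_op ht) => [||x y].
- exact: coarse_gen_bounded.
- by apply: bounded_opB; exact: coarse_gen_bounded.
rewrite !fctE !coarse_genE // (L2_left_sub hM htau hL2 Ma Ma').
exact: (lin_sub (tl _)).
Qed.

Lemma coarse_gen_subr a b b' : M a -> M b -> M b' ->
  u a (b - b') = u a b - u a b'.
Proof.
move=> Ma Mb Mb'; have Mbb := M_sub Mb Mb'; case: (ht) => _ tr _ _.
apply: (tensor_eq_op ht) => [||x y].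
- exact: coarse_gen_bounded.
- by apply: bounded_opB; exact: coarse_gen_bounded.
rewrite !fctE !coarse_genE // (L2_right_sub hM htau hL2 Mb Mb').
exact: (lin_sub (tr _)).
Qed.

Section Subalgebra.
Context {D : set (K -> K)}.
Hypothesis hD : unital_star_subalgebra D.
Hypothesis DM : D `<=` M.

Lemma coarse_span_bounded : coarse_span M eta t D `<=` bounded_op.
Proof.
apply: lin_span_ind => [|c _ T [x [y [Dx Dy ->]]] bT]; first exact: bounded_op0.
by apply/bounded_opD/bT/bounded_opZ/coarse_gen_bounded; exact: DM.
Qed.

Lemma coarse_span_star : unital_star_subalgebra (coarse_span M eta t D).
Proof.
have [_ [D_id _ _ D_comp D_adj]] := hD.
split; first exact: coarse_span_bounded.
split.
- by apply: lin_span_gen; exists id, id; rewrite coarse_gen_id.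
- by move=> S T; exact: lin_spanD.
- by move=> c T; exact: lin_spanZ.
- move=> S T hS hT; have bT := coarse_span_bounded hT.
  move: S hS; apply: lin_span_ind => [|c _ S [x [y [Dx Dy ->]]] IH].
    rewrite (_ : _ \o T = 0) //; exact: lin_span0.
  rewrite (_ : _ \o T = c *: (u x y \o T) + (S \o T)) //.
  apply: lin_spanD => //; apply: lin_spanZ.
  have bu := coarse_gen_bounded (DM Dx) (DM Dy).
  move: T hT {bT IH}; apply: lin_span_ind => [|c' _ T [x' [y' [Dx' Dy' ->]]] IH].
    rewrite (_ : _ \o _ = 0); first exact: lin_span0.
    by apply/funext => v /=; rewrite (lin0 bu.1).
  rewrite (_ : _ \o _ = c' *: (u x y \o u x' y') + (u x y \o T)).
    apply: lin_spanD => //; apply: lin_spanZ; rewrite coarse_gen_comp; try exact: DM.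
    by apply: lin_span_gen; exists (x \o x'), (y' \o y); split=> //; exact: D_comp.
  by apply/funext => v /=; rewrite !fctE (lin_add bu.1) (lin_scale bu.1).
(* Boundedness accompanies the induction because additivity of [adj] requires it. *)
- move=> T hT; suff : bounded_op T /\ coarse_span M eta t D (adj T) by case.
  move: T hT; apply: lin_span_ind => [|c _ T [x [y [Dx Dy ->]]] [bT IH]].
    split; first exact: bounded_op0.
    rewrite (_ : adj _ = 0); first exact: lin_span0.
    by apply: adj_uniq => [|v w]; [exact: bounded_op0|rewrite dotp0l dotp0r].
  have bu := coarse_gen_bounded (DM Dx) (DM Dy).
  split; first by apply: bounded_opD => //; exact: bounded_opZ.
  rewrite adjD ?adjZ //; last exact: bounded_opZ.
  apply: lin_spanD => //; apply/lin_spanZ/lin_span_gen.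
  exists (adj x), (adj y); split; [exact: D_adj|exact: D_adj|].
  by rewrite coarse_gen_adj //; exact: DM.
Qed.

(** The same [x] and [y] must approximate on both sides, since the image of the tensor operator is
    later compared with [Lm a \o Rm b]. *)
Lemma coarse_approx a b (e : R) : 0 < e -> norm_closure D a -> norm_closure D b ->
  exists x y, [/\ D x, D y, nrm_le e (u a b - u x y) &
    nrm_le e ((Lm a \o Rm b) - (Lm x \o Rm y))].
Proof.
move=> e0 cDa cDb; have Ma := norm_closure_subM DM cDa.
have Mb := norm_closure_subM DM cDb.
have [ba ha] := (norm_closureP _ _).1 cDa; have [bb hb] := (norm_closureP _ _).1 cDb.
have [Ca Ca0 hCa] := bounded_op_bound ba; have [Cb Cb0 hCb] := bounded_op_bound bb.
(* Both errors are at most [q * (Ca + Cb + q)]. The summand [e] in the denominator forces [q <= 1],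
   so that this is at most [e]. *)
pose q := e / (Ca + Cb + 1 + e).
have q1 : 0 < Ca + Cb + 1 + e by rewrite !addr_gt0.
have q0 : 0 < q by rewrite divr_gt0.
have qle1 : q <= 1 by rewrite ler_pdivrMr // mul1r; lra.
have [x Dx ax] := ha _ q0; have [y Dy by_] := hb _ q0.
have Mx := DM Dx; have My := DM Dy.
have hCx : nrm_le (Ca + q) x.
  rewrite -[x](subKr a); exact: nrm_leB hCa ax.
have small : q * Cb + (Ca + q) * q <= e.
  have -> : q * Cb + (Ca + q) * q = q * (Cb + Ca + q) by ring.
  have h : q * (Ca + Cb + 1 + e) = e by rewrite divfK // gt_eqF.
  by rewrite -[leRHS]h ler_wpM2l ?(ltW q0) //; lra.
have Cq0 : 0 <= Ca + q by rewrite addr_ge0 // ltW.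
have Mq := ltW q0.
exists x, y; split=> //; apply: (nrm_le_mono small).
  have -> : u a b - u x y = u (a - x) b + u x (b - y).
    by rewrite coarse_gen_subl // coarse_gen_subr // addrA subrK.
  apply: nrm_leD.
    by case: (coarse_gen_spec Mq (ltW Cb0) (M_sub Ma Mx) Mb ax hCb).
  by case: (coarse_gen_spec Cq0 Mq Mx (M_sub Mb My) hCx by_).
have -> : (Lm a \o Rm b) - (Lm x \o Rm y) =
    (Lm (a - x) \o Rm b) + (Lm x \o Rm (b - y)).
  rewrite (L2_left_sub hM htau hL2 Ma Mx) (L2_right_sub hM htau hL2 Mb My).
  apply/funext => v; rewrite !fctE /= (lin_sub (Lm_bounded Mx).1).
  by rewrite addrA subrK.
apply: nrm_leD; apply: nrm_le_comp => //.
- exact: (L2_left_nrm_le hM htau hL2 Mq (M_sub Ma Mx) ax).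
- exact: (L2_right_nrm_le hM htau hL2 (ltW Cb0) Mb hCb).
- exact: (L2_left_nrm_le hM htau hL2 Cq0 Mx hCx).
- exact: (L2_right_nrm_le hM htau hL2 Mq (M_sub Mb My) by_).
Qed.

Lemma coarse_gen_closure a b : norm_closure D a -> norm_closure D b ->
  norm_closure (coarse_span M eta t D) (u a b).
Proof.
move=> cDa cDb; apply/norm_closureP; split=> [|e e0].
  by apply: coarse_gen_bounded; exact: norm_closure_subM cDa || exact: norm_closure_subM cDb.
have [x [y [Dx Dy h _]]] := coarse_approx e0 cDa cDb.
by exists (u x y) => //; apply: lin_span_gen; exists x, y.
Qed.

(** The homomorphism is given over [cA] only; this inclusion lets its extension by continuity reach
    the minimal tensor product of the closure. *)
Lemma min_tensor_op_closure :
  min_tensor_op M eta t (norm_closure D) `<=` norm_closure (coarse_span M eta t D).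
Proof.
move=> T /norm_closureP[bT hT]; apply/norm_closureP; split=> // e e0.
have e2 : 0 < e / 2 by rewrite divr_gt0.
have [S hS TS] := hT _ e2.
suff /norm_closureP[_ /(_ _ e2)[S' hS' SS']] : norm_closure (coarse_span M eta t D) S.
  exists S' => //; rewrite (_ : T - S' = (T - S) + (S - S')); last by rewrite addrA subrK.
  by rewrite (_ : e = e / 2 + e / 2); [exact: nrm_leD|field].
move: S hS {TS}; apply: lin_span_ind => [|c _ S [x [y [Dx Dy ->]]] IH].
  exact/(norm_closure_sub coarse_span_bounded)/lin_span0.
apply: (norm_closureD coarse_span_star) => //.
apply: (norm_closureZ coarse_span_star); exact: coarse_gen_closure.
Qed.

End Subalgebra.
End Coarse.

(** * Compressions *)

Section Compression.
Context {R : realType} {H K L : hilbertType R} {D : set (H -> H)}.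
Context {Phi F : (H -> H) -> (K -> K)} {c : R} {V : L -> K} {zeta : H}.
Local Open Scope complex_scope.
Hypothesis hD : unital_star_subalgebra D.
Hypothesis hPhi : star_hom_on D Phi.
Hypothesis c0 : 0 <= c.
Hypothesis Phi_le : forall T (b : R), D T -> 0 <= b -> nrm_le b T -> nrm_le (c * b) (Phi T).
Hypothesis hF : forall T, norm_closure D T -> bounded_op (F T) /\
    forall S (b : R), D S -> 0 <= b -> nrm_le b (T - S) -> nrm_le (c * b) (F T - Phi S).
Hypothesis bV : bounded_op V.
Hypothesis V1 : nrm_le 1 V.

Definition compression_defect : L -> L := id - (adj V \o Phi id \o V).

(** A substitute for [zeta] being a unit vector, which also covers the zero space: there the defect
    vanishes. *)
Hypothesis hzeta : dotp zeta zeta *: compression_defect = compression_defect.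

Definition compression (T : H -> H) : L -> L :=
  (adj V \o F T \o V) + dotp (T zeta) zeta *: compression_defect.

Let bV' : bounded_op (adj V). Proof. exact: bounded_op_adj. Qed.
Let D_id : D id. Proof. by case: hD => _ []. Qed.
Let D_bounded T : D T -> bounded_op T. Proof. by case: hD => h _; exact: h. Qed.
Let P := Phi id.
Let bP : bounded_op P. Proof. by case: hPhi => h _ _ _; exact: h. Qed.
Let PP : P \o P = P.
Proof. by case: hPhi => _ _ h _; rewrite /P -h. Qed.
Let adjP' : adj P = P.
Proof. by case: hPhi => _ _ _ h; rewrite /P -h // adj_id. Qed.
Let dotPP x : dotp (P x) x = (nrm (P x) ^+ 2)%:C.
Proof. by rewrite -dotpp -{1}PP /= adjP // adjP'. Qed.

Lemma compression_defect_bounded : bounded_op compression_defect.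
Proof.
apply: bounded_opB; first exact: bounded_op_id.
by apply: bounded_op_comp => //; exact: bounded_op_comp.
Qed.

(** The diagonal is [|x|^2 - |P (V x)|^2], nonnegative since [P] is an orthogonal projection and [V]
    a contraction. *)
Lemma compression_defect_form :
  semi_inner (fun x y => dotp (compression_defect x) y).
Proof.
have bd := compression_defect_bounded.
split=> [x y z|a x y|x y|x].
- by rewrite (lin_add bd.1) dotpDl.
- by rewrite (lin_scale bd.1) dotpZl.
- rewrite -dotpC /compression_defect !fctE /= dotpBl dotpBr adjPr //.
  by rewrite -(adjP bV) -/P adjP // adjP'.
- rewrite /compression_defect !fctE /= dotpBl adjPr // -/P dotPP dotpp -rcN -rcD ler0c.
  rewrite subr_ge0 ler_sqr ?nnegrE ?nrm_ge0 //.
  have h : nrm (P (V x)) ^+ 2 <= nrm (P (V x)) * nrm (V x).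
    rewrite -[leLHS]/(complex.Re (nrm (P (V x)) ^+ 2)%:C) -dotPP.
    by rewrite (le_trans (ler_norm _)) // (le_trans (nrm_Re _)) // dotp_CS.
  have h1 := V1 x; rewrite mul1r in h1; apply: le_trans h1.
  have := nrm_ge0 (P (V x)); rewrite le0r => /orP[/eqP->|p0]; first exact: nrm_ge0.
  by rewrite -(ler_pM2l p0) -expr2.
Qed.

Lemma compression_bounded T : norm_closure D T -> bounded_op (compression T).
Proof.
move=> cT; have [bF _] := hF cT; apply: bounded_opD.
  by apply: bounded_op_comp => //; exact: bounded_op_comp.
exact/bounded_opZ/compression_defect_bounded.
Qed.

Lemma compression_linear : linear_on (norm_closure D) compression.
Proof.
have [FD FZ] := ext_linear hD hPhi c0 hF.
split=> [S T cS cT|a T cT]; apply/funext => x; rewrite /compression !fctE /=.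
  by rewrite FD // !fctE (lin_add bV'.1) dotpDl scalerDl addrACA.
by rewrite FZ // !fctE (lin_scale bV'.1) dotpZl [RHS]scalerDr scalerA.
Qed.

Lemma compression_id : compression id = id.
Proof.
rewrite /compression hzeta (ext_agree hD hF D_id).
by rewrite /compression_defect addrC subrK.
Qed.

(** For the correction term, the scalar matrix [dotp (X i j zeta) zeta] is positive, as tuples of
    multiples of [zeta] show, and [schur_psd] combines it with the form of the defect. *)
Lemma compression_ucp : ucp_on (norm_closure D) compression.
Proof.
split; last exact: compression_id.
split; [exact: compression_bounded|exact: compression_linear|].
move=> n X cX pX w; have bX i j : bounded_op (X i j) by case: (cX i j).
rewrite (_ : \sum_(i < n) _ =
   \sum_(i < n) \sum_(j < n) dotp (F (X i j) (V (w j))) (V (w i)) +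
   \sum_(i < n) \sum_(j < n)
     dotp (X i j zeta) zeta * dotp (compression_defect (w j)) (w i)).
  apply: addr_ge0.
    exact: (ext_completely_positive hD hPhi c0 Phi_le hF (fun i => V (w i)) cX pX).
  apply: (schur_psd compression_defect_form) => a.
  have := pX (fun i => a i *: zeta); congr (0 <= _).
  apply: eq_bigr => i _; apply: eq_bigr => j _.
  by rewrite (lin_scale (bX i j).1) dotpZl dotpZr; ring.
rewrite -big_split /=; apply: eq_bigr => i _; rewrite -big_split /=.
apply: eq_bigr => j _; rewrite mxE /compression !fctE /= dotpDl dotpZl.
by rewrite adjPr.
Qed.

Lemma compression_lipschitz : exists2 C : R, 0 <= C &
  forall T S (b : R), norm_closure D T -> D S -> 0 <= b -> nrm_le b (T - S) ->
    nrm_le (C * b) (compression T - compression S).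
Proof.
have [C C0 hC] := bounded_op_bound compression_defect_bounded.
have V1' := nrm_le_adj bV ler01 V1.
exists (c + nrm zeta ^+ 2 * C) => [|T S b cT DS b0 TS].
  by rewrite addr_ge0 // mulr_ge0 ?sqr_ge0 // ltW.
have h1 := (hF cT).2 S b DS b0 TS.
have -> : compression T - compression S =
   (adj V \o (F T - Phi S) \o V) + dotp ((T - S) zeta) zeta *: compression_defect.
  apply/funext => x; rewrite /compression (ext_agree hD hF DS) !fctE /=.
  rewrite (lin_sub bV'.1) dotpBl scalerBl.
  by apply: dotpP => w; rewrite !(dotpDr, dotpBr, dotpNr); ring.
rewrite mulrDl; apply: nrm_leD.
  have := nrm_le_comp (mulr_ge0 ler01 (mulr_ge0 c0 b0)) (nrm_le_comp ler01 V1' h1) V1.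
  by rewrite mulr1 mul1r.
apply: nrm_le_mono (nrm_leZ _ hC); rewrite mulrAC ler_wpM2r ?(ltW C0) //.
rewrite (le_trans (dotp_CS _ _)) // (le_trans (ler_wpM2r (nrm_ge0 _) (TS _))) //.
by rewrite le_eqVlt; apply/orP; left; apply/eqP; ring.
Qed.

End Compression.

Arguments compression_defect {R H K L} Phi V.
Arguments compression {R H K L} Phi F V zeta.

(** * The polar part of a Fredholm operator *)

Section Polar.
Context {R : realType} {L H : hilbertType R}.
Local Open Scope complex_scope.

Lemma compact_op_sum {K : hilbertType R} (n : nat) (T : 'I_n -> L -> K) :
  (forall i, compact_op (T i)) -> compact_op (\sum_(i < n) T i).
Proof. by move=> cT; elim/big_ind: _ => //; [exact: compact_op0|exact: compact_opD]. Qed.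

(** The commutator is the adjoint of [adj X \o S - S \o adj Y] followed on the right by [S], minus
    [adj S] applied to [X \o S - S \o Y]; hence both intertwining hypotheses. *)
Lemma commutator_gram_compact (S : L -> H) (X : H -> H) (Y : L -> L) :
  bounded_op S -> bounded_op X -> bounded_op Y ->
  compact_op ((X \o S) - (S \o Y)) ->
  compact_op ((adj X \o S) - (S \o adj Y)) ->
  compact_op (commutator (adj S \o S) Y).
Proof.
move=> bS bX bY c1 c2; have bS' := bounded_op_adj bS.
have bX' := bounded_op_adj bX; have bY' := bounded_op_adj bY.
have -> : commutator (adj S \o S) Y =
    (adj ((adj X \o S) - (S \o adj Y)) \o S) - (adj S \o ((X \o S) - (S \o Y))).
  rewrite adjB; try exact: bounded_op_comp.
  rewrite (adj_comp bX' bS) (adj_comp bS bY') (adjK bX) (adjK bY).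
  apply/funext => x; rewrite /commutator !fctE /=.
  rewrite (lin_sub bS'.1).
  by apply: dotpP => w; rewrite !(dotpDr, dotpBr, dotpNr); ring.
apply: compact_opB; first exact: (compact_op_compr (compact_op_adj c2) bS).
exact: compact_op_compl.
Qed.

(* [N] is the inverse square root of [S^* S + G], where [G] has finite rank. *)
Lemma fredholm_polar (S : L -> H) : bounded_op S -> fredholm (adj S \o S) ->
  exists N : L -> L, [/\ bounded_op N, nrm_le 1 (S \o N),
    compact_op (id - (adj (S \o N) \o (S \o N))) &
    forall Y, bounded_op Y -> compact_op (commutator (adj S \o S) Y) ->
      compact_op (commutator N Y)].
Proof.
move=> bS fS; have [n [u [C [C0 hC]]]] := fredholm_coercive bS fS.
have bS' := bounded_op_adj bS.
pose G : L -> L := \sum_(i < n) (fun x => dotp x (u i) *: u i).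
have cG : compact_op G by apply: compact_op_sum => i; exact: compact_op_rank1.
have bG := compact_op_bounded cG.
have GE x y : dotp (G x) y = \sum_(i < n) dotp x (u i) * dotp (u i) y.
  by rewrite /G fct_sumE dotp_suml; apply: eq_bigr => i _; rewrite dotpZl.
have Gpos z : dotp (G z) z = (\sum_(i < n) nrm (dotp z (u i)) ^+ 2)%:C.
  rewrite GE; elim/big_ind2: _ => [//|a b c d -> ->|i _]; first by rewrite rcD.
  by rewrite (dotpC z (u i)) mul_conj.
have sG : symmetric_op G.
  move=> x y; rewrite [RHS]dotpC !GE rmorph_sum; apply: eq_bigr => i _.
  by rewrite rmorphM /= -!dotpC mulrC.
pose F := (adj S \o S) + G.
have bSS : bounded_op (adj S \o S) by exact: bounded_op_comp.
have bF : bounded_op F by exact: bounded_opD.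
have sF : symmetric_op F.
  by move=> x y; rewrite /F !fctE dotpDl dotpDr sG /= adjPr // adjP.
have C2 : 0 < C ^- 2 by rewrite invr_gt0 exprn_gt0.
have posF z : C ^- 2 * nrm z ^+ 2 <= complex.Re (dotp (F z) z).
  by rewrite /F !fctE dotpDl /= adjPr // dotpp Gpos -rcD /= ler_pdivrMl ?exprn_gt0.
have [N [bN sN NFN hN]] := inverse_sqrt bF sF C2 posF.
have bV : bounded_op (S \o N) by exact: bounded_op_comp.
have adjN : adj N = N by apply: adj_uniq.
(* Since [N (S^* S + G) N = 1], the defect is [N G N]. Positivity of [G] makes [S \o N] a
   contraction, and its finite rank makes the defect compact. *)
have VV : id - (adj (S \o N) \o (S \o N)) = N \o G \o N.
  rewrite (adj_comp bS bN) adjN; apply/funext => x.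
  have NF : N (F (N x)) = x by exact: (congr1 (@^~ x) NFN).
  rewrite -[LHS]/(x - N (adj S (S (N x)))) -{1}NF.
  by rewrite (_ : F (N x) = adj S (S (N x)) + G (N x)) // (lin_add bN.1) addrAC subrr add0r.
exists N; split=> //.
- move=> x; rewrite mul1r -ler_sqr ?nnegrE ?nrm_ge0 // -lecR -!dotpp.
  have : 0 <= dotp ((id - (adj (S \o N) \o (S \o N))) x) x.
    rewrite VV /= sN Gpos ler0c sumr_ge0 // => i _; exact: sqr_ge0.
  by rewrite !fctE /= dotpBl subr_ge0 -[adj _ _]/(adj (S \o N) ((S \o N) x)) adjPr.
- by rewrite VV; apply: compact_op_compr => //; exact: compact_op_compl.
move=> Y bY cY; apply: hN => //.
have -> : commutator F Y = commutator (adj S \o S) Y + ((G \o Y) - (Y \o G)).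
  apply/funext => x; rewrite /commutator /F !fctE /= (lin_add bY.1).
  by apply: dotpP => w; rewrite !(dotpDr, dotpBr, dotpNr); ring.
apply: compact_opD => //; apply: compact_opB; first exact: compact_op_compr.
exact: compact_op_compl.
Qed.

End Polar.

(** * The completely positive map and its compactness property *)

Lemma ucp_on_subset {R : realType} {H K : hilbertType R} (D D' : set (H -> H))
    (f : (H -> H) -> (K -> K)) : D `<=` D' -> ucp_on D' f -> ucp_on D f.
Proof.
move=> DD' [[hb [hD hZ] hp] hi]; split=> //; split=> [T /DD'||n X hX].
- exact: hb.
- by split=> [S T /DD' hS /DD' hT|c T /DD' hT]; [exact: hD|exact: hZ].
- by apply: hp => i j; exact: DD'.
Qed.

Theorem proposition5p2 (R : realType)
  (K : hilbertType R) (M : set (K -> K)) (tau : (K -> K) -> R[i])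
  (hM : von_neumann_algebra M) (htau : faithful_normal_trace M tau)
  (* LL is L2 (x) L2 *)
  (L2 : hilbertType R) (eta : (K -> K) -> L2) (hL2 : is_L2_space M tau eta)
  (LL : hilbertType R) (t : L2 -> L2 -> LL) (ht : is_hilbert_tensor t)
  (cA : set (K -> K)) (hcA : unital_star_subalgebra cA) (hcAM : cA `<=` M)
  (hdense : M `<=` sigma_weak_closure cA)
  (A : set (K -> K)) (hA : A = norm_closure cA)
  (H : hilbertType R) (lft rgt : (K -> K) -> (H -> H))
  (hH : bimodule cA lft rgt)
  (d : (K -> K) -> H) (hd : derivation_on cA lft rgt d)
  (hclos : closable_on eta cA d)
  (I : countType) (e : I -> (K -> K)) (he : linear_basis cA e)
  (heo : orthonormal_family (fun i => eta (e i)))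
  (S : (K -> K) -> H) (hSlin : linear_on cA S)
  (hS1 : forall i, d (e i) <> 0 -> S (e i) = `|d (e i)|^-1 *: d (e i))
  (hS0 : forall i, d (e i) = 0 -> `|S (e i)| = 1)
  (hweak : weakly_contained_in_coarse M eta t cA lft rgt)
  (* Sb is the bounded extension of S to L2 *)
  (Sb : L2 -> H) (hSb : bounded_op Sb)
  (hSbS : forall a, cA a -> Sb (eta a) = S a)
  (hfred : fredholm (adj Sb \o Sb))
  (hcomp : forall x y, cA x -> cA y ->
     compact_op (fun xi : L2 =>
       lft x (rgt y (Sb xi)) - Sb (L2_left M eta x (L2_right M eta y xi)))) :
  exists theta : (LL -> LL) -> (L2 -> L2),
    ucp_on (min_tensor_op M eta t A) theta /\
    forall a b, A a -> A b ->
      compact_op (theta (tensor_op t (L2_left M eta a) (L2_right M eta b))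
                  - (L2_left M eta a \o L2_right M eta b)).
Proof.
have hAM : norm_closure cA `<=` M := norm_closure_subM hM hcAM.
have [_ [cA_id _ _ _ cA_adj]] := hcA.
pose Lm := L2_left M eta; pose Rm := L2_right M eta.
pose U x y := tensor_op t (Lm x) (Rm y).
have bL x : M x -> bounded_op (Lm x) by move=> Mx; exact: (L2_left_bounded hM htau hL2 Mx).
have bR x : M x -> bounded_op (Rm x) by move=> Mx; exact: (L2_right_bounded hM htau hL2 Mx).
have [Phi [hPhi [c c0 hc] hPhiE]] := hweak.
have cE := ge0E c0; set c' := complex.Re c in cE.
have c'0 : 0 <= c' by rewrite -ler0c -cE.
set D := coarse_span M eta t cA in hPhi hc.
have Phi_le T (b : R) : D T -> 0 <= b -> nrm_le b T -> nrm_le (c' * b) (Phi T).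
  move=> DT b0 hT; apply/norm_le_real; rewrite rcM -cE.
  by apply: hc => //; [rewrite ler0c|exact/norm_le_real].
have hD : unital_star_subalgebra D by exact: (coarse_span_star hM htau hL2 ht hcA hcAM).
have [F hF] := hom_extension hD hPhi Phi_le.
have [N [bN V1 cV hN]] := fredholm_polar hSb hfred.
set V := Sb \o N in V1 cV.
have bV : bounded_op V by exact: bounded_op_comp.
have bV' := bounded_op_adj bV.
(* A simple tensor [t x x] has norm [nrm x ^+ 2], which explains the scaling. If [L2] is zero, then
   so is the defect, and [0] will do. *)
have [zeta hzeta] : exists zeta : LL,
    dotp zeta zeta *: compression_defect Phi V = compression_defect Phi V.
  have [[x x0]|triv] := pselect (exists x : L2, x <> 0).
    have nx : 0 < nrm x by rewrite lt_def nrm_ge0 andbT; apply/eqP => /nrm_eq0.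
    exists (real_complex R (nrm x ^- 2) *: t x x); case: ht => _ _ tE _.
    rewrite dotpZl dotpZr conjC_real tE dotpp -!rcM (_ : _ * _ = 1) ?scale1r //.
    by field; rewrite gt_eqF.
  exists 0; apply/funext => x; apply: contrapT => h; apply: triv.
  by exists (compression_defect Phi V x) => d0; apply: h; rewrite !fctE d0 scaler0.
have bX x y : cA x -> cA y -> bounded_op (lft x \o rgt y).
  move=> cx cy; case: hH => [[hl _ _ _] [hr _ _ _] _].
  by apply: bounded_op_comp; [exact: hl|exact: hr].
have bY x y : M x -> M y -> bounded_op (Lm x \o Rm y).
  by move=> Mx My; apply: bounded_op_comp; [exact: bL|exact: bR].
have cXY x y : cA x -> cA y ->
    compact_op (((lft x \o rgt y) \o Sb) - (Sb \o (Lm x \o Rm y))).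
  by move=> cx cy; exact: hcomp.
have adjX x y : cA x -> cA y -> adj (lft x \o rgt y) = lft (adj x) \o rgt (adj y).
  move=> cx cy; case: hH => [[hl _ _ hla] [hr _ _ hra] hlr].
  rewrite (adj_comp (hl _ cx) (hr _ cy)) -(hla _ cx) -(hra _ cy).
  by rewrite (hlr _ _ (cA_adj _ cx) (cA_adj _ cy)).
have adjY x y : M x -> M y -> M (adj x) -> M (adj y) ->
    adj (Lm x \o Rm y) = Lm (adj x) \o Rm (adj y).
  move=> Mx My Mx' My'; rewrite (adj_comp (bL _ Mx) (bR _ My)).
  rewrite (L2_left_adj hM htau hL2 Mx) (L2_right_adj hM htau hL2 My).
  by rewrite (L2_comm hM htau hL2).
have cNY x y : cA x -> cA y -> compact_op (commutator N (Lm x \o Rm y)).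
  move=> cx cy; have Mx := hcAM _ cx; have My := hcAM _ cy.
  have cx' := cA_adj _ cx; have cy' := cA_adj _ cy.
  apply: hN; first exact: bY.
  apply: (commutator_gram_compact hSb (bX _ _ cx cy)) => //; first exact: bY.
    exact: cXY.
  by rewrite adjX // adjY //; [exact: cXY|exact: hcAM|exact: hcAM].
have FU x y : cA x -> cA y -> F (U x y) = lft x \o rgt y.
  move=> cx cy; rewrite (ext_agree hD hF); first exact: hPhiE.
  by apply: lin_span_gen; exists x, y.
(* The compactness hypothesis at [x = y = id] says that [Phi id] fixes the range of [Sb] up to a
   compact operator. *)
have cdef : compact_op (compression_defect Phi V).
  have P1 : Phi id = lft id \o rgt id.
    by rewrite -(hPhiE _ _ cA_id cA_id) (coarse_gen_id hM htau hL2 ht).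
  have -> : compression_defect Phi V = (id - (adj V \o V)) -
     (adj V \o ((((lft id \o rgt id) \o Sb) - (Sb \o (Lm id \o Rm id))) \o N)).
    apply/funext => z; rewrite /compression_defect P1 /Lm /Rm.
    rewrite (L2_left_id hM htau hL2) (L2_right_id hM htau hL2) !fctE /=.
    rewrite (lin_sub bV'.1) -[Sb (N z)]/(V z).
    by apply: dotpP => w; rewrite !(dotpDr, dotpBr, dotpNr); ring.
  apply: compact_opB cV (compact_op_compl bV' (compact_op_compr _ bN)).
  exact: cXY.
have cU x y : cA x -> cA y -> compact_op (compression Phi F V zeta (U x y) - (Lm x \o Rm y)).
  move=> cx cy; have bXxy := bX _ _ cx cy.
  rewrite /compression (FU _ _ cx cy); set X := lft x \o rgt y in bXxy *.
  set Y := Lm x \o Rm y.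
  have bYxy : bounded_op Y by apply: bY; exact: hcAM.
  set s := dotp _ _.
  (* The bracket under [adj V] is [X V - V Y], split into the intertwining defect of [Sb] and the
     commutator of [N] with [Y]. *)
  have -> : (adj V \o X \o V) + s *: compression_defect Phi V - Y =
     (adj V \o (((((X \o Sb) - (Sb \o Y)) \o N) - (Sb \o commutator N Y))))
     - ((id - (adj V \o V)) \o Y) + s *: compression_defect Phi V.
    apply/funext => z; rewrite !fctE /= /commutator !fctE /=.
    rewrite (lin_sub hSb.1) -[Sb (N z)]/(V z) -[Sb (N (Y z))]/(V (Y z)) !(lin_sub bV'.1).
    by apply: dotpP => w; rewrite !(dotpDr, dotpBr, dotpNr); ring.
  apply: compact_opD; last exact: compact_opZ.
  apply: compact_opB; last exact: compact_op_compr.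
  apply: compact_op_compl => //; apply: compact_opB.
    by apply: compact_op_compr => //; exact: cXY.
  by apply: compact_op_compl => //; exact: cNY.
exists (compression Phi F V zeta); split.
  apply: ucp_on_subset (compression_ucp hD hPhi c'0 Phi_le hF bV V1 hzeta).
  by rewrite hA; exact: (min_tensor_op_closure hM htau hL2 ht hcA hcAM).
rewrite hA => a b Aa Ab; have cUab := coarse_gen_closure hM htau hL2 ht hcAM Aa Ab.
have [C C0 hC] := compression_lipschitz (zeta := zeta) hD hPhi c'0 hF bV V1.
apply: compact_op_limit => [|r r0].
  apply: bounded_opB; first exact: (compression_bounded hD hPhi hF bV cUab).
  by apply: bY; exact: hAM.
have C1 : 0 < C + 1 by rewrite ltr_wpDl.
(* Of the error [r], the map accounts for [C] shares and the operator [Lm a \o Rm b] for one. *)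
have r1 : 0 < r / (C + 1) by rewrite divr_gt0.
have [x [y [cx cy hU hY]]] := coarse_approx hM htau hL2 ht hcAM r1 Aa Ab.
exists (compression Phi F V zeta (U x y) - (Lm x \o Rm y)); first exact: cU.
have DU : D (U x y) by apply: lin_span_gen; exists x, y.
rewrite (_ : r = C * (r / (C + 1)) + r / (C + 1)); last by field; rewrite gt_eqF.
rewrite (_ : _ - _ = (compression Phi F V zeta (U a b) - compression Phi F V zeta (U x y))
   - ((Lm a \o Rm b) - (Lm x \o Rm y))).
  by apply: nrm_leB => //; apply: hC => //; exact: ltW.
by apply/funext => z; rewrite !fctE; apply: dotpP => w;
  rewrite !(dotpDr, dotpBr, dotpNr); ring.
Qed.
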